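(* For each $n\in\mathbb{N}$ the shifted zeta function of real projective space satisfies the following identities: $$\zeta_{\mathbb{RP}^{2n-1}}(s,\lambda_{2n-1})=\sum_{i=1}^{n}\bar u(n-1,i-1)\left(\tau_n-(-1)^n2^{2i-2s-2}\right)\zeta(2s-2i+2)-(n-1)^{-2s},$$ $$\zeta_{\mathbb{RP}^{2n}}(s,\lambda_{2n})=\sum_{i=1}^{n}\bar v(n,i)\,2^{4i-2s-2}\,\zeta\left(2s-2i+1,\tfrac54+\tfrac{\tau_n}{2}\right)-\gamma_n\left[\frac{2}{2n-1}\right]^{2s},$$ where $\gamma_n=0$ if $n=1,2$ and $\gamma_n=1$ otherwise, and $\tau_n=0$ if $n$ is odd and $\tau_n=1$ if $n$ is even. The determinant of the Laplacian on odd- and even-dimensional real projective spaces, $\mathbb{RP}^{2n-1}$ and $\mathbb{RP}^{2n}$ respectively, satisfies $$\zeta'_{\mathbb{RP}^{2n-1}}(0)=-\log\left[\det\left(\mathbb{RP}^{2n-1}\right)\right]=\frac{1}{(2n-2)!}\sum_{k=0}^{n-1}2^{2k+1}\zeta'(-2k)\left[s(2n-1,2k+1)+s(2n-2,2k)\right]+\log(4(n-1)),$$ $$\zeta'_{\mathbb{RP}^{2n}}(0)=-\log\left[\det\left(\mathbb{RP}^{2n}\right)\right]=\frac{1}{(2n-1)!}\sum_{k=0}^{2n-1}\left(1-\tau_k2^{k+1}\right)\zeta'(-k)\left[s(2n,k+1)+s(2n-1,k)\right]+\log(4n-2)+\sum_{i=1}^{n}\bar v(n,i)\frac{(2n-1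)^{2i}}{4i}\left(\frac{H_{i-1}}{2}-H_{2i-1}\right).$$
   Context: $\mathbb{N}=\{1,2,3,\dots\}$. $\zeta(s)$ is the Riemann zeta function, $\zeta(s,a)=\sum_{j\ge0}(j+a)^{-s}$ the Hurwitz zeta function (both meromorphically continued), $\zeta'$ the derivative of $\zeta$, and $H_m=\sum_{k=1}^m\frac1k$ (with $H_0=0$). For $N\ge1$, the eigenvalues of the Laplacian on real projective space $\mathbb{RP}^N$ (quotient of the unit sphere) are $2k(2k+N-1)$, with multiplicities $m_k^N=\binom{N+2k}{2k}-\binom{N+2k-2}{2k-2}$, $k=0,1,2,\dots$; the nonzero ones correspond to $k\ge1$. The spectral zeta function is $\zeta_{\mathbb{RP}^N}(s)=\sum_{k\ge1}m_k^N(2k(2k+N-1))^{-s}$ for $\mathrm{Re}(s)$ large, extended meromorphically to $\mathbb{C}$; it is analytic at $0$ and $\det(\mathbb{RP}^N):=e^{-\zeta'_{\mathbb{RP}^N}(0)}$. With $\lambda_N=\left(\frac{N-1}{2}\right)^2$, the shifted zeta function is (the meromorphic continuation of) $\zeta_{\mathbb{RP}^N}(s,\lambda_N):=\sum_{k\ge1}m_k^N\left(2k+\frac{N-1}{2}\right)^{-2s}$. The (signed) Stirling numbers of the first kind $s(n,k)$ are defined by $x(x-1)\cdots(x-n+1)=\sum_{k=0}^ns(n,k)x^k$ (the left-hand side being $1$ for $n=0$). The central factorial numbers $u$ and $v$ are given for $n\ge1$ by $\sum_{k=1}^nu(n,k)x^k=\prod_{i=0}^{n-1}(x-i^2)$ with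 $u(n,0)=0$, and $\sum_{k=1}^nv(n,k)x^k=x\prod_{i=1}^{n-1}(x-(2i-1)^2)$; also $u(0,0)=1$. Moreover $\bar u(n,k):=\frac{2}{(2n)!}u(n,k)$ and $\bar v(n,k):=\frac{4^{-(n-1)}}{(2n-1)!}v(n,k)$.
   Formalization: The determinant formula for odd-dimensional projective space is stated for n ≥ 2 only, since at n = 1 its term log(4(n-1)) is log 0 and undefined; in the first shifted identity the term (n-1)^{-2s} at n = 1 is read as 0. *)

(* Defs.v *)
(* Stdlib reals with Coquelicot's complex numbers; [C] is [Complex.C]. *)
From Stdlib Require Import Reals Factorial List Lia.
From Coquelicot Require Import Coquelicot.
Import ListNotations.
Open Scope R_scope.

Definition Cexp (z : C) : C := (exp (Re z) * cos (Im z), exp (Re z) * sin (Im z)).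

(* x ^ s for a real base x >= 0.  The base 0 is given the value 0 for every
   exponent: it occurs only as (n-1)^(-2s) with n = 1, where 0^(-2s) = 0 is the
   value for Re s < 0 and hence, by continuation, for all s. *)
Definition Rcpow (x : R) (s : C) : C :=
  if Rlt_dec 0 x then Cexp (s * ln x)%C else RtoC 0.

Definition analytic_at (f : C -> C) (a : C) : Prop :=
  exists (c : nat -> C) (r : R), 0 < r /\
    forall h : C, Cmod h < r ->
      @is_pseries C_AbsRing C_NormedModule c h (f (a + h)%C).

Definition pole_at (f : C -> C) (a : C) : Prop :=
  exists (m : nat) (g : C -> C) (r : R),
    (0 < m)%nat /\ analytic_at g a /\ g a <> RtoC 0 /\ 0 < r /\
    forall h : C, 0 < Cmod h < r -> f (a + h)%C = (g (a + h) / h ^ m)%C.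

(* Removable singularities are required to be filled in; the value of [f] at a
   genuine pole is arbitrary. *)
Definition meromorphic (f : C -> C) : Prop :=
  forall a : C, analytic_at f a \/ pole_at f a.

(* [F] is the meromorphic continuation of s |-> sum_{k >= 0} term s k, a series
   converging to [F s] for Re s large. *)
Definition meromorphic_continuation (term : C -> nat -> C) (F : C -> C) : Prop :=
  meromorphic F /\
  exists sigma : R, forall s : C, sigma < Re s ->
    @is_series C_AbsRing C_NormedModule (term s) (F s).

Definition is_riemann_zeta : (C -> C) -> Prop :=
  meromorphic_continuation (fun s k => Rcpow (INR (S k)) (- s)%C).

Definition is_hurwitz_zeta (a : R) : (C -> C) -> Prop :=
  meromorphic_continuation (fun s j => Rcpow (INR j + a) (- s)%C).

Definition RP_eigenvalue (N k : nat) : R :=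
  2 * INR k * (2 * INR k + INR N - 1).

(* Only used for k >= 1, so that the natural number subtractions are exact. *)
Definition RP_mult (N k : nat) : R :=
  Binomial.C (N + 2 * k) (2 * k) - Binomial.C (N + 2 * k - 2) (2 * k - 2).

(* The sums over k >= 1 are reindexed by k = S j, j >= 0. *)
Definition is_RP_zeta (N : nat) : (C -> C) -> Prop :=
  meromorphic_continuation
    (fun s j => RP_mult N (S j) * Rcpow (RP_eigenvalue N (S j)) (- s))%C.

(* The shift lambda_N = ((N-1)/2)^2 completes the square:
   2k(2k+N-1) + lambda_N = (2k + (N-1)/2)^2. *)
Definition is_RP_shifted_zeta (N : nat) : (C -> C) -> Prop :=
  meromorphic_continuation
    (fun s j => RP_mult N (S j)
                * Rcpow (2 * INR (S j) + (INR N - 1) / 2) (- (2 * s)))%C.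

Definition zeta_det (Z : C -> C) : C := Cexp (- C_derive Z 0)%C.

(* [roots_coef rs k] is the coefficient of x^k in the product of the x - r over
   r in [rs], computed by multiplying out one factor at a time
   (see [roots_coefE]). *)
Fixpoint roots_coef (rs : list R) (k : nat) : R :=
  match rs with
  | [] => match k with O => 1 | S _ => 0 end
  | r :: rs' =>
      match k with O => 0 | S k' => roots_coef rs' k' end - r * roots_coef rs' k
  end.

Definition stirling1 (n k : nat) : R :=
  roots_coef (map INR (seq 0 n)) k.

Definition cfu (n k : nat) : R :=
  roots_coef (map (fun i => INR i ^ 2) (seq 0 n)) k.

Definition cfv (n k : nat) : R :=
  roots_coef (0 :: map (fun i => (2 * INR i - 1) ^ 2) (seq 1 (n - 1))) k.

Definition ubar (n k : nat) : R := 2 / INR (fact (2 * n)) * cfu n k.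

Definition vbar (n k : nat) : R :=
  / 4 ^ (n - 1) / INR (fact (2 * n - 1)) * cfv n k.

Definition harmonic (m : nat) : R := sum_n_m (fun k => / INR k) 1 m.

Definition tau (n : nat) : R := if Nat.even n then 1 else 0.

Definition gamma (n : nat) : R := if Nat.leb n 2 then 0 else 1.

Definition Csum (f : nat -> C) (a b : nat) : C := @sum_n_m C_Ring f a b.

Lemma roots_coef_gt rs k : (length rs < k)%nat -> roots_coef rs k = 0.
Proof.
revert k; induction rs as [|r rs IH]; intros [|k] Hk; simpl in *; try lia; try reflexivity.
rewrite !IH by lia; ring.
Qed.

Lemma roots_coefE rs x :
  sum_n_m (fun k => roots_coef rs k * x ^ k) 0 (length rs)
  = fold_right Rmult 1 (map (fun r => x - r) rs).
Proof.
induction rs as [|r rs IH]; simpl length.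
  now rewrite sum_n_n; simpl; ring.
simpl map; simpl fold_right; rewrite <- IH.
rewrite sum_Sn_m by lia.
rewrite (sum_n_m_ext_loc _ (fun k => plus (scal x (roots_coef rs (pred k) * x ^ pred k))
                                         (scal (- r) (roots_coef rs k * x ^ k)))).
2: { intros [|k] Hk; [lia|]; unfold plus, scal; simpl; unfold mult; simpl; ring. }
rewrite sum_n_m_plus, !sum_n_m_scal_l, <- sum_n_m_S; simpl pred.
assert (H : sum_n_m (fun k => roots_coef rs k * x ^ k) 1 (S (length rs))
            = sum_n_m (fun k => roots_coef rs k * x ^ k) 0 (length rs) - roots_coef rs 0).
{ rewrite sum_n_Sm by lia; rewrite roots_coef_gt by lia.
  rewrite (sum_Sn_m _ 0) by lia; unfold plus; simpl; ring. }
match goal with |- ?L = _ =>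
  change L with (roots_coef (r :: rs) 0 * x ^ 0
    + (x * sum_n_m (fun k => roots_coef rs k * x ^ k) 0 (length rs)
       + - r * sum_n_m (fun k => roots_coef rs k * x ^ k) 1 (S (length rs)))) end.
rewrite H; simpl; ring.
Qed.

Lemma stirling1E n x :
  sum_n_m (fun k => stirling1 n k * x ^ k) 0 n
  = fold_right Rmult 1 (map (fun i => x - INR i) (seq 0 n)).
Proof.
pose proof (roots_coefE (map INR (seq 0 n)) x) as H.
now rewrite length_map, length_seq, map_map in H.
Qed.

Lemma cfuE n x :
  sum_n_m (fun k => cfu n k * x ^ k) 0 n
  = fold_right Rmult 1 (map (fun i => x - INR i ^ 2) (seq 0 n)).
Proof.
pose proof (roots_coefE (map (fun i => INR i ^ 2) (seq 0 n)) x) as H.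
now rewrite length_map, length_seq, map_map in H.
Qed.

Lemma cfu_n0 n : (1 <= n)%nat -> cfu n 0 = 0.
Proof. destruct n; [lia|]; intros _; unfold cfu; simpl; ring. Qed.

Lemma cfvE n x : (1 <= n)%nat ->
  sum_n_m (fun k => cfv n k * x ^ k) 0 n
  = x * fold_right Rmult 1 (map (fun i => x - (2 * INR i - 1) ^ 2) (seq 1 (n - 1))).
Proof.
intros Hn.
pose proof (roots_coefE (0 :: map (fun i => (2 * INR i - 1) ^ 2) (seq 1 (n - 1))) x) as H.
simpl length in H; rewrite length_map, length_seq in H.
replace (S (n - 1)) with n in H by lia.
simpl map in H; rewrite map_map in H; simpl fold_right in H.
now rewrite Rminus_0_r in H.
Qed.

Lemma cfv_n0 n : cfv n 0 = 0.
Proof. unfold cfv; simpl; ring. Qed.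

(* Main.v *)
(** All functions are handled as germs of power series with a bound on [sum |c_n| r^n]; such bounds
    multiply and add up along infinite sums, so uniform convergence never needs Cauchy's formula, and
    identities between meromorphic functions propagate from a half-plane by the isolation of zeros.

    Telescoping [(w + 1/2) ^ (1 - z) - (w - 1/2) ^ (1 - z)], expanded by the binomial series, yields a
    recursion for [(z - 1) zeta(z, c)], hence its regularity, the residue 1 and the trivial zeros.  The
    multiplicities are polynomials in [w = 2k + d], [d = (N - 1) / 2], in [w - d] and in [w + d]; the first
    form gives the shifted zeta function.  Since the eigenvalue is [(w - d)(w + d)], its power [- s] is the
    mean of [(w - d) ^ (- 2s)] and [(w + d) ^ (- 2s)] up to a term whose expansion in [d / w] has
    coefficients vanishing to second order at [s = 0].  The mean produces the values [zeta'(- k)] and the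
    logarithm; a second-order zero meeting a pole of the Hurwitz zeta function at 1 produces the harmonic
    numbers. *)
Require Import Defs.
From Stdlib Require Import Reals Factorial Lia Lra Classical ClassicalEpsilon Wf_nat List.
From Coquelicot Require Import Coquelicot.
Open Scope R_scope.

(** * Finite sums and series *)

(** The hypotheses provide arbitrary meromorphic continuations, whose values at poles carry no
    information. Identities are therefore proved on punctured neighbourhoods, and values are read
    off only where both sides are analytic. The half-integer shift cancels the even orders, so the
    recursion links z to z + 2, z + 4, ... and, for c = 1, closes on the nonpositive even integers,
    where the binomial series is finite. This yields the trivial zeros without a functional
    equation. Expanding the eigenvalues in w alone would leave derivatives of a Hurwitz zeta
    function with parameter 1 + d/2. The linear factors 2k and 2k + N - 1 run through integers
    instead, so their mean involves only the Riemann zeta function; of the auxiliary Hurwitz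
    function nothing but the residue reaches the derivative at 0. The logarithm of 2(N - 1) has two
    sources: ln 2 comes from zeta(0) = -1/2, and ln(N - 1) from the value 2k + N - 1 at k = 0, which
    is not in the spectrum although the multiplicity polynomial equals 1 there. *)

Fixpoint csum (f : nat -> C) (n : nat) : C :=
  match n with O => 0 | S m => (csum f m + f m)%C end.

Fixpoint rsum (f : nat -> R) (n : nat) : R :=
  match n with O => 0 | S m => rsum f m + f m end.

Definition clim (u : nat -> C) (l : C) : Prop :=
  forall eps : R, 0 < eps ->
    exists N, forall n, (N <= n)%nat -> Cmod (u n - l) < eps.

Definition cser (f : nat -> C) (l : C) : Prop := clim (csum f) l.

Lemma Cmod_sub_comm (a b : C) : Cmod (a - b) = Cmod (b - a).
Proof. rewrite <- Cmod_opp. f_equal. ring. Qed.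

Lemma Cmod_sub_triangle (a b c : C) : Cmod (a - c) <= Cmod (a - b) + Cmod (b - c).
Proof.
replace (a - c)%C with ((a - b) + (b - c))%C by ring. apply Cmod_triangle.
Qed.

Lemma Cmod_rev_triangle (a b : C) : Cmod a - Cmod b <= Cmod (a + b).
Proof.
generalize (Cmod_triangle (a + b) (- b)). rewrite Cmod_opp.
replace (a + b + - b)%C with a by ring. lra.
Qed.

Lemma Cmod_le_Re_Im (z : C) : Cmod z <= Rabs (Re z) + Rabs (Im z).
Proof.
assert (E : z = (RtoC (Re z) + Ci * RtoC (Im z))%C).
{ destruct z as [x y]. unfold Ci, RtoC, Cplus, Cmult; simpl. f_equal; ring. }
rewrite E at 1. eapply Rle_trans; [apply Cmod_triangle|].
rewrite Cmod_mult, Cmod_Ci, !Cmod_R. lra.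
Qed.

Lemma im_le_Cmod (z : C) : Rabs (Im z) <= Cmod z.
Proof.
eapply Rle_trans; [|apply Rmax_Cmod]. apply Rmax_r.
Qed.

Lemma clim_Re_Im (u : nat -> C) (l : C) :
  clim u l <->
  is_lim_seq (fun n => Re (u n)) (Re l) /\ is_lim_seq (fun n => Im (u n)) (Im l).
Proof.
split.
- intros H; split; apply is_lim_seq_spec; intros eps; destruct (H eps (cond_pos eps)) as [N HN];
    exists N; intros n Hn; specialize (HN n Hn).
  + eapply Rle_lt_trans; [|exact HN].
    replace (Re (u n) - Re l) with (Re (u n - l)) by reflexivity. apply re_le_Cmod.
  + eapply Rle_lt_trans; [|exact HN].
    replace (Im (u n) - Im l) with (Im (u n - l)) by reflexivity. apply im_le_Cmod.
- intros [H1 H2] eps Heps. apply is_lim_seq_spec in H1. apply is_lim_seq_spec in H2.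
  destruct (H1 (pos_div_2 (mkposreal eps Heps))) as [N1 HN1].
  destruct (H2 (pos_div_2 (mkposreal eps Heps))) as [N2 HN2].
  exists (max N1 N2). intros n Hn.
  specialize (HN1 n ltac:(lia)). specialize (HN2 n ltac:(lia)). simpl in HN1, HN2.
  eapply Rle_lt_trans; [apply Cmod_le_Re_Im|].
  change (Re (u n - l)) with (Re (u n) - Re l). change (Im (u n - l)) with (Im (u n) - Im l). lra.
Qed.

Lemma clim_ext (u v : nat -> C) (l : C) : (forall n, u n = v n) -> clim u l -> clim v l.
Proof. intros E H eps Heps. destruct (H eps Heps) as [N HN]. exists N. intros. rewrite <- E. auto. Qed.

Lemma clim_const (l : C) : clim (fun _ => l) l.
Proof. intros eps Heps. exists O. intros. replace (l - l)%C with (RtoC 0) by ring. rewrite Cmod_0. lra. Qed.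

Lemma clim_unique (u : nat -> C) (l l' : C) : clim u l -> clim u l' -> l = l'.
Proof.
rewrite !clim_Re_Im. intros [A B] [A' B'].
apply is_lim_seq_unique in A, B, A', B'. rewrite A in A'. rewrite B in B'.
inversion A'. inversion B'. destruct l, l'. simpl in *. unfold Re, Im in *. simpl in *. congruence.
Qed.

Lemma clim_plus (u v : nat -> C) (l l' : C) :
  clim u l -> clim v l' -> clim (fun n => u n + v n)%C (l + l')%C.
Proof.
rewrite !clim_Re_Im. intros [A B] [A' B']. split.
- apply (is_lim_seq_plus' _ _ _ _ A A').
- apply (is_lim_seq_plus' _ _ _ _ B B').
Qed.

Lemma clim_scal (u : nat -> C) (k l : C) : clim u l -> clim (fun n => k * u n)%C (k * l)%C.
Proof.
intros H eps Heps.
assert (P : 0 < Cmod k + 1) by (generalize (Cmod_ge_0 k); lra).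
destruct (H (eps / (Cmod k + 1))) as [N HN]; [apply Rdiv_lt_0_compat; lra|].
exists N. intros n Hn. specialize (HN n Hn).
replace (k * u n - k * l)%C with (k * (u n - l))%C by ring. rewrite Cmod_mult.
apply (Rmult_lt_compat_l _ _ _ P) in HN.
replace ((Cmod k + 1) * (eps / (Cmod k + 1))) with eps in HN by (field; lra).
generalize (Cmod_ge_0 (u n - l)); nra.
Qed.

Lemma clim_shift (u : nat -> C) (l : C) (K : nat) : clim (fun n => u (n + K)%nat) l -> clim u l.
Proof.
intros H eps Heps. destruct (H eps Heps) as [N HN]. exists (N + K)%nat. intros n Hn.
specialize (HN (n - K)%nat ltac:(lia)). replace (n - K + K)%nat with n in HN by lia. exact HN.
Qed.

Lemma clim_subseq (u : nat -> C) (l : C) (phi : nat -> nat) :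
  (forall n, (n <= phi n)%nat) -> clim u l -> clim (fun n => u (phi n)) l.
Proof.
intros P H eps Heps. destruct (H eps Heps) as [N HN]. exists N. intros n Hn.
apply HN. specialize (P n). lia.
Qed.

Lemma clim_Cmod (u : nat -> C) (l : C) : clim u l -> is_lim_seq (fun n => Cmod (u n)) (Cmod l).
Proof.
intros H. apply is_lim_seq_spec. intros eps. destruct (H eps (cond_pos eps)) as [N HN].
exists N. intros n Hn. eapply Rle_lt_trans; [|apply (HN n Hn)].
generalize (Cmod_rev_triangle (u n) (- l)) (Cmod_rev_triangle l (- u n)).
rewrite !Cmod_opp. replace (u n + - l)%C with (u n - l)%C by ring.
replace (l + - u n)%C with (l - u n)%C by ring. rewrite (Cmod_sub_comm l).
intros. apply Rabs_le. lra.
Qed.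

Lemma clim_bound (u : nat -> C) (l x : C) (M : R) (K : nat) :
  clim u l -> (forall n, (K <= n)%nat -> Cmod (u n - x) <= M) -> Cmod (l - x) <= M.
Proof.
intros H Hb. apply le_epsilon. intros eps Heps. destruct (H eps Heps) as [N HN].
specialize (HN (max N K) ltac:(lia)). specialize (Hb (max N K) ltac:(lia)).
rewrite Cmod_sub_comm in HN.
generalize (Cmod_sub_triangle l (u (max N K)) x). lra.
Qed.

Lemma csum_ext (f g : nat -> C) n : (forall k, (k < n)%nat -> f k = g k) -> csum f n = csum g n.
Proof. induction n; intros H; simpl; [reflexivity|]. rewrite IHn, H by (try intros; try apply H; lia). reflexivity. Qed.

Lemma csum_plus (f g : nat -> C) n : csum (fun k => f k + g k)%C n = (csum f n + csum g n)%C.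
Proof. induction n; simpl; [ring|]. rewrite IHn. ring. Qed.

Lemma csum_scal (x : C) (f : nat -> C) n : csum (fun k => x * f k)%C n = (x * csum f n)%C.
Proof. induction n; simpl; [ring|]. rewrite IHn. ring. Qed.

Lemma csum_zero (f : nat -> C) n : (forall k, (k < n)%nat -> f k = 0) -> csum f n = 0.
Proof. induction n; intros H; simpl; [reflexivity|]. rewrite IHn, H by (try intros; try apply H; lia). ring. Qed.

Lemma csum_recl (f : nat -> C) n : csum f (S n) = (f O + csum (fun k => f (S k)) n)%C.
Proof.
induction n; [simpl; ring|].
change (csum f (S (S n))) with (csum f (S n) + f (S n))%C. rewrite IHn. simpl. ring.
Qed.

Lemma csum_add (f : nat -> C) n m : csum f (n + m) = (csum f n + csum (fun k => f (n + k)%nat) m)%C.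
Proof.
induction m; [rewrite Nat.add_0_r; simpl; ring|].
rewrite Nat.add_succ_r. simpl. rewrite IHm. ring.
Qed.

Lemma rsum_ext (f g : nat -> R) n : (forall k, (k < n)%nat -> f k = g k) -> rsum f n = rsum g n.
Proof. induction n; intros H; simpl; [reflexivity|]. rewrite IHn, H by (try intros; try apply H; lia). reflexivity. Qed.

Lemma rsum_plus (f g : nat -> R) n : rsum (fun k => f k + g k) n = rsum f n + rsum g n.
Proof. induction n; simpl; [ring|]. rewrite IHn. ring. Qed.

Lemma rsum_scal (x : R) (f : nat -> R) n : rsum (fun k => x * f k) n = x * rsum f n.
Proof. induction n; simpl; [ring|]. rewrite IHn. ring. Qed.

Lemma rsum_le (f g : nat -> R) n : (forall k, (k < n)%nat -> f k <= g k) -> rsum f n <= rsum g n.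
Proof.
induction n; intros H; simpl; [lra|].
generalize (IHn ltac:(intros; apply H; lia)) (H n ltac:(lia)). lra.
Qed.

Lemma rsum_nonneg (f : nat -> R) n : (forall k, 0 <= f k) -> 0 <= rsum f n.
Proof. intros H; induction n; simpl; [lra|]. specialize (H n). lra. Qed.

Lemma rsum_incr (f : nat -> R) n m : (forall k, 0 <= f k) -> (n <= m)%nat -> rsum f n <= rsum f m.
Proof. intros H L. induction L; simpl; [lra|]. specialize (H m). lra. Qed.

Lemma rsum_term (f : nat -> R) n M : (forall k, 0 <= f k) -> (forall n, rsum f n <= M) -> f n <= M.
Proof. intros H B. specialize (B (S n)). simpl in B. generalize (rsum_nonneg f n H). lra. Qed.

Lemma Cmod_csum (f : nat -> C) n : Cmod (csum f n) <= rsum (fun k => Cmod (f k)) n.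
Proof.
induction n; simpl; [rewrite Cmod_0; lra|].
eapply Rle_trans; [apply Cmod_triangle|]. lra.
Qed.

Lemma rsum_exchange (f : nat -> nat -> R) n m :
  rsum (fun j => rsum (fun k => f j k) m) n = rsum (fun k => rsum (fun j => f j k) n) m.
Proof.
induction n; simpl.
- induction m; simpl; [reflexivity|]. rewrite <- IHm. ring.
- rewrite IHn, <- rsum_plus. reflexivity.
Qed.

Lemma rsum_lim (f : nat -> R) M :
  (forall k, 0 <= f k) -> (forall n, rsum f n <= M) ->
  exists S : R, is_lim_seq (rsum f) S /\ S <= M /\ forall n, rsum f n <= S.
Proof.
intros H B.
destruct (ex_finite_lim_seq_incr (rsum f) M) as [S HS]; [|exact B|].
- intros n. apply rsum_incr; auto.
- exists S. repeat split; auto.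
  + apply (is_lim_seq_le (rsum f) (fun _ => M) S M); auto. apply is_lim_seq_const.
  + apply (is_lim_seq_incr_compare _ _ HS). intros n. apply rsum_incr; auto.
Qed.

Lemma rsum_tail (f : nat -> R) M :
  (forall k, 0 <= f k) -> (forall n, rsum f n <= M) ->
  forall eps, 0 < eps -> exists K, forall n, rsum f n - rsum f K <= eps.
Proof.
intros H B eps Heps. destruct (rsum_lim f M H B) as [S [HS [_ HB]]].
apply is_lim_seq_spec in HS. destruct (HS (mkposreal eps Heps)) as [K HK]. exists K. intros n.
specialize (HK K (le_n K)). simpl in HK. apply Rabs_lt_between in HK. specialize (HB n). lra.
Qed.

Lemma Cmod_csum_sub (f : nat -> C) (g : nat -> R) K n :
  (forall k, Cmod (f k) <= g k) -> (K <= n)%nat ->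
  Cmod (csum f n - csum f K) <= rsum g n - rsum g K.
Proof.
intros H L. induction L.
- replace (csum f K - csum f K)%C with (RtoC 0) by ring. rewrite Cmod_0. lra.
- simpl. replace (csum f m + f m - csum f K)%C with ((csum f m - csum f K) + f m)%C by ring.
  eapply Rle_trans; [apply Cmod_triangle|]. specialize (H m). lra.
Qed.

Lemma cser_ext (f g : nat -> C) l : (forall k, f k = g k) -> cser f l -> cser g l.
Proof. intros E. apply clim_ext. intros n. apply csum_ext. auto. Qed.

Lemma cser_plus (f g : nat -> C) l l' : cser f l -> cser g l' -> cser (fun k => f k + g k)%C (l + l')%C.
Proof.
intros A B. apply (clim_ext (fun n => csum f n + csum g n)%C).
- intros. rewrite csum_plus. reflexivity.
- apply clim_plus; assumption.
Qed.

Lemma cser_scal (f : nat -> C) x l : cser f l -> cser (fun k => x * f k)%C (x * l)%C.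
Proof.
intros A. apply (clim_ext (fun n => x * csum f n)%C).
- intros. rewrite csum_scal. reflexivity.
- apply clim_scal; assumption.
Qed.

Lemma cser_zero : cser (fun _ => RtoC 0) 0.
Proof.
apply (clim_ext (fun _ => RtoC 0)); [|apply clim_const]. intros n. symmetry. apply csum_zero. reflexivity.
Qed.

Lemma cser_csum (f : nat -> nat -> C) (l : nat -> C) n :
  (forall j, (j < n)%nat -> cser (f j) (l j)) ->
  cser (fun k => csum (fun j => f j k) n) (csum l n).
Proof.
induction n; intros H; simpl; [apply cser_zero|].
apply cser_plus; [apply IHn; intros; apply H; lia|apply H; lia].
Qed.

Lemma cser_finite (f : nat -> C) n : (forall k, (n <= k)%nat -> f k = 0) -> cser f (csum f n).
Proof.
intros H. apply (clim_shift _ _ n). apply (clim_ext (fun _ => csum f n)); [|apply clim_const].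
intros m. rewrite Nat.add_comm, csum_add. rewrite (csum_zero (fun k => f (n + k)%nat)) by (intros; apply H; lia).
ring.
Qed.

Lemma cser_recl (f : nat -> C) l : cser (fun k => f (S k)) l -> cser f (f O + l)%C.
Proof.
intros H. apply (clim_shift _ _ 1). apply (clim_ext (fun n => f O + csum (fun k => f (S k)) n)%C).
- intros n. rewrite Nat.add_1_r, csum_recl. reflexivity.
- apply clim_plus; [apply clim_const|exact H].
Qed.

Lemma cser_tail (f : nat -> C) l n : cser f l -> cser (fun k => f (n + k)%nat) (l - csum f n)%C.
Proof.
intros H. apply (clim_ext (fun m => csum f (n + m) + (- csum f n))%C).
- intros m. rewrite csum_add. ring.
- apply clim_plus; [|apply clim_const]. apply (clim_subseq (csum f) l (fun m => (n + m)%nat)); [intros; lia|exact H].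
Qed.

(** Absolute convergence implies convergence. The sum inherits the bound M, which is how coefficient
    norms will control values of functions. *)
Lemma cser_abs (f : nat -> C) (g : nat -> R) M :
  (forall k, Cmod (f k) <= g k) -> (forall n, rsum g n <= M) ->
  exists l, cser f l /\ Cmod l <= M.
Proof.
intros H B.
assert (G : forall k, 0 <= g k) by (intros; eapply Rle_trans; [apply Cmod_ge_0|apply H]).
assert (EX : exists l, clim (csum f) l).
(* The Cauchy criterion is checked once for any p that respects differences and is bounded by
   [Cmod], then applied to [Re] and [Im]. *)
{ assert (Cau : forall (p : C -> R), (forall z, Rabs (p z) <= Cmod z) ->
     (forall x y, p (x - y)%C = p x - p y) -> exists l : R, is_lim_seq (fun n => p (csum f n)) l).
  { intros p Hp Hs.
    assert (ex_finite_lim_seq (fun n => p (csum f n))) as [l Hl].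
    { apply ex_lim_seq_cauchy_corr. intros eps.
      destruct (rsum_tail g M G B (eps / 3)) as [K HK]; [generalize (cond_pos eps); lra|].
      exists K. intros n m Hn Hm.
      rewrite <- Hs. eapply Rle_lt_trans; [apply Hp|].
      eapply Rle_lt_trans; [apply (Cmod_sub_triangle _ (csum f K))|].
      rewrite (Cmod_sub_comm (csum f K)).
      generalize (Cmod_csum_sub f g K n H Hn) (Cmod_csum_sub f g K m H Hm) (HK n) (HK m) (cond_pos eps). lra. }
    exists l. exact Hl. }
  destruct (Cau Re re_le_Cmod ltac:(reflexivity)) as [x Hx].
  destruct (Cau Im im_le_Cmod ltac:(reflexivity)) as [y Hy].
  exists (x, y). apply clim_Re_Im. split; assumption. }
destruct EX as [l Hl]. exists l. split; [exact Hl|].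
replace l with (l - 0)%C by ring. apply (clim_bound (csum f) l 0 M 0 Hl).
intros n _. replace (csum f n - 0)%C with (csum f n) by ring.
eapply Rle_trans; [apply Cmod_csum|]. eapply Rle_trans; [|apply (B n)]. apply rsum_le. auto.
Qed.

Lemma cser_tail_bound (f : nat -> C) (g : nat -> R) l K eps :
  cser f l -> (forall k, Cmod (f k) <= g k) -> (forall n, rsum g n - rsum g K <= eps) ->
  Cmod (l - csum f K) <= eps.
Proof.
intros H B T. apply (clim_bound (csum f) l _ eps K H). intros n Hn.
eapply Rle_trans; [apply (Cmod_csum_sub f g K n B Hn)|apply T].
Qed.

Lemma clim_csum (u : nat -> nat -> C) (v : nat -> C) K :
  (forall k, (k < K)%nat -> clim (fun N => u N k) (v k)) -> clim (fun N => csum (u N) K) (csum v K).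
Proof.
induction K; intros H; simpl; [apply clim_const|].
apply clim_plus; [apply IHK; intros; apply H; lia|apply H; lia].
Qed.

(** Dominated convergence for series: since g majorizes all [u N] and hence v, one cut-off K makes
    all tails small at once. It serves to sum a double series in the other order. *)
Lemma tannery (u : nat -> nat -> C) (v : nat -> C) (g : nat -> R) (M : R) (U : nat -> C) (V : C) :
  (forall N k, Cmod (u N k) <= g k) -> (forall n, rsum g n <= M) ->
  (forall k, clim (fun N => u N k) (v k)) ->
  (forall N, cser (u N) (U N)) -> cser v V -> clim U V.
Proof.
intros Hg HM Hl HU HV eps Heps.
assert (G : forall k, 0 <= g k) by (intros; eapply Rle_trans; [apply Cmod_ge_0|apply (Hg O)]).
destruct (rsum_tail g M G HM (eps / 4)) as [K HK]; [lra|].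
assert (Hv : forall k, Cmod (v k) <= g k).
{ intros k. replace (v k) with (v k - 0)%C by ring.
  apply (clim_bound _ _ 0 (g k) 0 (Hl k)). intros n _. replace (u n k - 0)%C with (u n k) by ring. auto. }
destruct (clim_csum u v K (fun k _ => Hl k) (eps / 4)) as [N HN]; [lra|].
exists N. intros n Hn. specialize (HN n Hn).
generalize (cser_tail_bound _ _ _ _ _ (HU n) (Hg n) HK) (cser_tail_bound _ _ _ _ _ HV Hv HK).
generalize (Cmod_sub_triangle (U n) (csum (u n) K) V) (Cmod_sub_triangle (csum (u n) K) (csum v K) V).
rewrite (Cmod_sub_comm (csum v K)). lra.
Qed.

(** * Complex exponentials and powers *)

Lemma Cexp_plus (a b : C) : Cexp (a + b) = (Cexp a * Cexp b)%C.
Proof.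
destruct a as [x y], b as [u v]. unfold Cexp, Cplus, Cmult, Re, Im; simpl.
rewrite exp_plus, cos_plus, sin_plus. f_equal; ring.
Qed.

Lemma Cexp_RtoC (x : R) : Cexp x = RtoC (exp x).
Proof. unfold Cexp, RtoC, Re, Im; simpl. rewrite cos_0, sin_0. f_equal; ring. Qed.

Lemma Cexp_0 : Cexp 0 = RtoC 1.
Proof. rewrite Cexp_RtoC, exp_0. reflexivity. Qed.

Lemma Cexp_opp_r (z : C) : (Cexp z * Cexp (- z))%C = RtoC 1.
Proof. rewrite <- Cexp_plus. replace (z + - z)%C with (RtoC 0) by ring. apply Cexp_0. Qed.

Lemma Cmod_Cexp (z : C) : Cmod (Cexp z) = exp (Re z).
Proof.
destruct z as [x y]. unfold Cmod, Cexp, Re, Im; simpl.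
replace (_ + _) with (exp x * exp x * (Rsqr (sin y) + Rsqr (cos y))) by (unfold Rsqr; ring).
rewrite sin2_cos2, Rmult_1_r. apply sqrt_square. left. apply exp_pos.
Qed.

Lemma Re_mult_R_r (s : C) (x : R) : Re (s * x)%C = Re s * x.
Proof. destruct s. unfold Re, Cmult, RtoC; simpl. ring. Qed.

Lemma Rcpow_pos (x : R) (s : C) : 0 < x -> Rcpow x s = Cexp (s * ln x)%C.
Proof. intros H. unfold Rcpow. destruct (Rlt_dec 0 x); [reflexivity|contradiction]. Qed.

Lemma Rcpow_plus (x : R) (s t : C) : 0 < x -> Rcpow x (s + t) = (Rcpow x s * Rcpow x t)%C.
Proof. intros H. rewrite !Rcpow_pos by exact H. rewrite <- Cexp_plus. f_equal. ring. Qed.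

Lemma Rcpow_mult_base (x y : R) (s : C) : 0 < x -> 0 < y -> Rcpow (x * y) s = (Rcpow x s * Rcpow y s)%C.
Proof.
intros H K. rewrite !Rcpow_pos by (try apply Rmult_lt_0_compat; assumption).
rewrite <- Cexp_plus, ln_mult by assumption. f_equal. rewrite RtoC_plus. ring.
Qed.

Lemma Rcpow_inv_base (x : R) (s : C) : 0 < x -> Rcpow (/ x) s = Rcpow x (- s).
Proof.
intros H. rewrite !Rcpow_pos by (try apply Rinv_0_lt_compat; assumption).
rewrite ln_Rinv by assumption. f_equal. rewrite RtoC_opp. ring.
Qed.

Lemma Rcpow_0_r (x : R) : 0 < x -> Rcpow x 0 = RtoC 1.
Proof. intros H. rewrite Rcpow_pos by exact H. replace (0 * ln x)%C with (RtoC 0) by ring. apply Cexp_0. Qed.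

Lemma Rcpow_INR (x : R) (n : nat) : 0 < x -> Rcpow x (INR n) = RtoC (x ^ n).
Proof.
intros H. rewrite Rcpow_pos, <- RtoC_mult, Cexp_RtoC by exact H. f_equal.
change (exp (INR n * ln x)) with (Rpower x (INR n)). apply Rpower_pow, H.
Qed.

Lemma Rcpow_opp_r (x : R) (s : C) : 0 < x -> (Rcpow x s * Rcpow x (- s))%C = RtoC 1.
Proof. intros H. rewrite <- Rcpow_plus by exact H. replace (s + - s)%C with (RtoC 0) by ring. apply Rcpow_0_r, H. Qed.

Lemma Cmod_Rcpow (x : R) (s : C) : 0 < x -> Cmod (Rcpow x s) = Rpower x (Re s).
Proof. intros H. rewrite Rcpow_pos, Cmod_Cexp, Re_mult_R_r by exact H. reflexivity. Qed.

Lemma Cmod_pos_R (x : R) : 0 <= x -> Cmod x = x.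
Proof. intros H. rewrite Cmod_R. apply Rabs_pos_eq, H. Qed.

Lemma sum_n_rsum (f : nat -> R) n : sum_n f n = rsum f (S n).
Proof.
induction n; [rewrite sum_O; simpl; ring|].
rewrite sum_Sn, IHn. reflexivity.
Qed.

Lemma Re_csum (f : nat -> C) n : Re (csum f n) = rsum (fun k => Re (f k)) n.
Proof. induction n; [reflexivity|]. simpl. rewrite <- IHn. reflexivity. Qed.

Lemma Im_csum (f : nat -> C) n : Im (csum f n) = rsum (fun k => Im (f k)) n.
Proof. induction n; [reflexivity|]. simpl. rewrite <- IHn. reflexivity. Qed.

Lemma is_series_rsum (f : nat -> R) (l : R) : is_series f l -> is_lim_seq (rsum f) l.
Proof.
intros H. apply is_lim_seq_incr_1. apply (is_lim_seq_ext (sum_n f)); [apply sum_n_rsum|exact H].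
Qed.

Lemma CV_radius_ge (a : nat -> R) (rho M : R) :
  (forall n, Rabs (a n) * rho ^ n <= M) -> 0 < rho -> Rbar_le rho (CV_radius a).
Proof.
intros H P. destruct (CV_radius_bounded a) as [Hub _].
apply (Hub rho). exists M. intros n.
rewrite Rabs_mult, (Rabs_pos_eq (rho ^ n)); [apply H|apply pow_le; lra].
Qed.

(** Along the real axis a complex power series splits into two real ones, to which the real theorems
    on derivatives of power series apply. *)
Lemma cser_PSeries (c : nat -> C) (rho M t : R) :
  (forall n, Cmod (c n) * rho ^ n <= M) -> Rabs t < rho ->
  cser (fun n => c n * RtoC (t ^ n))%C
    (PSeries (fun n => Re (c n)) t, PSeries (fun n => Im (c n)) t) /\
  Rbar_lt (Rabs t) (CV_radius (fun n => Re (c n))) /\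
  Rbar_lt (Rabs t) (CV_radius (fun n => Im (c n))).
Proof.
intros H Ht.
assert (P : 0 < rho) by (generalize (Rabs_pos t); lra).
assert (A : forall p : C -> R, (forall z, Rabs (p z) <= Cmod z) ->
    Rbar_lt (Rabs t) (CV_radius (fun n => p (c n)))).
{ intros p Hp. apply (Rbar_lt_le_trans _ rho); [exact Ht|]. apply (CV_radius_ge _ rho M); [|exact P].
  intros n. eapply Rle_trans; [|apply H]. apply Rmult_le_compat_r; [apply pow_le; lra|apply Hp]. }
generalize (A Re re_le_Cmod) (A Im im_le_Cmod). intros A1 A2. split; [|split; assumption].
apply clim_Re_Im.
generalize (CV_radius_inside _ _ A1) (CV_radius_inside _ _ A2). intros B1 B2.
apply PSeries_correct in B1, B2. apply is_series_rsum in B1, B2. split.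
- eapply is_lim_seq_ext; [|exact B1]. intros n. rewrite Re_csum. apply rsum_ext. intros k _.
  rewrite Re_mult_R_r. unfold scal; simpl; unfold mult; simpl. rewrite pow_n_pow. ring.
- eapply is_lim_seq_ext; [|exact B2]. intros n. rewrite Im_csum. apply rsum_ext. intros k _.
  destruct (c k) as [x y]. unfold Im, Cmult, RtoC, scal; simpl; unfold mult; simpl. rewrite pow_n_pow. ring.
Qed.

(* The quotient of the power series by [Cexp (- g phi)] has derivative zero. *)
Lemma power_series_ode (c : nat -> C) (rho M : R) (g : C) (phi dphi : R -> R) :
  (forall n, Cmod (c n) * rho ^ n <= M) -> phi 0 = 0 ->
  (forall t, Rabs t < rho -> is_derive phi t (dphi t)) ->
  (forall t u d, Rabs t < rho -> cser (fun n => c n * RtoC (t ^ n))%C u ->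
     cser (fun n => INR (S n) * c (S n) * RtoC (t ^ n))%C d -> d = (- (g * dphi t) * u)%C) ->
  forall t, Rabs t < rho ->
    cser (fun n => c n * RtoC (t ^ n))%C (c O * Cexp (- (g * phi t)))%C.
Proof.
intros H H0 Hphi Hode t Ht.
set (U1 := PSeries (fun n => Re (c n))). set (U2 := PSeries (fun n => Im (c n))).
assert (D : forall s, Rabs s < rho ->
   is_derive U1 s (- dphi s * (Re g * U1 s - Im g * U2 s)) /\
   is_derive U2 s (- dphi s * (Re g * U2 s + Im g * U1 s))).
{ intros s Hs. destruct (cser_PSeries c rho M s H Hs) as [S1 [R1 R2]].
  assert (K1 := is_derive_PSeries _ _ R1). assert (K2 := is_derive_PSeries _ _ R2).
  assert (X1 := R1). rewrite <- CV_radius_derive in X1. assert (X2 := R2). rewrite <- CV_radius_derive in X2.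
  apply CV_radius_inside in X1, X2. apply PSeries_correct in X1, X2. apply is_series_rsum in X1, X2.
  assert (S2 : cser (fun n => INR (S n) * c (S n) * RtoC (s ^ n))%C
      (PSeries (PS_derive (fun n => Re (c n))) s, PSeries (PS_derive (fun n => Im (c n))) s)).
  { apply clim_Re_Im. split.
    - eapply is_lim_seq_ext; [|exact X1]. intros n. rewrite Re_csum. apply rsum_ext. intros k _.
      rewrite Re_mult_R_r, re_scal_l. unfold PS_derive, scal; simpl; unfold mult; simpl. rewrite pow_n_pow. ring.
    - eapply is_lim_seq_ext; [|exact X2]. intros n. rewrite Im_csum. apply rsum_ext. intros k _.
      rewrite im_scal_r, im_scal_l. unfold PS_derive, scal; simpl; unfold mult; simpl. rewrite pow_n_pow. ring. }
  assert (E := Hode s _ _ Hs S1 S2). clear S1 S2.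
  destruct g as [g1 g2]. unfold Cmult, Copp, RtoC, Re, Im in *; simpl in *.
  injection E as E1 E2. rewrite E1 in K1. rewrite E2 in K2. unfold U1, U2. split.
  - replace (- dphi s * _) with (- (g1 * dphi s - g2 * 0) * PSeries (fun n => fst (c n)) s
      - - (g1 * 0 + g2 * dphi s) * PSeries (fun n => snd (c n)) s) by ring. exact K1.
  - replace (- dphi s * _) with (- (g1 * dphi s - g2 * 0) * PSeries (fun n => snd (c n)) s
      + - (g1 * 0 + g2 * dphi s) * PSeries (fun n => fst (c n)) s) by ring. exact K2. }
(* [W1] and [W2] are the real and imaginary parts of (U1 + i U2) * Cexp (g * phi). *)
set (W1 := fun s => U1 s * (exp (Re g * phi s) * cos (Im g * phi s))
                  - U2 s * (exp (Re g * phi s) * sin (Im g * phi s))).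
set (W2 := fun s => U1 s * (exp (Re g * phi s) * sin (Im g * phi s))
                  + U2 s * (exp (Re g * phi s) * cos (Im g * phi s))).
assert (DW : forall s, Rabs s < rho -> is_derive W1 s 0 /\ is_derive W2 s 0).
{ intros s Hs. destruct (D s Hs) as [D1 D2]. assert (D3 := Hphi s Hs).
  assert (V1 := is_derive_unique _ _ _ D1). assert (V2 := is_derive_unique _ _ _ D2).
  assert (V3 := is_derive_unique _ _ _ D3).
  split; unfold W1, W2; auto_derive.
  all: try (repeat split; first [exists (- dphi s * (Re g * U1 s - Im g * U2 s)); exact D1
        | exists (- dphi s * (Re g * U2 s + Im g * U1 s)); exact D2 | exists (dphi s); exact D3 | trivial]).
  all: change (Derive (fun x => U1 x) s) with (Derive U1 s); change (Derive (fun x => U2 x) s) with (Derive U2 s);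
    change (Derive (fun x => phi x) s) with (Derive phi s); rewrite V1, V2, V3; ring. }
assert (CST : forall W : R -> R, (forall s, Rabs s < rho -> is_derive W s 0) -> W t = W 0).
{ intros W HW. destruct (Rtotal_order t 0) as [L|[E|G]].
  - apply (eq_is_derive W t 0); [|exact L]. intros s Hs. apply HW.
    rewrite Rabs_left in Ht by exact L. apply Rabs_lt_between. lra.
  - rewrite E. reflexivity.
  - symmetry. apply (eq_is_derive W 0 t); [|exact G]. intros s Hs. apply HW.
    rewrite Rabs_right in Ht by lra. apply Rabs_lt_between. lra. }
assert (F1 := CST W1 (fun s Hs => proj1 (DW s Hs))). assert (F2 := CST W2 (fun s Hs => proj2 (DW s Hs))).
unfold W1, W2 in F1, F2. rewrite H0 in F1, F2. rewrite !Rmult_0_r, exp_0, cos_0, sin_0 in F1, F2.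
assert (Z : U1 0 = Re (c O) /\ U2 0 = Im (c O)).
{ split; unfold U1, U2; rewrite PSeries_0; reflexivity. }
destruct Z as [Z1 Z2]. rewrite Z1, Z2 in F1, F2.
destruct (cser_PSeries c rho M t H Ht) as [S1 _].
fold U1 U2 in S1.
replace (c O * Cexp (- (g * phi t)))%C with (U1 t, U2 t); [exact S1|].
assert (E : c O = ((U1 t, U2 t) * Cexp (g * phi t))%C).
{ destruct (c O) as [x y]. destruct g as [g1 g2]. unfold Cexp, Cmult, RtoC, Re, Im in *; simpl in *.
  rewrite !Rmult_0_r, Rminus_0_r, Rplus_0_l. f_equal; lra. }
rewrite E, <- Cmult_assoc, Cexp_opp_r, Cmult_1_r. reflexivity.
Qed.

(** * Power series with Wiener norms *)

(* [wn a r f M]: on the closed disc of radius [r] around [a], [f] is the sum of a power series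
   of Wiener norm [sum |c_n| r^n <= M].  These bounds are submultiplicative and add up along
   infinite sums, which makes Cauchy's formula unnecessary. *)
Definition wn (a : C) (r : R) (f : C -> C) (M : R) : Prop :=
  exists c : nat -> C,
    (forall n, rsum (fun k => Cmod (c k) * r ^ k) n <= M) /\
    forall h, Cmod h <= r -> cser (fun k => c k * h ^ k)%C (f (a + h)%C).

Lemma Cmod_term (c h : C) (r : R) k : Cmod h <= r -> Cmod (c * h ^ k) <= Cmod c * r ^ k.
Proof.
intros H. rewrite Cmod_mult, Cmod_pow. apply Rmult_le_compat_l; [apply Cmod_ge_0|].
apply pow_incr. split; [apply Cmod_ge_0|exact H].
Qed.

Lemma wterm_nonneg (c : nat -> C) (r : R) : 0 <= r -> forall k, 0 <= Cmod (c k) * r ^ k.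
Proof. intros H k. apply Rmult_le_pos; [apply Cmod_ge_0|apply pow_le, H]. Qed.

Lemma wn_ext a r f g M : (forall h, Cmod h <= r -> f (a + h)%C = g (a + h)%C) -> wn a r f M -> wn a r g M.
Proof. intros E [c [H1 H2]]. exists c. split; [exact H1|]. intros h Hh. rewrite <- E by exact Hh. auto. Qed.

Lemma wn_le a r f M M' : M <= M' -> wn a r f M -> wn a r f M'.
Proof. intros E [c [H1 H2]]. exists c. split; [|exact H2]. intros n. specialize (H1 n). lra. Qed.

Lemma wn_shrink a r r' f M : 0 <= r' <= r -> wn a r f M -> wn a r' f M.
Proof.
intros E [c [H1 H2]]. exists c. split.
- intros n. eapply Rle_trans; [|apply (H1 n)]. apply rsum_le. intros k _.
  apply Rmult_le_compat_l; [apply Cmod_ge_0|]. apply pow_incr. lra.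
- intros h Hh. apply H2. lra.
Qed.

Lemma wn_nonneg a r f M : wn a r f M -> 0 <= M.
Proof. intros [c [H _]]. apply (H O). Qed.

Lemma wn_bound a r f M h : wn a r f M -> Cmod h <= r -> Cmod (f (a + h)%C) <= M.
Proof.
intros [c [H1 H2]] Hh.
destruct (cser_abs (fun k => c k * h ^ k)%C (fun k => Cmod (c k) * r ^ k) M) as [l [L1 L2]]; auto.
- intros k. apply Cmod_term, Hh.
- rewrite (clim_unique _ _ _ (H2 h Hh) L1). exact L2.
Qed.

Lemma wn_const a r x : wn a r (fun _ => x) (Cmod x).
Proof.
exists (fun k => match k with O => x | S _ => 0 end). split.
- intros n. assert (E : forall m, rsum (fun k => Cmod (match k with O => x | S _ => 0 end) * r ^ k) (S m) = Cmod x).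
  { induction m; [simpl; ring|]. change (rsum ?f (S (S m))) with (rsum f (S m) + f (S m)). rewrite IHm, Cmod_0. ring. }
  destruct n; [simpl; apply Cmod_ge_0|rewrite E; lra].
- intros h _.
  assert (K : cser (fun k => (match k with O => x | S _ => 0 end) * h ^ k)%C (0 + x * 1)%C).
  { apply (cser_finite (fun k => (match k with O => x | S _ => 0 end) * h ^ k)%C 1).
    intros [|k] Hk; [lia|ring]. }
  replace (0 + x * 1)%C with x in K by ring. exact K.
Qed.

Lemma wn_plus a r f g M N : wn a r f M -> wn a r g N -> wn a r (fun z => f z + g z)%C (M + N).
Proof.
intros [c [H1 H2]] [d [K1 K2]].
destruct (Rle_dec 0 r) as [Hr|Hr].
- exists (fun k => c k + d k)%C. split.
  + intros n. eapply Rle_trans; [|apply Rplus_le_compat; [apply (H1 n)|apply (K1 n)]].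
    rewrite <- rsum_plus. apply rsum_le. intros k _. rewrite <- Rmult_plus_distr_r.
    apply Rmult_le_compat_r; [apply pow_le, Hr|apply Cmod_triangle].
  + intros h Hh. apply (cser_ext (fun k => c k * h ^ k + d k * h ^ k)%C); [intros; ring|].
    apply cser_plus; auto.
(* For r < 0 the disc is empty, so zero coefficients do; the empty partial sums show that M and N
   are nonnegative. *)
- exists (fun _ => RtoC 0). split.
  + intros n. generalize (H1 O) (K1 O). simpl.
    replace (rsum _ n) with 0; [lra|]. induction n; simpl; [reflexivity|]. rewrite <- IHn, Cmod_0. ring.
  + intros h Hh. generalize (Cmod_ge_0 h). lra.
Qed.

Lemma wn_scal a r f M x : wn a r f M -> wn a r (fun z => x * f z)%C (Cmod x * M).
Proof.
intros [c [H1 H2]]. exists (fun k => x * c k)%C. split.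
- intros n. rewrite (rsum_ext _ (fun k => Cmod x * (Cmod (c k) * r ^ k))) by (intros; rewrite Cmod_mult; ring).
  rewrite rsum_scal. apply Rmult_le_compat_l; [apply Cmod_ge_0|apply H1].
- intros h Hh. apply (cser_ext (fun k => x * (c k * h ^ k))%C); [intros; ring|]. apply cser_scal. auto.
Qed.

(** Weierstrass' theorem without contour integrals: the n-th coefficients of the f k are dominated
    by M k / r^n, so they can be summed over k, and the norm bound passes to the limit after
    exchanging two finite sums. *)
Lemma wn_series a r (f : nat -> C -> C) (M : nat -> R) (B : R) (F : C -> C) :
  0 < r -> (forall k, wn a r (f k) (M k)) -> (forall n, rsum M n <= B) ->
  (forall h, Cmod h <= r -> cser (fun k => f k (a + h)%C) (F (a + h)%C)) -> wn a r F B.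
Proof.
intros Hr Hf HB HF.
destruct (choice _ Hf) as [c Hc].
assert (MP : forall k, 0 <= M k) by (intros k; apply (wn_nonneg _ _ _ _ (Hf k))).
assert (T : forall k n, Cmod (c k n) * r ^ n <= M k).
{ intros k n. apply (rsum_term (fun n => Cmod (c k n) * r ^ n)); [apply wterm_nonneg; lra|apply Hc]. }
assert (EX : forall n, exists l, cser (fun k => c k n) l).
{ intros n. assert (P : 0 < r ^ n) by (apply pow_lt, Hr).
  destruct (cser_abs (fun k => c k n) (fun k => / r ^ n * M k) (/ r ^ n * B)) as [l [L _]].
  - intros k. apply (Rmult_le_reg_r (r ^ n)); [exact P|].
    replace (/ r ^ n * M k * r ^ n) with (M k) by (field; lra). apply T.
  - intros m. rewrite rsum_scal. apply Rmult_le_compat_l; [left; apply Rinv_0_lt_compat, P|apply HB].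
  - exists l. exact L. }
destruct (choice _ EX) as [C0 HC]. exists C0. split.
- intros N.
  assert (L : is_lim_seq (fun K => rsum (fun n => Cmod (csum (fun k => c k n) K) * r ^ n) N)
                (rsum (fun n => Cmod (C0 n) * r ^ n) N)).
  { induction N; simpl; [apply is_lim_seq_const|]. apply is_lim_seq_plus'; [exact IHN|].
    apply is_lim_seq_mult'; [apply clim_Cmod, HC|apply is_lim_seq_const]. }
  apply (is_lim_seq_le (fun K => rsum (fun n => Cmod (csum (fun k => c k n) K) * r ^ n) N) (fun _ => B)
     (rsum (fun n => Cmod (C0 n) * r ^ n) N) B); [|exact L|apply is_lim_seq_const].
  intros K. eapply Rle_trans; [|apply (HB K)].
  apply Rle_trans with (rsum (fun n => rsum (fun k => Cmod (c k n) * r ^ n) K) N).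
  + apply rsum_le. intros n _. rewrite (rsum_ext _ (fun k => r ^ n * Cmod (c k n))) by (intros; ring).
    rewrite rsum_scal, Rmult_comm. apply Rmult_le_compat_l; [apply pow_le; lra|apply Cmod_csum].
  + rewrite rsum_exchange. apply rsum_le. intros k _. apply Hc.
- intros h Hh.
  (* N truncates the powers of h: summing the truncated expansions over k gives the partial sums of
     the series with coefficients [C0 n], while the full expansions are the f k. *)
  apply (tannery (fun N k => csum (fun n => c k n * h ^ n)%C N) (fun k => f k (a + h)%C) M B); auto.
  + intros N k. eapply Rle_trans; [apply Cmod_csum|]. eapply Rle_trans; [|apply (proj1 (Hc k) N)].
    apply rsum_le. intros n _. apply Cmod_term, Hh.
  + intros k. apply (proj2 (Hc k) h Hh).
  + intros N. apply (cser_csum (fun n k => c k n * h ^ n)%C (fun n => C0 n * h ^ n)%C).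
    intros j _. rewrite Cmult_comm. apply (cser_ext (fun k => h ^ j * c k j)%C); [intros; ring|].
    apply cser_scal, HC.
Qed.

Lemma wn_shift a r f M : 0 <= r -> wn a r f M -> wn a r (fun z => (z - a) * f z)%C (r * M).
Proof.
intros Hr [c [H1 H2]]. exists (fun k => match k with O => RtoC 0 | S k => c k end). split.
- intros [|n].
  + simpl. apply Rmult_le_pos; [exact Hr|apply (H1 O)].
  + assert (E : forall m, rsum (fun k => Cmod (match k with O => RtoC 0 | S k => c k end) * r ^ k) (S m)
        = r * rsum (fun k => Cmod (c k) * r ^ k) m).
    { induction m; [simpl; rewrite Cmod_0; ring|].
      change (rsum ?f (S (S m))) with (rsum f (S m) + f (S m)). rewrite IHm. simpl. ring. }
    rewrite E. apply Rmult_le_compat_l; [exact Hr|apply H1].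
- intros h Hh. replace ((a + h - a) * f (a + h))%C with (0 * h ^ 0 + h * f (a + h))%C by ring.
  apply (cser_recl (fun k => (match k with O => RtoC 0 | S k => c k end) * h ^ k)%C).
  apply (cser_ext (fun k => h * (c k * h ^ k))%C); [intros; simpl; ring|]. apply cser_scal. auto.
Qed.

(** Writing f g as the sum of c_k (z - a)^k g(z) reduces products to [wn_series] and spares the
    Cauchy product of two series. *)
Lemma wn_mult a r f g M N : 0 < r -> wn a r f M -> wn a r g N -> wn a r (fun z => f z * g z)%C (M * N).
Proof.
intros Hr [c [H1 H2]] Hg.
assert (NP := wn_nonneg _ _ _ _ Hg).
apply (wn_series a r (fun k z => c k * ((z - a) ^ k * g z))%C (fun k => Cmod (c k) * (r ^ k * N))); auto.
- intros k. apply wn_scal. induction k.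
  + simpl. rewrite Rmult_1_l. apply (wn_ext _ _ g); [intros; ring|exact Hg].
  + simpl. rewrite Rmult_assoc. apply (wn_ext _ _ (fun z => (z - a) * ((z - a) ^ k * g z))%C); [intros; ring|].
    apply wn_shift; [lra|exact IHk].
- intros n. rewrite (rsum_ext _ (fun k => N * (Cmod (c k) * r ^ k))) by (intros; ring).
  rewrite rsum_scal, Rmult_comm. apply Rmult_le_compat_r; auto.
- intros h Hh. rewrite Cmult_comm.
  apply (cser_ext (fun k => g (a + h) * (c k * h ^ k))%C).
  + intros k. replace (a + h - a)%C with h by ring. ring.
  + apply cser_scal. auto.
Qed.

Lemma wn_linear a r x y : 0 <= r -> wn a r (fun z => x * z + y)%C (Cmod (x * a + y) + Cmod x * r).
Proof.
intros Hr. apply (wn_ext _ _ (fun z => (x * a + y) + x * ((z - a) * 1))%C); [intros; ring|].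
apply wn_plus; [apply wn_const|]. apply wn_scal.
replace r with (r * Cmod 1) at 2 by (rewrite Cmod_1; ring). apply wn_shift; [exact Hr|apply wn_const].
Qed.

Lemma wn_affine a r x y f M : wn (x * a + y) (Cmod x * r) f M -> wn a r (fun z => f (x * z + y))%C M.
Proof.
intros [c [H1 H2]]. exists (fun k => c k * x ^ k)%C. split.
- intros n. rewrite (rsum_ext _ (fun k => Cmod (c k) * (Cmod x * r) ^ k)); [apply H1|].
  intros. rewrite Cmod_mult, Cmod_pow, Rpow_mult_distr. ring.
- intros h Hh. replace (x * (a + h) + y)%C with ((x * a + y) + x * h)%C by ring.
  apply (cser_ext (fun k => c k * (x * h) ^ k)%C); [intros k; rewrite Cpow_mult_l; ring|].
  apply H2. rewrite Cmod_mult. apply Rmult_le_compat_l; [apply Cmod_ge_0|exact Hh].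
Qed.

Lemma csum_Cconj (f : nat -> C) n : Cconj (csum f n) = csum (fun k => Cconj (f k)) n.
Proof. induction n; simpl; [unfold Cconj, RtoC; simpl; f_equal; ring|]. rewrite <- IHn, Cplus_conj. reflexivity. Qed.

Lemma clim_Cconj u l : clim u l -> clim (fun n => Cconj (u n)) (Cconj l).
Proof.
intros H eps Heps. destruct (H eps Heps) as [N HN]. exists N. intros n Hn.
rewrite <- Cminus_conj, Cmod_conj. auto.
Qed.

Lemma cser_Cconj f l : cser f l -> cser (fun k => Cconj (f k)) (Cconj l).
Proof. intros H. apply (clim_ext (fun n => Cconj (csum f n))); [apply csum_Cconj|apply clim_Cconj, H]. Qed.

Lemma Cpow_conj (z : C) n : Cconj (z ^ n) = (Cconj z ^ n)%C.
Proof. induction n; simpl; [unfold Cconj, RtoC; simpl; f_equal; ring|]. rewrite Cmult_conj, IHn. reflexivity. Qed.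

(** Reflection in the real axis conjugates the coefficients; this prepares the proof that the
    derivative of the spectral zeta function at 0 is real. *)
Lemma wn_Cconj a r f M : wn a r f M -> wn (Cconj a) r (fun z => Cconj (f (Cconj z))) M.
Proof.
intros [c [H1 H2]]. exists (fun k => Cconj (c k)). split.
- intros n. rewrite (rsum_ext _ (fun k => Cmod (c k) * r ^ k)); [apply H1|]. intros. rewrite Cmod_conj. reflexivity.
- intros h Hh. rewrite Cplus_conj, Cconj_conj.
  apply (cser_ext (fun k => Cconj (c k * Cconj h ^ k))%C).
  + intros k. rewrite Cmult_conj, Cpow_conj, Cconj_conj. reflexivity.
  + apply cser_Cconj, H2. rewrite Cmod_conj. exact Hh.
Qed.

(** * Analytic germs and the identity theorem *)

Definition an (f : C -> C) (a : C) : Prop := exists r M, 0 < r /\ wn a r f M.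

(** The centre is left out because a meromorphic function may take any value at its pole. *)
Definition peq (f g : C -> C) (a : C) : Prop :=
  exists r, 0 < r /\ forall h, 0 < Cmod h < r -> f (a + h)%C = g (a + h)%C.

(** The exponent m need not be the exact order of the pole, so sums and products require no
    discussion of cancellation. *)
Definition mer (f : C -> C) (a : C) : Prop :=
  exists (m : nat) (g : C -> C), an g a /\ peq (fun z => (z - a) ^ m * f z)%C g a.

(** Library neighbourhoods in the complex plane are products of real balls. One direction goes
    through real and imaginary parts, the other bounds them by [Cmod]. *)
Lemma is_series_cser (f : nat -> C) (l : C) : @is_series C_AbsRing C_NormedModule f l <-> cser f l.
Proof.
assert (E : forall n, sum_n (G := C_NormedModule) f n = csum f (S n)).
{ induction n; [rewrite sum_O; simpl; ring|]. rewrite sum_Sn, IHn. reflexivity. }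
split.
- intros H. apply (clim_shift _ _ 1). apply clim_Re_Im.
  assert (B := proj1 (filterlim_locally (F := eventually) (sum_n f) l) H).
  split; apply is_lim_seq_spec; intros eps; destruct (B eps) as [N HN]; exists N; intros n Hn;
    specialize (HN n Hn); rewrite E in HN; rewrite Nat.add_1_r; destruct HN as [H1 H2]; [exact H1|exact H2].
- intros H. refine (proj2 (filterlim_locally (F := eventually) (sum_n f) l) _). intros eps.
  destruct (H eps (cond_pos eps)) as [N HN]. exists N. intros n Hn.
  rewrite E. apply C_NormedModule_mixin_compat1. apply (HN (S n)). lia.
Qed.

Lemma is_pseries_cser (c : nat -> C) (h l : C) :
  @is_pseries C_AbsRing C_NormedModule c h l <-> cser (fun k => c k * h ^ k)%C l.
Proof.
assert (E : forall k, (c k * h ^ k)%C = scal (pow_n (K := C_AbsRing) h k) (c k)).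
{ intros k. rewrite Cmult_comm. unfold scal; simpl. unfold mult; simpl. f_equal. }
unfold is_pseries. rewrite is_series_cser. split; apply cser_ext; intros; rewrite E; reflexivity.
Qed.

Lemma cser_bounded (f : nat -> C) l : cser f l -> exists B, forall k, Cmod (f k) <= B.
Proof.
intros H. destruct (H 1 ltac:(lra)) as [N HN].
assert (F : exists B, forall k, (k < N)%nat -> Cmod (f k) <= B).
{ clear HN. induction N as [|N [B IH]]; [exists 0; intros; lia|].
  exists (Rmax B (Cmod (f N))). intros k Hk. destruct (Nat.eq_dec k N) as [->|Hn]; [apply Rmax_r|].
  eapply Rle_trans; [apply IH; lia|apply Rmax_l]. }
destruct F as [B HB]. exists (Rmax B 2). intros k. destruct (Nat.lt_ge_cases k N) as [L|L].
- eapply Rle_trans; [apply HB, L|apply Rmax_l].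
- eapply Rle_trans; [|apply Rmax_r].
  replace (f k) with ((csum f (S k) - l) - (csum f k - l))%C by (simpl; ring).
  eapply Rle_trans; [apply Cmod_triangle|]. rewrite Cmod_opp.
  generalize (HN (S k) ltac:(lia)) (HN k ltac:(lia)). lra.
Qed.

Lemma rsum_half_pow n : rsum (fun k => (/ 2) ^ k) n <= 2.
Proof.
assert (E : rsum (fun k => (/ 2) ^ k) n = 2 - 2 * (/ 2) ^ n) by (induction n; simpl; [ring|rewrite IHn; field]).
rewrite E. generalize (pow_le (/ 2) n ltac:(lra)). lra.
Qed.

Lemma an_analytic_at f a : an f a <-> analytic_at f a.
Proof.
split.
- intros [r [M [Hr [c [_ H]]]]]. exists c, r. split; [exact Hr|]. intros h Hh. apply is_pseries_cser, H. lra.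
- intros [c [r [Hr H]]].
  assert (HH : Cmod (RtoC (r / 2)) = r / 2) by (apply Cmod_pos_R; lra).
  assert (K := H (RtoC (r / 2)) ltac:(rewrite HH; lra)). apply is_pseries_cser, cser_bounded in K.
  (* Terms bounded at radius r / 2 have a geometric majorant of ratio 1/2 at radius r / 4, whence
     the norm 2 B. *)
  destruct K as [B HB]. exists (r / 4), (B * 2). split; [lra|]. exists c. split.
  + intros n. assert (BP : 0 <= B) by (eapply Rle_trans; [apply Cmod_ge_0|apply (HB O)]).
    eapply Rle_trans; [|apply Rmult_le_compat_l; [exact BP|apply (rsum_half_pow n)]].
    rewrite <- rsum_scal. apply rsum_le. intros k _. specialize (HB k).
    rewrite Cmod_mult, Cmod_pow, HH in HB.
    replace (r / 4) with ((r / 2) * / 2) by field. rewrite Rpow_mult_distr, <- Rmult_assoc.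
    apply Rmult_le_compat_r; [apply pow_le; lra|exact HB].
  + intros h Hh. apply is_pseries_cser, H. lra.
Qed.

Lemma wn_common a f g : an f a -> an g a ->
  exists r M N, 0 < r /\ wn a r f M /\ wn a r g N.
Proof.
intros [r [M [Hr H]]] [r' [M' [Hr' H']]]. exists (Rmin r r'), M, M'.
assert (P : 0 < Rmin r r') by (apply Rmin_glb_lt; assumption).
repeat split; auto; [apply (wn_shrink a r)|apply (wn_shrink a r')]; auto; split; try lra;
  [apply Rmin_l|apply Rmin_r].
Qed.

Lemma an_const a x : an (fun _ => x) a.
Proof. exists 1, (Cmod x). split; [lra|apply wn_const]. Qed.

Lemma an_plus f g a : an f a -> an g a -> an (fun z => f z + g z)%C a.
Proof. intros F G. destruct (wn_common _ _ _ F G) as [r [M [N [Hr [H K]]]]]. exists r, (M + N). split; [exact Hr|apply wn_plus; assumption]. Qed.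

Lemma an_mult f g a : an f a -> an g a -> an (fun z => f z * g z)%C a.
Proof. intros F G. destruct (wn_common _ _ _ F G) as [r [M [N [Hr [H K]]]]]. exists r, (M * N). split; [exact Hr|apply wn_mult; assumption]. Qed.

Lemma an_linear a x y : an (fun z => x * z + y)%C a.
Proof. exists 1, (Cmod (x * a + y) + Cmod x * 1). split; [lra|apply wn_linear; lra]. Qed.

Lemma an_ext_loc f g a r : 0 < r -> (forall h, Cmod h < r -> f (a + h)%C = g (a + h)%C) -> an f a -> an g a.
Proof.
intros Hr E [r' [M [Hr' H]]]. exists (Rmin (r / 2) r'), M.
assert (P : 0 < Rmin (r / 2) r') by (apply Rmin_glb_lt; lra). split; [exact P|].
apply (wn_ext _ _ f).
- intros h Hh. apply E. generalize (Rmin_l (r / 2) r'). lra.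
- apply (wn_shrink a r'); [split; [lra|apply Rmin_r]|exact H].
Qed.

Lemma an_ext f g a : (forall z, f z = g z) -> an f a -> an g a.
Proof. intros E. apply (an_ext_loc f g a 1); [lra|intros; apply E]. Qed.

Lemma an_scal f a x : an f a -> an (fun z => x * f z)%C a.
Proof. intros H. apply an_mult; [apply an_const|exact H]. Qed.

Lemma an_pow f a n : an f a -> an (fun z => f z ^ n)%C a.
Proof. intros H. induction n; simpl; [apply an_const|apply an_mult; assumption]. Qed.

Lemma an_csum f a n : (forall j, (j < n)%nat -> an (f j) a) -> an (fun z => csum (fun j => f j z) n) a.
Proof.
induction n; intros H; simpl; [apply an_const|].
apply an_plus; [apply IHn; intros; apply H; lia|apply H; lia].
Qed.

Lemma an_affine f a x y : an f (x * a + y)%C -> an (fun z => f (x * z + y))%C a.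
Proof.
intros [r [M [Hr H]]]. destruct (Req_dec (Cmod x) 0) as [E|E].
- apply Cmod_eq_0 in E. apply (an_ext (fun _ => f (0 * a + y)%C)).
  + intros z. rewrite E. f_equal. ring.
  + apply an_const.
- assert (P : 0 < Cmod x) by (generalize (Cmod_ge_0 x); lra).
  exists (r / Cmod x), M. split; [apply Rdiv_lt_0_compat; assumption|]. apply wn_affine.
  replace (Cmod x * (r / Cmod x)) with r by (field; lra). exact H.
Qed.

Lemma an_Cconj f a : an f a -> an (fun z => Cconj (f (Cconj z))) (Cconj a).
Proof. intros [r [M [Hr H]]]. exists r, M. split; [exact Hr|apply wn_Cconj, H]. Qed.

(** Every term of the tail contains the factor (|h| / r)^n. This replaces Taylor's formula: n = 1
    gives Lipschitz bounds, n = 2 derivatives, and n one past the first nonzero coefficient the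
    isolation of zeros. *)
Lemma cser_remainder (c : nat -> C) (r M : R) (h l : C) n :
  (forall n, rsum (fun k => Cmod (c k) * r ^ k) n <= M) -> 0 < r -> Cmod h <= r ->
  cser (fun k => c k * h ^ k)%C l ->
  Cmod (l - csum (fun k => c k * h ^ k)%C n) <= (Cmod h / r) ^ n * M.
Proof.
intros HM Hr Hh H. apply (cser_tail _ _ n) in H. simpl in H.
assert (Q : 0 <= Cmod h / r) by (apply Rmult_le_pos; [apply Cmod_ge_0|left; apply Rinv_0_lt_compat, Hr]).
destruct (cser_abs (fun k => c (n + k)%nat * h ^ (n + k))%C
   (fun k => (Cmod h / r) ^ n * (Cmod (c (n + k)%nat) * r ^ (n + k))) ((Cmod h / r) ^ n * M)) as [l' [L1 L2]].
- intros k. rewrite Cmod_mult, Cmod_pow, !pow_add.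
  replace ((Cmod h / r) ^ n * (Cmod (c (n + k)%nat) * (r ^ n * r ^ k)))
    with (Cmod (c (n + k)%nat) * (((Cmod h / r) ^ n * r ^ n) * r ^ k)) by ring.
  rewrite <- Rpow_mult_distr. replace (Cmod h / r * r) with (Cmod h) by (field; lra).
  apply Rmult_le_compat_l; [apply Cmod_ge_0|]. apply Rmult_le_compat_l; [apply pow_le, Cmod_ge_0|].
  apply pow_incr. split; [apply Cmod_ge_0|exact Hh].
- intros m. rewrite rsum_scal. apply Rmult_le_compat_l; [apply pow_le, Q|].
  eapply Rle_trans; [|apply (HM (n + m)%nat)].
  induction m; simpl; [rewrite Nat.add_0_r; apply rsum_nonneg, wterm_nonneg; lra|].
  rewrite Nat.add_succ_r. simpl. lra.
- rewrite (clim_unique _ _ _ H L1). exact L2.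
Qed.

Lemma wn_lipschitz a r f M h : 0 < r -> wn a r f M -> Cmod h <= r ->
  Cmod (f (a + h)%C - f a) <= Cmod h / r * M.
Proof.
intros Hr [c [H1 H2]] Hh.
assert (E : f a = c O).
{ assert (K := H2 0 ltac:(rewrite Cmod_0; lra)). replace (a + 0)%C with a in K by ring.
  assert (K' : cser (fun k => c k * 0 ^ k)%C (0 + c O * 1)%C).
  { apply (cser_finite (fun k => c k * 0 ^ k)%C 1). intros [|k] Hk; [lia|simpl; ring]. }
  rewrite (clim_unique _ _ _ K K'). ring. }
generalize (cser_remainder c r M h _ 1 H1 Hr Hh (H2 h Hh)). simpl.
rewrite E. replace (f (a + h)%C - (0 + c O * 1))%C with (f (a + h)%C - c O)%C by ring. lra.
Qed.

Lemma an_lipschitz f a : an f a ->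
  exists r K, 0 < r /\ 0 <= K /\ forall h, Cmod h < r -> Cmod (f (a + h)%C - f a) <= K * Cmod h.
Proof.
intros [r [M [Hr H]]]. exists r, (M / r). split; [exact Hr|].
split; [apply Rmult_le_pos; [apply (wn_nonneg _ _ _ _ H)|left; apply Rinv_0_lt_compat, Hr]|].
intros h Hh. generalize (wn_lipschitz a r f M h Hr H ltac:(lra)). unfold Rdiv. nra.
Qed.

Lemma an_isolated_zeros f a : an f a ->
  (exists d, 0 < d /\ forall h, 0 < Cmod h < d -> f (a + h)%C <> 0) \/
  (exists d, 0 < d /\ forall h, Cmod h < d -> f (a + h)%C = 0).
Proof.
intros [r [M [Hr [c [H1 H2]]]]].
destruct (classic (exists n, c n <> 0)) as [NZ|Z].
- left. destruct (dec_inh_nat_subset_has_unique_least_element _ (fun n => classic (c n <> 0)) NZ) as [n [[Hn Hmin] _]].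
  assert (Zn : forall k, (k < n)%nat -> c k = 0).
  { intros k Hk. apply NNPP. intros K. specialize (Hmin k K). lia. }
  assert (CP : 0 < Cmod (c n)) by (apply Cmod_gt_0, Hn).
  assert (MP : 0 <= M) by apply (H1 O).
  assert (RP : 0 < r ^ S n) by (apply pow_lt, Hr).
  (* Below this radius the remainder, at most M |h|^(n+1) / r^(n+1), is smaller than the leading
     term |c_n| |h|^n; M + 1 avoids a division by zero. *)
  exists (Rmin r (Cmod (c n) * r ^ S n / (M + 1))). split.
  + apply Rmin_glb_lt; [exact Hr|]. apply Rdiv_lt_0_compat; [apply Rmult_lt_0_compat; assumption|lra].
  + intros h [Hh Hd] E.
    assert (D1 : Cmod h < r) by (generalize (Rmin_l r (Cmod (c n) * r ^ S n / (M + 1))); lra).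
    assert (D2 : Cmod h < Cmod (c n) * r ^ S n / (M + 1))
      by (generalize (Rmin_r r (Cmod (c n) * r ^ S n / (M + 1))); lra).
    apply (Rmult_lt_compat_r (M + 1)) in D2; [|lra].
    replace (Cmod (c n) * r ^ S n / (M + 1) * (M + 1)) with (Cmod (c n) * r ^ S n) in D2 by (field; lra).
    generalize (cser_remainder c r M h _ (S n) H1 Hr ltac:(lra) (H2 h ltac:(lra))). rewrite E. simpl csum.
    rewrite csum_zero by (intros k Hk; rewrite (Zn k Hk); ring).
    replace (0 - (0 + c n * h ^ n))%C with (- (c n * h ^ n))%C by ring.
    rewrite Cmod_opp, Cmod_mult, Cmod_pow. intros K.
    assert (HP : 0 < Cmod h ^ n) by (apply pow_lt, Hh).
    apply (Rmult_le_compat_r (r ^ S n)) in K; [|lra].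
    replace ((Cmod h / r) ^ S n * M * r ^ S n) with ((Cmod h / r * r) ^ S n * M) in K by (rewrite Rpow_mult_distr; ring).
    replace (Cmod h / r * r) with (Cmod h) in K by (field; lra). simpl in K, D2, RP.
    assert (Cmod h ^ n * (Cmod (c n) * (r * r ^ n)) <= Cmod h ^ n * (Cmod h * M)) by lra.
    apply Rmult_le_reg_l in H; [|exact HP]. nra.
- right. exists r. split; [exact Hr|]. intros h Hh. apply (clim_unique (csum (fun k => c k * h ^ k)%C)).
  + apply H2. lra.
  + apply (cser_ext (fun _ => RtoC 0)); [|apply cser_zero]. intros k.
    replace (c k) with (RtoC 0); [ring|]. symmetry. apply NNPP. intros K. apply Z. exists k. exact K.
Qed.

(** * Punctured equality, meromorphic germs and the identity theorem *)

Lemma peq_sym f g a : peq f g a -> peq g f a.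
Proof. intros [r [Hr H]]. exists r. split; [exact Hr|]. intros. symmetry. auto. Qed.

Lemma peq_and f g f' g' (a : C) (P : C -> Prop) : peq f g a -> peq f' g' a ->
  (forall h, f (a + h)%C = g (a + h)%C -> f' (a + h)%C = g' (a + h)%C -> h <> 0 -> P (a + h)%C) ->
  exists r, 0 < r /\ forall h, 0 < Cmod h < r -> P (a + h)%C.
Proof.
intros [r [Hr H]] [r' [Hr' H']] HP. exists (Rmin r r'). split; [apply Rmin_glb_lt; assumption|].
intros h [Hh1 Hh2]. generalize (Rmin_l r r') (Rmin_r r r'). intros.
apply HP; [apply H; lra|apply H'; lra|apply Cmod_gt_0, Hh1].
Qed.

Lemma peq_trans f g k a : peq f g a -> peq g k a -> peq f k a.
Proof. intros H K. apply (peq_and f g g k a (fun z => f z = k z) H K). congruence. Qed.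

Lemma peq_all f g a : (forall z, f z = g z) -> peq f g a.
Proof. intros E. exists 1. split; [lra|auto]. Qed.

Lemma small_zero (x : C) (r K : R) :
  0 < r -> 0 <= K -> (forall h : C, 0 < Cmod h < r -> Cmod x <= K * Cmod h) -> x = 0.
Proof.
intros Hr HK H. apply Cmod_eq_0. generalize (Cmod_ge_0 x). intros [P|E]; [exfalso|auto].
set (d := Rmin (r / 2) (Cmod x / (2 * (K + 1)))).
assert (D : 0 < d) by (apply Rmin_glb_lt; [lra|apply Rdiv_lt_0_compat; lra]).
assert (D1 : d <= r / 2) by apply Rmin_l.
assert (D2 : d <= Cmod x / (2 * (K + 1))) by apply Rmin_r.
specialize (H (RtoC d)). rewrite Cmod_pos_R in H by lra. specialize (H ltac:(lra)).
apply (Rmult_le_compat_r (2 * (K + 1))) in D2; [|lra].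
replace (Cmod x / (2 * (K + 1)) * (2 * (K + 1))) with (Cmod x) in D2 by (field; lra). nra.
Qed.

Lemma an_peq_eq f g a : an f a -> an g a -> peq f g a -> f a = g a.
Proof.
intros F G [r [Hr E]].
destruct (an_lipschitz f a F) as [r1 [K1 [P1 [Q1 L1]]]]. destruct (an_lipschitz g a G) as [r2 [K2 [P2 [Q2 L2]]]].
apply Ceq_minus. apply (small_zero _ (Rmin r (Rmin r1 r2)) (K1 + K2)); [repeat apply Rmin_glb_lt; assumption|lra|].
intros h [Hh1 Hh2].
generalize (Rmin_l r (Rmin r1 r2)) (Rmin_r r (Rmin r1 r2)) (Rmin_l r1 r2) (Rmin_r r1 r2). intros.
specialize (L1 h ltac:(lra)). specialize (L2 h ltac:(lra)). specialize (E h ltac:(lra)). rewrite E in L1.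
rewrite Cmod_sub_comm in L1. generalize (Cmod_sub_triangle (f a) (g (a + h)%C) (g a)). lra.
Qed.

Lemma mer_an f a : an f a -> mer f a.
Proof. intros H. exists O, f. split; [exact H|]. apply peq_all. intros. simpl. ring. Qed.

Lemma meromorphic_mer F a : meromorphic F -> mer F a.
Proof.
intros H. destruct (H a) as [A|[m [g [r [Hm [G [_ [Hr E]]]]]]]].
- apply mer_an, an_analytic_at, A.
- exists m, g. split; [apply an_analytic_at, G|]. exists r. split; [exact Hr|]. intros h Hh.
  rewrite E by exact Hh. replace (a + h - a)%C with h by ring. field. apply Cpow_nz, Cmod_gt_0, Hh.
Qed.

Lemma an_sub a b : an (fun z => z - b)%C a.
Proof. apply (an_ext (fun z => 1 * z + - b)%C); [intros; ring|apply an_linear]. Qed.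

Lemma mer_plus f g a : mer f a -> mer g a -> mer (fun z => f z + g z)%C a.
Proof.
intros [m [F [HF EF]]] [n [G [HG EG]]]. exists (m + n)%nat, (fun z => (z - a) ^ n * F z + (z - a) ^ m * G z)%C. split.
- apply an_plus; apply an_mult; try assumption; apply an_pow, an_sub.
- unfold peq. apply (peq_and _ _ _ _ a (fun z => ((z - a) ^ (m + n) * (f z + g z) = (z - a) ^ n * F z + (z - a) ^ m * G z)%C) EF EG).
  intros h E1 E2 _. simpl in E1, E2. rewrite <- E1, <- E2, Cpow_add_r. ring.
Qed.

Lemma mer_mult f g a : mer f a -> mer g a -> mer (fun z => f z * g z)%C a.
Proof.
intros [m [F [HF EF]]] [n [G [HG EG]]]. exists (m + n)%nat, (fun z => F z * G z)%C. split.
- apply an_mult; assumption.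
- unfold peq. apply (peq_and _ _ _ _ a (fun z => ((z - a) ^ (m + n) * (f z * g z) = F z * G z)%C) EF EG).
  intros h E1 E2 _. rewrite <- E1, <- E2, Cpow_add_r. ring.
Qed.

Lemma mer_csum f a n : (forall j, (j < n)%nat -> mer (f j) a) -> mer (fun z => csum (fun j => f j z) n) a.
Proof.
induction n; intros H; simpl; [apply mer_an, an_const|].
apply mer_plus; [apply IHn; intros; apply H; lia|apply H; lia].
Qed.

Lemma peq_affine f g (a x y : C) : x <> 0 -> peq f g (x * a + y)%C -> peq (fun z => f (x * z + y)%C) (fun z => g (x * z + y)%C) a.
Proof.
intros Hx [r [Hr H]]. assert (P : 0 < Cmod x) by (apply Cmod_gt_0, Hx).
exists (r / Cmod x). split; [apply Rdiv_lt_0_compat; assumption|]. intros h [H1 H2].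
replace (x * (a + h) + y)%C with ((x * a + y) + x * h)%C by ring. apply H. rewrite Cmod_mult.
apply (Rmult_lt_compat_l (Cmod x)) in H2; [|exact P].
replace (Cmod x * (r / Cmod x)) with r in H2 by (field; lra). split; [apply Rmult_lt_0_compat|]; assumption.
Qed.

Lemma mer_affine f (a x y : C) : x <> 0 -> mer f (x * a + y)%C -> mer (fun z => f (x * z + y))%C a.
Proof.
intros Hx [m [g [G E]]]. exists m, (fun z => (/ x) ^ m * g (x * z + y)%C)%C. split.
- apply an_scal, an_affine, G.
- apply (peq_affine _ _ _ _ _ Hx) in E. destruct E as [r [Hr E]]. exists r. split; [exact Hr|]. intros h Hh.
  rewrite <- E by exact Hh.
  replace (x * (a + h) + y - (x * a + y))%C with (x * h)%C by ring. replace (a + h - a)%C with h by ring.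
  rewrite Cpow_mult_l, Cpow_inv by exact Hx. field. apply Cpow_nz, Hx.
Qed.

Lemma mer_Cconj f a : mer f (Cconj a) -> mer (fun z => Cconj (f (Cconj z))) a.
Proof.
intros [m [g [G [r [Hr E]]]]]. exists m, (fun z => Cconj (g (Cconj z))). split.
- rewrite <- (Cconj_conj a). apply an_Cconj, G.
- exists r. split; [exact Hr|]. intros h Hh. rewrite !Cplus_conj, <- E by (rewrite Cmod_conj; exact Hh).
  rewrite Cmult_conj, Cpow_conj. replace (a + h - a)%C with h by ring.
  replace (Cconj a + Cconj h - Cconj a)%C with (Cconj h) by ring. rewrite Cconj_conj. reflexivity.
Qed.

Lemma mer_isolated_zeros f a : mer f a ->
  (exists d, 0 < d /\ forall h, 0 < Cmod h < d -> f (a + h)%C <> 0) \/ peq f (fun _ => RtoC 0) a.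
Proof.
intros [m [g [G [r [Hr E]]]]]. destruct (an_isolated_zeros g a G) as [[d [Hd H]]|[d [Hd H]]]; [left|right];
  exists (Rmin r d); (split; [apply Rmin_glb_lt; assumption|]); intros h [H1 H2];
  generalize (Rmin_l r d) (Rmin_r r d); intros; specialize (E h ltac:(lra)); simpl in E.
- intros Z. apply (H h ltac:(lra)). rewrite <- E, Z. ring.
- rewrite (H h ltac:(lra)) in E. replace (a + h - a)%C with h in E by ring.
  apply NNPP. intros NZ. apply (Cmult_neq_0 (h ^ m) (f (a + h)%C)); auto. apply Cpow_nz, Cmod_gt_0, H1.
Qed.

(* The zero germ propagates leftwards along the horizontal line through [a]. *)
Lemma mer_zero_propagates f rho sigma :
  (forall a, rho < Re a -> mer f a) -> (forall s, sigma < Re s -> f s = 0) ->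
  forall a, rho < Re a -> peq f (fun _ => RtoC 0) a.
Proof.
intros Hm Hz a Ha. apply NNPP. intros N.
set (E := fun t => 0 <= t /\ ~ peq f (fun _ => RtoC 0) (a + RtoC t)%C).
assert (RE : forall t : R, Re (a + RtoC t)%C = Re a + t) by (intros; destruct a; reflexivity).
assert (B : bound E).
{ exists (Rmax 0 (sigma - Re a + 1)). intros t [Ht1 Ht2]. apply Rnot_lt_le. intros L. apply Ht2.
  exists 1. split; [lra|]. intros h Hh. apply Hz.
  generalize (Rmax_r 0 (sigma - Re a + 1)). intros. generalize (re_le_Cmod h). intros K.
  assert (- Re h <= Rabs (Re h)) by (rewrite <- Rabs_Ropp; apply Rle_abs).
  change (Re (a + RtoC t + h)%C) with (Re (a + RtoC t)%C + Re h). rewrite RE. lra. }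
assert (NE : exists t, E t).
{ exists 0. split; [lra|]. replace (a + RtoC 0)%C with a by ring. exact N. }
destruct (completeness E B NE) as [S [UB LUB]].
assert (S0 : 0 <= S) by (apply UB; split; [lra|]; replace (a + RtoC 0)%C with a by ring; exact N).
assert (OK : forall t, S < t -> peq f (fun _ => RtoC 0) (a + RtoC t)%C).
{ intros t Ht. apply NNPP. intros K. assert (E t) by (split; [lra|exact K]). apply UB in H. lra. }
(* S is the last place where the germ is not known to vanish; both alternatives at a + S are
   contradictory. *)
destruct (mer_isolated_zeros f (a + RtoC S)%C) as [[d [Hd H]]|[d [Hd H]]].
- apply Hm. rewrite RE. lra.
(* A point slightly to the right of a + S + d / 2 lies in the punctured disc where f has no zero,
   yet also where the germ vanishes. *)
- destruct (OK (S + d / 2) ltac:(lra)) as [r [Hr Hf]].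
  set (e := Rmin (r / 2) (d / 4)).
  assert (e1 : 0 < e) by (apply Rmin_glb_lt; lra).
  assert (e2 : e <= r / 2) by apply Rmin_l. assert (e3 : e <= d / 4) by apply Rmin_r.
  apply (H (RtoC (d / 2 + e))); [rewrite Cmod_pos_R; lra|].
  specialize (Hf (RtoC e)). rewrite Cmod_pos_R in Hf by lra. rewrite <- Hf by lra. f_equal.
  rewrite !RtoC_plus. ring.
(* If f vanishes around a + S, its germ vanishes at every real shift closer than d, so S was not the
   least upper bound. *)
- assert (U : is_upper_bound E (S - d / 2)).
  { intros t Ht. apply Rnot_lt_le. intros L. assert (t <= S) by (apply UB, Ht). destruct Ht as [Ht0 Ht].
    apply Ht. destruct (Req_dec t S) as [->|NEQ]; [exists d; split; assumption|].
    exists (S - t). split; [lra|]. intros h [Hh1 Hh2].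
    replace (a + RtoC t + h)%C with (a + RtoC S + (h + - RtoC (S - t)))%C by (rewrite RtoC_minus; ring).
    apply H. assert (A : Cmod (RtoC (S - t)) = S - t) by (apply Cmod_pos_R; lra). split.
    - generalize (Cmod_rev_triangle (- RtoC (S - t)) h). rewrite Cmod_opp, A, Cplus_comm. lra.
    - eapply Rle_lt_trans; [apply Cmod_triangle|]. rewrite Cmod_opp, A. lra. }
  apply LUB in U. lra.
Qed.

Lemma mer_identity f g rho sigma :
  (forall a, rho < Re a -> mer f a) -> (forall a, rho < Re a -> mer g a) ->
  (forall s, sigma < Re s -> f s = g s) -> forall a, rho < Re a -> peq f g a.
Proof.
intros F G E a Ha.
destruct (mer_zero_propagates (fun z => f z + - (1) * g z)%C rho sigma) with (a := a) as [r [Hr H]]; auto.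
- intros b Hb. apply mer_plus; [auto|]. apply mer_mult; [apply mer_an, an_const|auto].
- intros s Hs. rewrite E by exact Hs. ring.
- exists r. split; [exact Hr|]. intros h Hh. specialize (H h Hh). simpl in H.
  apply Ceq_minus. rewrite <- H. ring.
Qed.

(** If F had a pole with numerator g, then u g = (z - a)^m G near a with m > 0, forcing u a * g a =
    0. Hence F is analytic at a, because [meromorphic] demands that removable singularities be
    filled in. *)
Lemma meromorphic_removable F u G a : meromorphic F -> an u a -> u a <> 0 -> an G a ->
  peq (fun z => u z * F z)%C G a -> an F a /\ (u a * F a)%C = G a.
Proof.
intros H Hu U0 HG E. destruct (H a) as [A|[m [g [r [Hm [Hg [Hnz [Hr K]]]]]]]].
- apply an_analytic_at in A. split; [exact A|].
  apply (an_peq_eq (fun z => u z * F z)%C G); [apply an_mult| |]; assumption.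
- exfalso. apply an_analytic_at in Hg.
  apply (Cmult_neq_0 (u a) (g a)); [assumption|assumption|].
  rewrite (an_peq_eq (fun z => u z * g z)%C (fun z => (z - a) ^ m * G z)%C a).
  + replace (a - a)%C with (RtoC 0) by ring. destruct m; [lia|]. simpl. ring.
  + apply an_mult; assumption.
  + apply an_mult; [apply an_pow, an_sub|exact HG].
  + destruct E as [r' [Hr' E]]. exists (Rmin r r'). split; [apply Rmin_glb_lt; assumption|]. intros h [H1 H2].
    generalize (Rmin_l r r') (Rmin_r r r'); intros. rewrite <- E, K by lra.
    replace (a + h - a)%C with h by ring. field. apply Cpow_nz, Cmod_gt_0, H1.
Qed.

(** * The binomial series and Dirichlet sums *)

Lemma rsum_le_series (f : nat -> R) l : (forall k, 0 <= f k) -> is_series f l -> forall n, rsum f n <= l.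
Proof.
intros H S. apply is_series_rsum in S. apply (is_lim_seq_incr_compare _ _ S).
intros n. apply rsum_incr; auto.
Qed.

Lemma rsum_exp_le (x : R) n : 0 <= x -> rsum (fun k => x ^ k / INR (fact k)) n <= exp x.
Proof.
intros Hx. apply rsum_le_series.
- intros k. apply Rmult_le_pos; [apply pow_le, Hx|left; apply Rinv_0_lt_compat, INR_fact_lt_0].
- generalize (is_exp_Reals x). apply is_series_ext. intros n0.
  unfold scal; simpl; unfold mult; simpl. rewrite pow_n_pow. reflexivity.
Qed.

Lemma INR_S_nz n : RtoC (INR (S n)) <> 0.
Proof. intros E. apply RtoC_inj in E. apply (not_0_INR (S n)); [lia|exact E]. Qed.

Lemma INR_fact_C_nz n : RtoC (INR (fact n)) <> 0.
Proof. intros E. apply RtoC_inj in E. apply (INR_fact_neq_0 n E). Qed.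

Lemma Cexp_series (w : C) : cser (fun n => w ^ n / INR (fact n))%C (Cexp w).
Proof.
(* The exponential series is viewed along the ray t w, with t real; radius 2 leaves room for the
   evaluation at t = 1. *)
assert (K := power_series_ode (fun n => w ^ n / INR (fact n))%C 2 (exp (Cmod w * 2)) (- w) (fun t => t) (fun _ => 1)).
replace (Cexp w) with (w ^ 0 / INR (fact 0) * Cexp (- (- w * 1)))%C.
- apply (cser_ext (fun n => w ^ n / INR (fact n) * RtoC (1 ^ n))%C); [intros; rewrite pow1; ring|].
  apply K; try reflexivity.
  + intros n. rewrite Cmod_div, Cmod_pow by apply INR_fact_C_nz.
    rewrite (Cmod_pos_R (INR (fact n))) by apply pos_INR.
    replace (_ * 2 ^ n) with ((Cmod w * 2) ^ n / INR (fact n)) by (rewrite Rpow_mult_distr; unfold Rdiv; ring).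
    apply (rsum_term (fun n => (Cmod w * 2) ^ n / INR (fact n))).
    * intros k. apply Rmult_le_pos; [apply pow_le|left; apply Rinv_0_lt_compat, INR_fact_lt_0].
      generalize (Cmod_ge_0 w). lra.
    * intros m. apply rsum_exp_le. generalize (Cmod_ge_0 w). lra.
  + intros t _. apply is_derive_Reals, derivable_pt_lim_id.
  + intros t u d _ Hu Hd. apply (clim_unique _ _ _ Hd).
    apply (cser_ext (fun n => w * (w ^ n / INR (fact n) * RtoC (t ^ n)))%C).
    * intros n. rewrite fact_simpl, mult_INR, RtoC_mult. simpl Cpow. field.
      split; [apply INR_fact_C_nz|apply INR_S_nz].
    * replace (- (- w * 1) * u)%C with (w * u)%C by ring. apply cser_scal, Hu.
  + rewrite Rabs_R1. lra.
- simpl. replace (- (- w * 1))%C with w by ring. field.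
Qed.

Lemma wn_Cexp a r (g b : C) : 0 <= r -> wn a r (fun s => Cexp (g * s + b)) (exp (Re (g * a + b)%C) * exp (Cmod g * r)).
Proof.
intros Hr. exists (fun n => Cexp (g * a + b) * (g ^ n / INR (fact n)))%C. split.
- intros n. rewrite (rsum_ext _ (fun k => exp (Re (g * a + b)%C) * ((Cmod g * r) ^ k / INR (fact k)))).
  + rewrite rsum_scal. apply Rmult_le_compat_l; [left; apply exp_pos|]. apply rsum_exp_le.
    apply Rmult_le_pos; [apply Cmod_ge_0|exact Hr].
  + intros k _. rewrite Cmod_mult, Cmod_Cexp, Cmod_div, Cmod_pow by apply INR_fact_C_nz.
    rewrite (Cmod_pos_R (INR (fact k))) by apply pos_INR. rewrite Rpow_mult_distr. unfold Rdiv. ring.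
- intros h _. replace (g * (a + h) + b)%C with ((g * a + b) + g * h)%C by ring. rewrite (Cexp_plus (g * a + b) (g * h)).
  apply (cser_ext (fun n => Cexp (g * a + b) * ((g * h) ^ n / INR (fact n)))%C).
  + intros k. rewrite Cpow_mult_l. unfold Cdiv. ring.
  + apply cser_scal, Cexp_series.
Qed.

Lemma ln_nonneg x : 1 <= x -> 0 <= ln x.
Proof. intros [H|<-]; [rewrite <- ln_1; left; apply ln_increasing; lra|rewrite ln_1; lra]. Qed.

(** Since ln x >= 0, the norm of a power of x on a disc is again a power of x, with the largest real
    part of the exponent on the disc. Norms of Dirichlet terms can thus be summed like Dirichlet
    terms. *)
Lemma wn_Rcpow a r (x : R) (al be : C) : 0 <= r -> 1 <= x ->
  wn a r (fun s => Rcpow x (al * s + be)) (Rpower x (Re (al * a + be)%C + Cmod al * r)).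
Proof.
intros Hr Hx. assert (L := ln_nonneg x Hx).
apply (wn_ext _ _ (fun s => Cexp (al * ln x * s + be * ln x)%C)).
- intros h _. rewrite Rcpow_pos by lra. f_equal. ring.
- replace (Rpower x (Re (al * a + be)%C + Cmod al * r))
    with (exp (Re (al * ln x * a + be * ln x)%C) * exp (Cmod (al * ln x)%C * r)).
  + apply wn_Cexp, Hr.
  + unfold Rpower. rewrite <- exp_plus, Cmod_mult, (Cmod_pos_R (ln x)) by exact L. f_equal.
    replace (al * ln x * a + be * ln x)%C with ((al * a + be) * ln x)%C by ring. rewrite Re_mult_R_r. ring.
Qed.

Lemma an_Rcpow a (x : R) (al be : C) : 0 < x -> an (fun s => Rcpow x (al * s + be)) a.
Proof.
intros Hx. apply (an_ext (fun s => Cexp (al * ln x * s + be * ln x)%C)).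
- intros s. rewrite Rcpow_pos by exact Hx. f_equal. ring.
- eexists 1, _. split; [lra|apply wn_Cexp; lra].
Qed.

(* [cb s n] is the coefficient of [t ^ n] in [(1 + t) ^ (- s)]; [cbA A n] dominates it for [|s| <= A]. *)
Fixpoint cb (s : C) (n : nat) : C :=
  match n with O => 1 | S m => (cb s m * (- (s + INR m)) / INR (S m))%C end.

Fixpoint cbA (A : R) (n : nat) : R :=
  match n with O => 1 | S m => cbA A m * (A + INR m) / INR (S m) end.

Lemma INR_S_pos n : 0 < INR (S n).
Proof. apply lt_0_INR. lia. Qed.

Lemma cb_S s n : cb s (S n) = (cb s n * (- (s + INR n)) / INR (S n))%C.
Proof. reflexivity. Qed.

Lemma cbA_S A n : cbA A (S n) = cbA A n * (A + INR n) / INR (S n).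
Proof. reflexivity. Qed.

Lemma cbA_pos A n : 0 < A -> 0 < cbA A n.
Proof.
intros HA; induction n; [simpl; lra|]. rewrite cbA_S.
apply Rdiv_lt_0_compat; [|apply INR_S_pos]. apply Rmult_lt_0_compat; [exact IHn|generalize (pos_INR n); lra].
Qed.

Lemma cbA_summable A x : 0 < A -> 0 < x < 1 -> exists M, forall n, rsum (fun k => cbA A k * x ^ k) n <= M.
Proof.
intros HA Hx.
assert (P : forall k, 0 < cbA A k * x ^ k) by (intros; apply Rmult_lt_0_compat; [apply cbA_pos, HA|apply pow_lt; lra]).
destruct (ex_series_DAlembert (fun k => cbA A k * x ^ k) x) as [l Hl].
- lra.
- intros n. generalize (P n). lra.
- assert (L : is_lim_seq (fun n => x + x * (A - 1) * / INR (S n)) x).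
  { replace (Finite x) with (Finite (x + x * (A - 1) * 0)) by (f_equal; ring).
    apply is_lim_seq_plus'; [apply is_lim_seq_const|]. apply is_lim_seq_mult'; [apply is_lim_seq_const|].
    replace (Finite 0) with (Rbar_inv p_infty) by reflexivity.
    apply is_lim_seq_inv; [|discriminate]. apply -> is_lim_seq_incr_1. apply is_lim_seq_INR. }
  revert L. apply is_lim_seq_ext. intros n.
  generalize (P n) (P (S n)) (INR_S_pos n) (cbA_pos A n HA) (pow_lt x n ltac:(lra)). intros P1 P2 P3 P4 P5.
  rewrite Rabs_pos_eq by (left; apply Rdiv_lt_0_compat; assumption).
  rewrite cbA_S. simpl pow. rewrite S_INR in *. field. lra.
- exists l. apply rsum_le_series.
  + intros k. left. apply P.
  + revert Hl. apply is_series_ext. intros n. apply Rabs_pos_eq. left. apply P.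
Qed.

Lemma wn_cb a r A n : 0 < r -> Cmod a + r <= A -> wn a r (fun s => cb s n) (cbA A n).
Proof.
intros Hr HA. induction n.
- simpl. apply (wn_le _ _ _ (Cmod 1)); [rewrite Cmod_1; lra|apply wn_const].
- rewrite cbA_S.
  apply (wn_ext _ _ (fun s => / INR (S n) * (cb s n * ((- (1)) * s + - INR n)))%C).
  { intros h _. rewrite cb_S. unfold Cdiv. ring. }
  replace (cbA A n * (A + INR n) / INR (S n)) with (Cmod (/ INR (S n))%C * (cbA A n * (A + INR n))).
  + apply wn_scal, wn_mult; [exact Hr|exact IHn|].
    apply (wn_le _ _ _ (Cmod (- (1) * a + - INR n)%C + Cmod (- (1)) * r)); [|apply wn_linear; lra].
    rewrite Cmod_m1. generalize (Cmod_triangle (- (1) * a) (- INR n)).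
    rewrite Cmod_mult, Cmod_m1, Cmod_opp, (Cmod_pos_R (INR n)) by apply pos_INR. lra.
  + rewrite Cmod_inv by apply INR_S_nz. rewrite Cmod_pos_R by (left; apply INR_S_pos). unfold Rdiv. ring.
Qed.

Lemma Cmod_cb s A n : Cmod s < A -> Cmod (cb s n) <= cbA A n.
Proof.
intros H. replace s with (s + 0)%C by ring.
apply (wn_bound s (A - Cmod s) (fun s => cb s n)); [apply wn_cb; lra|rewrite Cmod_0; lra].
Qed.

Lemma binomial_series (s : C) (t : R) : Rabs t < 1 -> cser (fun n => cb s n * RtoC (t ^ n))%C (Rcpow (1 + t) (- s)).
Proof.
intros Ht. set (rho := (1 + Rabs t) / 2). set (A := Cmod s + 1).
assert (TP := Rabs_pos t).
assert (HA : 0 < A) by (unfold A; generalize (Cmod_ge_0 s); lra).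
assert (Hrho : 0 < rho < 1) by (unfold rho; lra).
destruct (cbA_summable A rho HA Hrho) as [M HM].
assert (POS : forall u, Rabs u < rho -> 0 < 1 + u) by (intros u Hu; apply Rabs_lt_between in Hu; lra).
assert (K := power_series_ode (cb s) rho M s (fun u => ln (1 + u)) (fun u => / (1 + u))).
replace (Rcpow (1 + t) (- s)) with (cb s O * Cexp (- (s * ln (1 + t))))%C.
- apply K.
  + intros n. apply Rle_trans with (cbA A n * rho ^ n).
    * apply Rmult_le_compat_r; [apply pow_le; lra|apply Cmod_cb; unfold A; lra].
    * apply (rsum_term (fun n => cbA A n * rho ^ n)); [|exact HM].
      intros k. left. apply Rmult_lt_0_compat; [apply cbA_pos, HA|apply pow_lt; lra].
  + rewrite Rplus_0_r. apply ln_1.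
  + intros u Hu. specialize (POS u Hu). auto_derive; [lra|field; lra].
  + intros u U d Hu HU Hd. specialize (POS u Hu).
    assert (T : cser (fun n => INR n * cb s n * RtoC (u ^ n))%C (u * d)%C).
    { replace (u * d)%C with (INR 0 * cb s 0 * RtoC (u ^ 0) + u * d)%C by (simpl; ring).
      apply (cser_recl (fun n => INR n * cb s n * RtoC (u ^ n))%C).
      apply (cser_ext (fun n => u * (INR (S n) * cb s (S n) * RtoC (u ^ n)))%C).
      - intros n. change (u ^ S n) with (u * u ^ n). rewrite (RtoC_mult u). ring.
      - apply cser_scal, Hd. }
    (* The recurrence of [cb] is the differential equation (1 + u) U' = - s U of (1 + u)^(-s). *)
    assert (E : (d + u * d = - s * U)%C).
    { apply (clim_unique _ _ _ (cser_plus _ _ _ _ Hd T)).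
      apply (cser_ext (fun n => - s * (cb s n * RtoC (u ^ n)))%C); [|apply cser_scal, HU].
      intros n. rewrite cb_S. field. apply INR_S_nz. }
    assert (NZ : RtoC (1 + u) <> 0) by (intros Z; apply RtoC_inj in Z; lra).
    replace d with ((d + u * d) / RtoC (1 + u))%C.
    * rewrite E, RtoC_inv by lra. field. exact NZ.
    * rewrite RtoC_plus in *. field. exact NZ.
  + unfold rho. lra.
- rewrite Rcpow_pos by (apply Rabs_lt_between in Ht; lra). simpl cb.
  rewrite Cmult_1_l. f_equal. ring.
Qed.

Definition bR (s : C) (J : nat) (t : R) : C :=
  (Rcpow (1 + t) (- s) - csum (fun j => cb s j * RtoC (t ^ j)) J)%C.

(** The tail at t is (|t| / t0)^J times the tail at t0, so a single constant works for all |t| <=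
    t0. This decay in t becomes decay in the summation index of the Dirichlet sums. *)
Lemma wn_bR a r A J t0 : 0 < r -> Cmod a + r <= A -> 0 < t0 < 1 ->
  exists K, 0 <= K /\ forall t, Rabs t <= t0 -> wn a r (fun s => bR s J t) (K * Rabs t ^ J).
Proof.
intros Hr HA Ht0. assert (AP : 0 < A) by (generalize (Cmod_ge_0 a); lra).
destruct (cbA_summable A t0 AP Ht0) as [M HM].
assert (TJ : 0 < t0 ^ J) by (apply pow_lt; lra).
assert (MP : 0 <= M) by apply (HM O).
exists (M / t0 ^ J). split; [apply Rmult_le_pos; [exact MP|left; apply Rinv_0_lt_compat, TJ]|].
intros t Ht.
apply (wn_series a r (fun k s => RtoC (t ^ (J + k)) * cb s (J + k))%C (fun k => Rabs t ^ (J + k) * cbA A (J + k))); auto.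
- intros k. replace (Rabs t ^ (J + k)) with (Cmod (RtoC (t ^ (J + k)))) by (rewrite Cmod_R, RPow_abs; reflexivity).
  apply wn_scal, wn_cb; assumption.
- intros n. apply Rle_trans with (rsum (fun k => (Rabs t ^ J / t0 ^ J) * (cbA A (J + k) * t0 ^ (J + k))) n).
  + apply rsum_le. intros k _. rewrite !pow_add.
    replace (Rabs t ^ J / t0 ^ J * (cbA A (J + k) * (t0 ^ J * t0 ^ k))) with (Rabs t ^ J * t0 ^ k * cbA A (J + k)) by (field; lra).
    apply Rmult_le_compat_r; [left; apply cbA_pos, AP|].
    apply Rmult_le_compat_l; [apply pow_le, Rabs_pos|]. apply pow_incr. split; [apply Rabs_pos|exact Ht].
  + rewrite rsum_scal. replace (M / t0 ^ J * Rabs t ^ J) with (Rabs t ^ J / t0 ^ J * M) by (unfold Rdiv; ring).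
    apply Rmult_le_compat_l.
    * apply Rmult_le_pos; [apply pow_le, Rabs_pos|left; apply Rinv_0_lt_compat, TJ].
    * eapply Rle_trans; [|apply (HM (J + n)%nat)].
      assert (G : forall k, 0 <= cbA A k * t0 ^ k) by (intros; left; apply Rmult_lt_0_compat; [apply cbA_pos, AP|apply pow_lt; lra]).
      clear -G. induction n; simpl; [rewrite Nat.add_0_r; apply rsum_nonneg, G|].
      rewrite Nat.add_succ_r. simpl. lra.
- intros h _. unfold bR.
  apply (cser_ext (fun k => cb (a + h) (J + k) * RtoC (t ^ (J + k)))%C); [intros; ring|].
  apply (cser_tail (fun k => cb (a + h) k * RtoC (t ^ k))%C). apply binomial_series. lra.
Qed.

(** * Convergence of Dirichlet sums *)

Lemma ln_one_minus_le y : 0 <= y < 1 -> ln (1 - y) <= - y.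
Proof.
intros H. destruct (Rle_lt_dec (ln (1 - y)) (- y)) as [L|L]; [exact L|exfalso].
apply exp_increasing in L. rewrite exp_ln in L by lra. generalize (exp_ineq1_le (- y)). lra.
Qed.

Lemma Rpower_pos x y : 0 < Rpower x y.
Proof. apply exp_pos. Qed.

(** Integral comparison in telescoping form; it follows from exp y >= 1 + y and ln (1 - y) <= - y at
    y = 1 / x. *)
Lemma Rpower_diff_ge x q : 2 <= x -> 1 < q -> (q - 1) * Rpower x (- q) <= Rpower (x - 1) (1 - q) - Rpower x (1 - q).
Proof.
intros Hx Hq. replace (x - 1) with (x * (1 - / x)) by (field; lra).
assert (I : 0 < / x <= / 2) by (split; [apply Rinv_0_lt_compat; lra|apply Rinv_le_contravar; lra]).
rewrite <- Rpower_mult_distr by lra.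
replace (- q) with ((1 - q) + - (1)) by ring. rewrite Rpower_plus, (Rpower_Ropp x 1), Rpower_1 by lra.
assert (E : 1 + (q - 1) * / x <= Rpower (1 - / x) (1 - q)).
{ unfold Rpower. eapply Rle_trans; [|apply exp_ineq1_le]. generalize (ln_one_minus_le (/ x) ltac:(lra)). nra. }
generalize (Rpower_pos x (1 - q)). nra.
Qed.

Lemma rsum_Rpower c q : 1 <= c -> 1 < q -> exists M, forall n, rsum (fun k => Rpower (INR k + c) (- q)) n <= M.
Proof.
intros Hc Hq. set (M := Rpower c (- q) + Rpower c (1 - q) / (q - 1)).
(* The partial sum plus the bound for its tail is nonincreasing, hence bounded by its initial value
   M. *)
assert (H : forall n, rsum (fun k => Rpower (INR k + c) (- q)) (S n) + Rpower (INR n + c) (1 - q) / (q - 1) <= M).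
{ induction n; [simpl; rewrite !Rplus_0_l; unfold M; lra|].
  change (rsum ?f (S (S n))) with (rsum f (S n) + f (S n)). cbv beta.
  generalize (Rpower_diff_ge (INR (S n) + c) q). rewrite S_INR. intros D.
  specialize (D ltac:(generalize (pos_INR n); lra) Hq). replace (INR n + 1 + c - 1) with (INR n + c) in D by ring.
  apply (Rmult_le_compat_r (/ (q - 1))) in D; [|left; apply Rinv_0_lt_compat; lra].
  replace ((q - 1) * Rpower (INR n + 1 + c) (- q) * / (q - 1)) with (Rpower (INR n + 1 + c) (- q)) in D by (field; lra).
  unfold Rdiv in *. lra. }
assert (P : forall n, 0 < Rpower (INR n + c) (1 - q) / (q - 1)) by (intros; apply Rdiv_lt_0_compat; [apply Rpower_pos|lra]).
exists M. intros [|n]; [|generalize (H n) (P n); lra]. simpl. generalize (H O) (P O). simpl.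
generalize (Rpower_pos (0 + c) (- q)). lra.
Qed.

(** A total operator, so that functions given by series can be named before convergence is known;
    its value is arbitrary for divergent series. *)
Definition csersum (f : nat -> C) : C := epsilon (inhabits (RtoC 0)) (fun l => cser f l).

Lemma csersum_correct f l : cser f l -> csersum f = l.
Proof.
intros H. apply (clim_unique (csum f)); [|exact H].
unfold csersum. apply (epsilon_spec (inhabits (RtoC 0)) (fun l => cser f l)). exists l. exact H.
Qed.

Lemma wn_csersum a r (f : nat -> C -> C) (M : nat -> R) B : 0 < r ->
  (forall k, wn a r (f k) (M k)) -> (forall n, rsum M n <= B) ->
  wn a r (fun s => csersum (fun k => f k s)) B /\
  forall h, Cmod h <= r -> cser (fun k => f k (a + h)%C) (csersum (fun k => f k (a + h)%C)).
Proof.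
intros Hr H HB.
assert (CV : forall h, Cmod h <= r -> cser (fun k => f k (a + h)%C) (csersum (fun k => f k (a + h)%C))).
{ intros h Hh. destruct (cser_abs (fun k => f k (a + h)%C) M B) as [l [L _]]; auto.
  - intros k. apply (wn_bound _ _ _ _ _ (H k) Hh).
  - rewrite (csersum_correct _ _ L). exact L. }
split; [|exact CV]. apply (wn_series a r f M); auto.
Qed.

Lemma dirichlet_terms (c : R) (al be a : C) (L r0 K : R) (g : nat -> C -> C) :
  1 <= c -> 0 < r0 -> (forall k, wn a r0 (g k) (K * Rpower (INR k + c) (- L))) ->
  Re (al * a + be)%C - L < -1 ->
  exists r M B, 0 < r /\
    (forall k, wn a r (fun s => Rcpow (INR k + c) (al * s + be) * g k s)%C (M k)) /\
    (forall n, rsum M n <= B).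
Proof.
(* The exponent at a lies below -1 by d. Half of this margin pays for its variation over the disc,
   since |al| r <= d / 2, and the other half keeps the series convergent. *)
intros Hc Hr0 Hg HL. set (d := - 1 - (Re (al * a + be)%C - L)).
assert (AP := Cmod_ge_0 al).
set (r := Rmin r0 (d / (2 * (Cmod al + 1)))).
assert (Hr : 0 < r) by (apply Rmin_glb_lt; [exact Hr0|apply Rdiv_lt_0_compat; unfold d; lra]).
assert (Hr1 : r <= r0) by apply Rmin_l.
assert (Hr2 : Cmod al * r <= d / 2).
{ assert (r <= d / (2 * (Cmod al + 1))) by apply Rmin_r.
  apply (Rmult_le_compat_r (2 * (Cmod al + 1))) in H; [|lra].
  replace (d / (2 * (Cmod al + 1)) * (2 * (Cmod al + 1))) with d in H by (field; lra). nra. }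
destruct (rsum_Rpower c (1 + d / 2) Hc ltac:(unfold d; lra)) as [B0 HB0].
assert (KP : 0 <= K).
{ assert (X := wn_nonneg _ _ _ _ (Hg O)). generalize (Rpower_pos (INR 0 + c) (- L)). nra. }
exists r, (fun k => K * Rpower (INR k + c) (- (1 + d / 2))), (K * B0). split; [exact Hr|]. split.
- intros k. assert (X1 : 1 <= INR k + c) by (generalize (pos_INR k); lra).
  apply (wn_le _ _ _ (Rpower (INR k + c) (Re (al * a + be)%C + Cmod al * r) * (K * Rpower (INR k + c) (- L)))).
  + rewrite (Rmult_comm K), <- Rmult_assoc, <- Rpower_plus, Rmult_comm. apply Rmult_le_compat_l; [exact KP|].
    apply Rle_Rpower; [exact X1|]. unfold d in *. lra.
  + apply wn_mult; [exact Hr|apply wn_Rcpow; lra|]. apply (wn_shrink a r0); [lra|apply Hg].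
- intros n. rewrite rsum_scal. apply Rmult_le_compat_l; [exact KP|apply HB0].
Qed.

(** * Complex derivatives *)

(** An explicit quadratic error is stronger than differentiability. Analytic functions satisfy it,
    and such bounds can be added over infinitely many functions. *)
Definition dv (f : C -> C) (a l : C) : Prop :=
  exists r K, 0 < r /\ 0 <= K /\
    forall h, Cmod h < r -> Cmod (f (a + h)%C - f a - l * h)%C <= K * Cmod h ^ 2.

Lemma dv_ext_loc f g a l r : 0 < r -> (forall h, Cmod h < r -> f (a + h)%C = g (a + h)%C) ->
  dv f a l -> dv g a l.
Proof.
intros Hr E [r' [K [Hr' [HK H]]]]. exists (Rmin r r'), K. repeat split; auto; [apply Rmin_glb_lt; assumption|].
intros h Hh. generalize (Rmin_l r r') (Rmin_r r r'). intros.
rewrite <- E by lra. assert (E0 := E 0 ltac:(rewrite Cmod_0; lra)). rewrite Cplus_0_r in E0.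
rewrite <- E0. apply H. lra.
Qed.

Lemma dv_ext f g a l : (forall z, f z = g z) -> dv f a l -> dv g a l.
Proof. intros E. apply (dv_ext_loc f g a l 1); [lra|auto]. Qed.

Lemma dv_eq f a l l' : l = l' -> dv f a l -> dv f a l'.
Proof. intros <-. auto. Qed.

Lemma dv_bound f a l : dv f a l ->
  exists r K, 0 < r /\ 0 <= K /\ forall h, Cmod h < r -> Cmod (f (a + h)%C - f a)%C <= K * Cmod h.
Proof.
intros [r [K [Hr [HK H]]]]. exists r, (K * r + Cmod l). repeat split; [exact Hr| |].
- generalize (Cmod_ge_0 l). nra.
- intros h Hh. specialize (H h Hh).
  replace (f (a + h) - f a)%C with ((f (a + h) - f a - l * h) + l * h)%C by ring.
  eapply Rle_trans; [apply Cmod_triangle|]. rewrite Cmod_mult.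
  generalize (Cmod_ge_0 h). intros.
  assert (Q : Cmod h ^ 2 <= r * Cmod h) by (simpl; nra).
  apply (Rmult_le_compat_l _ _ _ HK) in Q. lra.
Qed.

Lemma dv_unique f a l l' : dv f a l -> dv f a l' -> l = l'.
Proof.
intros [r [K [Hr [HK H]]]] [r' [K' [Hr' [HK' H']]]]. apply Ceq_minus.
apply (small_zero _ (Rmin r r') (K + K')); [apply Rmin_glb_lt; assumption|lra|].
intros h [H1 H2]. generalize (Rmin_l r r') (Rmin_r r r'). intros.
specialize (H h ltac:(lra)). specialize (H' h ltac:(lra)).
apply (Rmult_le_reg_r (Cmod h)); [exact H1|]. rewrite <- Cmod_mult.
replace ((l - l') * h)%C with ((f (a + h) - f a - l' * h) - (f (a + h) - f a - l * h))%C by ring.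
eapply Rle_trans; [apply Cmod_triangle|]. rewrite Cmod_opp. simpl in *. lra.
Qed.

Lemma dv_const a x : dv (fun _ => x) a 0.
Proof.
exists 1, 0. repeat split; try lra. intros h _. replace (x - x - 0 * h)%C with (RtoC 0) by ring. rewrite Cmod_0. lra.
Qed.

Lemma dv_plus f g a l l' : dv f a l -> dv g a l' -> dv (fun z => f z + g z)%C a (l + l')%C.
Proof.
intros [r [K [Hr [HK H]]]] [r' [K' [Hr' [HK' H']]]]. exists (Rmin r r'), (K + K').
split; [apply Rmin_glb_lt; assumption|]. split; [lra|]. intros h Hh.
generalize (Rmin_l r r') (Rmin_r r r'). intros. specialize (H h ltac:(lra)). specialize (H' h ltac:(lra)).
replace (f (a + h) + g (a + h) - (f a + g a) - (l + l') * h)%C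
  with ((f (a + h) - f a - l * h) + (g (a + h) - g a - l' * h))%C by ring.
eapply Rle_trans; [apply Cmod_triangle|]. lra.
Qed.

Lemma dv_mult f g a l l' : dv f a l -> dv g a l' -> dv (fun z => f z * g z)%C a (l * g a + f a * l')%C.
Proof.
intros F G. destruct (dv_bound _ _ _ F) as [r1 [K1 [Hr1 [HK1 H1]]]]. destruct (dv_bound _ _ _ G) as [r2 [K2 [Hr2 [HK2 H2]]]].
destruct F as [r [K [Hr [HK H]]]]. destruct G as [r' [K' [Hr' [HK' H']]]].
exists (Rmin (Rmin r r') (Rmin r1 r2)), (Cmod (g a) * K + Cmod (f a) * K' + K1 * K2).
split; [repeat apply Rmin_glb_lt; assumption|].
generalize (Cmod_ge_0 (f a)) (Cmod_ge_0 (g a)). intros P1 P2. split; [nra|]. intros h Hh.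
generalize (Rmin_l (Rmin r r') (Rmin r1 r2)) (Rmin_r (Rmin r r') (Rmin r1 r2))
  (Rmin_l r r') (Rmin_r r r') (Rmin_l r1 r2) (Rmin_r r1 r2). intros.
specialize (H h ltac:(lra)). specialize (H' h ltac:(lra)). specialize (H1 h ltac:(lra)). specialize (H2 h ltac:(lra)).
replace (f (a + h) * g (a + h) - f a * g a - (l * g a + f a * l') * h)%C
  with (g a * (f (a + h) - f a - l * h) + f a * (g (a + h) - g a - l' * h)
        + (f (a + h) - f a) * (g (a + h) - g a))%C by ring.
eapply Rle_trans; [apply Cmod_triangle|]. eapply Rle_trans; [apply Rplus_le_compat_r, Cmod_triangle|].
rewrite !Cmod_mult.
apply (Rmult_le_compat_l _ _ _ P2) in H. apply (Rmult_le_compat_l _ _ _ P1) in H'.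
assert (Q := Rmult_le_compat _ _ _ _ (Cmod_ge_0 _) (Cmod_ge_0 _) H1 H2).
replace (K1 * Cmod h * (K2 * Cmod h)) with (K1 * K2 * Cmod h ^ 2) in Q by ring. lra.
Qed.

Lemma dv_scal f a l x : dv f a l -> dv (fun z => x * f z)%C a (x * l)%C.
Proof.
intros H. replace (x * l)%C with (0 * f a + x * l)%C by ring.
apply (dv_mult (fun _ => x) f); [apply dv_const|exact H].
Qed.

Lemma dv_csum f a l n : (forall j, (j < n)%nat -> dv (f j) a (l j)) ->
  dv (fun z => csum (fun j => f j z) n) a (csum l n).
Proof.
induction n; intros H; simpl; [apply dv_const|].
apply dv_plus; [apply IHn; intros; apply H; lia|apply H; lia].
Qed.

Lemma dv_affine f (a l x y : C) : dv f (x * a + y)%C l -> dv (fun z => f (x * z + y)%C) a (x * l)%C.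
Proof.
intros [r [K [Hr [HK H]]]]. generalize (Cmod_ge_0 x). intros P.
exists (r / (Cmod x + 1)), (K * Cmod x ^ 2). split; [apply Rdiv_lt_0_compat; lra|].
split; [apply Rmult_le_pos; [exact HK|apply pow_le, P]|]. intros h Hh.
apply (Rmult_lt_compat_r (Cmod x + 1)) in Hh; [|lra].
replace (r / (Cmod x + 1) * (Cmod x + 1)) with r in Hh by (field; lra).
specialize (H (x * h)%C). rewrite Cmod_mult in H. generalize (Cmod_ge_0 h). intros Q. specialize (H ltac:(nra)).
replace (x * (a + h) + y)%C with (x * a + y + x * h)%C by ring.
replace (x * l * h)%C with (l * (x * h))%C by ring. eapply Rle_trans; [exact H|].
rewrite Rpow_mult_distr. lra.
Qed.

Lemma dv_id a : dv (fun z => z) a 1.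
Proof.
exists 1, 0. repeat split; try lra. intros h _. replace (a + h - a - 1 * h)%C with (RtoC 0) by ring. rewrite Cmod_0. lra.
Qed.

(** The error constant M / r^2 depends only on the norm and the radius, which is what a termwise
    treatment of infinite sums needs. *)
Lemma wn_dv a r f M : 0 < r -> wn a r f M ->
  exists c0 c1, f a = c0 /\ dv f a c1 /\
   forall h, Cmod h <= r -> Cmod (f (a + h)%C - c0 - c1 * h)%C <= (Cmod h / r) ^ 2 * M.
Proof.
intros Hr H. assert (HM := wn_nonneg _ _ _ _ H). destruct H as [c [H1 H2]].
assert (B : forall h, Cmod h <= r -> Cmod (f (a + h)%C - c O - c 1%nat * h)%C <= (Cmod h / r) ^ 2 * M).
{ intros h Hh. replace (f (a + h) - c 0%nat - c 1%nat * h)%C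
    with (f (a + h) - csum (fun k => c k * h ^ k) 2)%C by (simpl; ring).
  apply cser_remainder; auto. }
assert (E : f a = c O).
{ generalize (B 0 ltac:(rewrite Cmod_0; lra)). rewrite Cplus_0_r, Cmod_0.
  replace ((0 / r) ^ 2 * M) with 0 by (field; lra). intros Z.
  apply Ceq_minus, Cmod_eq_0, Rle_antisym; [|apply Cmod_ge_0].
  replace (f a - c 0%nat)%C with (f a - c 0%nat - c 1%nat * 0)%C by ring. exact Z. }
exists (c O), (c 1%nat). split; [exact E|]. split; [|exact B].
exists r, (M / r ^ 2). split; [exact Hr|]. split.
- apply Rmult_le_pos; [exact HM|left; apply Rinv_0_lt_compat, pow_lt, Hr].
- intros h Hh. rewrite E. eapply Rle_trans; [apply B; lra|]. right. field. lra.
Qed.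

Lemma an_dv f a : an f a -> exists l, dv f a l.
Proof. intros [r [M [Hr H]]]. destruct (wn_dv _ _ _ _ Hr H) as [_ [l [_ [L _]]]]. exists l. exact L. Qed.

(** A double zero shared by all terms survives summation, because their quadratic bounds (|h| / r)^2
    M k have a finite sum. *)
Lemma dv_csersum_zero a r (f : nat -> C -> C) (M : nat -> R) B : 0 < r ->
  (forall k, wn a r (f k) (M k)) -> (forall n, rsum M n <= B) ->
  (forall k, f k a = 0) -> (forall k, dv (f k) a 0) ->
  dv (fun s => csersum (fun k => f k s)) a 0.
Proof.
intros Hr H HB H0 HD. destruct (wn_csersum a r f M B Hr H HB) as [_ CV].
assert (BP : 0 <= B) by apply (HB O).
assert (Z : csersum (fun k => f k a) = 0).
{ apply csersum_correct. apply (cser_ext (fun _ => RtoC 0)); [intros; symmetry; apply H0|apply cser_zero]. }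
exists r, (B / r ^ 2). split; [exact Hr|]. split; [apply Rmult_le_pos; [exact BP|left; apply Rinv_0_lt_compat, pow_lt, Hr]|].
intros h Hh. rewrite Z. replace (_ - 0 - 0 * h)%C with (csersum (fun k => f k (a + h)%C)) by ring.
destruct (cser_abs (fun k => f k (a + h)%C) (fun k => (Cmod h / r) ^ 2 * M k) ((Cmod h / r) ^ 2 * B)) as [l [L1 L2]].
- intros k. destruct (wn_dv _ _ _ _ Hr (H k)) as [c0 [c1 [E0 [E1 E]]]].
  rewrite (dv_unique _ _ _ _ E1 (HD k)) in E. rewrite <- E0, H0 in E. specialize (E h ltac:(lra)).
  replace (f k (a + h) - 0 - 0 * h)%C with (f k (a + h)%C) in E by ring. exact E.
- intros n. rewrite rsum_scal. apply Rmult_le_compat_l; [apply pow2_ge_0|apply HB].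
- rewrite (csersum_correct _ _ L1). eapply Rle_trans; [exact L2|]. right. field. lra.
Qed.

Lemma dv_Cexp a : dv Cexp a (Cexp a).
Proof.
exists 1, (Cmod (Cexp a) * exp 1). split; [lra|].
split; [apply Rmult_le_pos; [apply Cmod_ge_0|left; apply exp_pos]|]. intros h Hh.
rewrite Cexp_plus. replace (Cexp a * Cexp h - Cexp a - Cexp a * h)%C with (Cexp a * (Cexp h - (1 + h)))%C by ring.
rewrite Cmod_mult, Rmult_assoc. apply Rmult_le_compat_l; [apply Cmod_ge_0|].
assert (K := cser_remainder (fun n => / INR (fact n))%C 1 (exp 1) h (Cexp h) 2).
replace (1 + h)%C with (csum (fun k => / INR (fact k) * h ^ k) 2)%C by (simpl; field).
eapply Rle_trans; [apply K|rewrite Rdiv_1_r; lra]; try lra.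
- intros n. eapply Rle_trans; [|apply (rsum_exp_le 1 n); lra]. apply rsum_le. intros k _.
  rewrite Cmod_inv by apply INR_fact_C_nz. rewrite Cmod_pos_R by apply pos_INR. unfold Rdiv. lra.
- apply (cser_ext (fun n => h ^ n / INR (fact n))%C); [intros; unfold Cdiv; ring|apply Cexp_series].
Qed.

Lemma dv_Rcpow a (x : R) (al be : C) : 0 < x ->
  dv (fun s => Rcpow x (al * s + be)) a (al * ln x * Rcpow x (al * a + be))%C.
Proof.
intros Hx. apply (dv_ext (fun s => Cexp (al * ln x * s + be * ln x)%C)).
- intros s. rewrite Rcpow_pos by exact Hx. f_equal. ring.
- apply dv_affine. rewrite Rcpow_pos by exact Hx.
  replace (al * ln x * a + be * ln x)%C with ((al * a + be) * ln x)%C by ring. apply dv_Cexp.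
Qed.

Lemma dv_C_derive f a l : dv f a l -> C_derive f a = l.
Proof.
intros [r [K [Hr [HK H]]]]. apply is_C_lim_unique.
refine (proj2 (filterlim_locally _ l) _). intros eps.
set (d := Rmin r (eps / (K + 1))).
assert (D : 0 < d) by (apply Rmin_glb_lt; [exact Hr|apply Rdiv_lt_0_compat; [apply cond_pos|lra]]).
assert (D1 : d <= r) by apply Rmin_l. assert (D2 : d <= eps / (K + 1)) by apply Rmin_r.
assert (DD : 0 < d / 2) by lra.
(* Half of d suffices: a product ball of radius d / 2 lies in a disc of radius sqrt 2 * (d / 2) <
   d. *)
exists (mkposreal (d / 2) DD). intros y Hy Hne. apply C_NormedModule_mixin_compat1.
apply C_NormedModule_mixin_compat2 in Hy. simpl in Hy.
change (Cmod (y - a)%C < sqrt 2 * (d / 2)) in Hy.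
change (Cmod ((f y - f a) / (y - a) - l)%C < eps).
assert (S2 : sqrt 2 <= 2) by (rewrite <- (sqrt_square 2) at 2 by lra; apply sqrt_le_1; lra).
set (h := (y - a)%C) in *. assert (Hh : Cmod h < d) by nra.
assert (HN : h <> 0) by (intros Z; apply Hne; apply Ceq_minus; exact Z).
assert (HP : 0 < Cmod h) by (apply Cmod_gt_0, HN).
replace y with (a + h)%C by (unfold h; ring). specialize (H h ltac:(lra)).
replace ((f (a + h) - f a) / h - l)%C with ((f (a + h) - f a - l * h) / h)%C by (field; exact HN).
rewrite Cmod_div by exact HN. apply (Rmult_lt_reg_r (Cmod h)); [exact HP|].
replace (_ / Cmod h * Cmod h) with (Cmod (f (a + h) - f a - l * h)%C) by (field; lra).
eapply Rle_lt_trans; [exact H|].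
apply (Rmult_le_compat_r (K + 1)) in D2; [|lra].
replace (eps / (K + 1) * (K + 1)) with (pos eps) in D2 by (field; lra).
assert ((K + 1) * Cmod h < eps) by nra. simpl. nra.
Qed.

(** * The Hurwitz zeta function *)

Lemma csum_double (f : nat -> C) n : csum f (2 * n) = csum (fun l => f (2 * l)%nat + f (2 * l + 1)%nat)%C n.
Proof.
induction n; [reflexivity|]. replace (2 * S n)%nat with (S (S (2 * n))) by lia.
simpl csum at 1. change (n + (n + 0))%nat with (2 * n)%nat. rewrite IHn. simpl csum.
change (n + (n + 0))%nat with (2 * n)%nat. rewrite Nat.add_1_r. ring.
Qed.

Lemma cb_0_l n : cb 0 (S n) = 0.
Proof. induction n; rewrite cb_S; [simpl; field|rewrite IHn; field; apply INR_S_nz]. Qed.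

Lemma bR_0_l J t : (1 <= J)%nat -> Rabs t < 1 -> bR 0 J t = 0.
Proof.
intros HJ Ht. unfold bR. rewrite Copp_0, Rcpow_0_r by (apply Rabs_lt_between in Ht; lra).
destruct J as [|J]; [lia|]. rewrite csum_recl, csum_zero; [simpl; ring|].
intros k _. rewrite cb_0_l. ring.
Qed.

(** With x = k + c this is the t for which x (1 + t) and x (1 - t) are x + 1/2 and x - 1/2. *)
Definition hstep (c : R) (k : nat) : R := / (2 * (INR k + c)).

(** What remains of (x + 1/2)^(1 - z) - (x - 1/2)^(1 - z) after the binomial orders below 2 J. The
    arguments keep the affine shape required by [dirichlet_terms] and [wn_affine]. *)
Definition hterm (c : R) (J k : nat) (z : C) : C :=
  (Rcpow (INR k + c) (- (1) * z + 1)
   * (bR (1 * z + - (1)) (2 * J) (hstep c k) + - (1) * bR (1 * z + - (1)) (2 * J) (- hstep c k)))%C.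

Definition hrem (c : R) (J : nat) (z : C) : C := csersum (fun k => hterm c J k z).

Lemma hstep_bounds c k : 1 <= c -> 0 < hstep c k <= / 2.
Proof.
intros Hc. unfold hstep. generalize (pos_INR k). intros. split.
- apply Rinv_0_lt_compat. lra.
- apply Rinv_le_contravar; lra.
Qed.

Lemma Rpower_opp_nat x n : 0 < x -> Rpower x (- INR n) = (/ x) ^ n.
Proof. intros Hx. rewrite Rpower_Ropp, Rpower_pow by exact Hx. symmetry. apply pow_inv. Qed.

(** The prefactor has size x^(1 - Re z) and the binomial remainder x^(- 2 J), so the sum over k
    converges exactly when the exponent 1 - Re z - 2 J is below -1. *)
Lemma hterm_wn c J a : 1 <= c -> 2 - 2 * INR J < Re a ->
  exists r M B, 0 < r /\ (forall k, wn a r (hterm c J k) (M k)) /\ (forall n, rsum M n <= B).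
Proof.
intros Hc Ha.
destruct (wn_bR (1 * a + - (1))%C 1 (Cmod (1 * a + - (1))%C + 1) (2 * J) (/ 2)) as [K [HK H]]; try lra.
apply (dirichlet_terms c (- (1)) 1 a (INR (2 * J)) 1 (2 * K * (/ 2) ^ (2 * J))); try lra.
- intros k. assert (X : 0 < INR k + c) by (generalize (pos_INR k); lra).
  destruct (hstep_bounds c k Hc) as [T1 T2].
  assert (W : forall u, Rabs u = hstep c k ->
    wn a 1 (fun z => bR (1 * z + - (1))%C (2 * J) u) (K * hstep c k ^ (2 * J))).
  { intros u Hu. apply (wn_affine a 1 1 (- (1)) (fun s => bR s (2 * J) u)).
    rewrite Cmod_1, Rmult_1_r, <- Hu. apply H. lra. }
  apply (wn_le _ _ _ (K * hstep c k ^ (2 * J) + Cmod (- (1))%C * (K * hstep c k ^ (2 * J)))).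
  + rewrite Cmod_m1, Rpower_opp_nat by exact X. unfold hstep.
    rewrite Rinv_mult, Rpow_mult_distr. right. ring.
  + apply wn_plus; [|apply wn_scal]; apply W; rewrite ?Rabs_Ropp; apply Rabs_pos_eq; lra.
- rewrite mult_INR. change (INR 2) with 2.
  replace (Re (- (1) * a + 1)%C) with (1 - Re a) by (destruct a; unfold Re; simpl; ring). lra.
Qed.

Lemma hrem_an c J a : 1 <= c -> 2 - 2 * INR J < Re a -> an (hrem c J) a.
Proof.
intros Hc Ha. destruct (hterm_wn c J a Hc Ha) as [r [M [B [Hr [H HB]]]]].
exists r, B. split; [exact Hr|]. apply (wn_csersum a r _ M B Hr H HB).
Qed.

Lemma hrem_cser c J a : 1 <= c -> 2 - 2 * INR J < Re a -> cser (fun k => hterm c J k a) (hrem c J a).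
Proof.
intros Hc Ha. destruct (hterm_wn c J a Hc Ha) as [r [M [B [Hr [H HB]]]]].
destruct (wn_csersum a r _ M B Hr H HB) as [_ K]. specialize (K 0 ltac:(rewrite Cmod_0; lra)).
rewrite Cplus_0_r in K. exact K.
Qed.

(** The order 2l + 1 occurs twice in the symmetric difference, and x t = 1/2 turns 2 t^(2l+1)
    x^(2l+1) into 4^(-l). The last factor z + 2l - 1 of the binomial coefficient is split off: it
    cancels the pole of F (z + 2l). *)
Definition hcoef (l : nat) (z : C) : C := (/ INR (2 * l + 1) * / 4 ^ l * cb (z - 1) (2 * l))%C.

Lemma hcoef_0 z : hcoef 0 z = 1.
Proof. unfold hcoef. simpl. field. Qed.

Lemma C4_pow_nz l : (RtoC 4 ^ l)%C <> 0.
Proof. apply Cpow_nz. intros E. apply RtoC_inj in E. lra. Qed.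

Lemma RtoC_nz x : x <> 0 -> RtoC x <> 0.
Proof. intros H E. apply RtoC_inj in E. auto. Qed.

(** Only odd orders survive in the difference of the expansions at t and -t, so the exponents
    advance in steps of 2. *)
Lemma hurwitz_difference c J k z : 1 <= c ->
  (Rcpow (INR k + c + / 2) (1 - z) - Rcpow (INR k + c - / 2) (1 - z)
   = - csum (fun l => hcoef l z * (z + INR (2 * l) - 1) * Rcpow (INR k + c) (- (z + INR (2 * l)))) J
     + hterm c J k z)%C.
Proof.
intros Hc. set (x := INR k + c). set (t := hstep c k).
assert (X : 1 <= x) by (unfold x; generalize (pos_INR k); lra).
destruct (hstep_bounds c k Hc) as [T1 T2]. fold t in T1, T2.
assert (XT : x * t = / 2) by (unfold t, hstep; fold x; field; lra).
replace (x + / 2) with (x * (1 + t)) by (rewrite <- XT; ring).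
replace (x - / 2) with (x * (1 + - t)) by (rewrite <- XT; ring).
rewrite !Rcpow_mult_base by lra.
assert (EB : forall u, Rcpow (1 + u) (1 - z) = (bR (1 * z + - (1)) (2 * J) u
     + csum (fun j => cb (z - 1) j * RtoC (u ^ j)) (2 * J))%C).
{ intros u. unfold bR. replace (1 * z + - (1))%C with (z - 1)%C by ring.
  replace (- (z - 1))%C with (1 - z)%C by ring. ring. }
rewrite !EB. unfold hterm. fold x t. replace (- (1) * z + 1)%C with (1 - z)%C by ring.
rewrite !csum_double.
match goal with |- (?p * (?b1 + ?s1) - ?p * (?b2 + ?s2) = - ?s3 + _)%C =>
  assert (ES : (p * s1 - p * s2 = - s3)%C) end.
{ rewrite <- !csum_scal. replace (- csum _ J)%C with (- (1) * csum (fun l =>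
    hcoef l z * (z + INR (2 * l) - 1) * Rcpow x (- (z + INR (2 * l)))) J)%C by ring.
  rewrite <- csum_scal.
  match goal with |- (csum ?f J - csum ?g J = _)%C => replace (csum f J - csum g J)%C
    with (csum f J + - (1) * csum g J)%C by ring; rewrite <- (csum_scal _ g), <- csum_plus end.
  apply csum_ext. intros l _. unfold hcoef.
  assert (P1 : (- t) ^ (2 * l) = t ^ (2 * l)) by (rewrite !pow_mult; f_equal; ring).
  assert (P2 : (- t) ^ (2 * l + 1) = - t ^ (2 * l + 1)) by (rewrite !pow_add, P1; ring).
  rewrite P1, P2, RtoC_opp.
  assert (P3 : Rcpow x (1 - z) = (Rcpow x (- (z + INR (2 * l))) * RtoC (x ^ (2 * l + 1)))%C).
  { rewrite <- Rcpow_INR, <- Rcpow_plus by lra. f_equal. rewrite plus_INR, RtoC_plus. simpl (INR 1). ring. }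
  rewrite P3.
  assert (P4 : (RtoC (x ^ (2 * l + 1)) * RtoC (t ^ (2 * l + 1)) = / 2 * / 4 ^ l)%C).
  { rewrite <- RtoC_mult, <- Rpow_mult_distr, XT, pow_add, pow_mult. rewrite pow_1, RtoC_mult.
    rewrite <- (RtoC_inv 2) by lra. replace ((/ 2) ^ 2) with (/ 4) by field.
    rewrite pow_inv, (RtoC_inv (4 ^ l)), RtoC_pow; [ring|]. apply pow_nonzero. lra. }
  replace (cb (z - 1) (2 * l + 1)) with (cb (z - 1) (2 * l) * (- (z - 1 + INR (2 * l))) / INR (2 * l + 1))%C
    by (rewrite Nat.add_1_r; reflexivity).
  match goal with |- ?lhs = ?rhs => transitivity (2 * Rcpow x (- (z + INR (2 * l)))
     * (cb (z - 1) (2 * l) * - (z - 1 + INR (2 * l)) / INR (2 * l + 1))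
     * (RtoC (x ^ (2 * l + 1)) * RtoC (t ^ (2 * l + 1))))%C; [ring|] end.
  rewrite P4. field. split; [apply C4_pow_nz|rewrite Nat.add_1_r; apply INR_S_nz]. }
rewrite <- ES. ring.
Qed.

Lemma cser_term_lim f l : cser f l -> clim f 0.
Proof.
intros H. apply (clim_ext (fun n => csum f (S n) + - (1) * csum f n)%C); [intros; simpl; ring|].
replace (RtoC 0) with (l + - (1) * l)%C by ring. apply clim_plus; [|apply clim_scal, H].
apply (clim_subseq (csum f) l S); [intros; lia|exact H].
Qed.

Lemma Rcpow_lim c z : 1 <= c -> 2 < Re z -> clim (fun k => Rcpow (INR k + c) (1 - z)) 0.
Proof.
intros Hc Hz. destruct (rsum_Rpower c (Re z - 1) Hc ltac:(lra)) as [M HM].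
destruct (cser_abs (fun k => Rcpow (INR k + c) (1 - z)) (fun k => Rpower (INR k + c) (- (Re z - 1))) M) as [l [L _]].
- intros k. rewrite Cmod_Rcpow by (generalize (pos_INR k); lra). right. f_equal.
  destruct z. unfold Re; simpl. ring.
- exact HM.
- apply (cser_term_lim _ _ L).
Qed.

Lemma telescoping_cser c z : 1 <= c -> 2 < Re z ->
  cser (fun k => Rcpow (INR k + c + / 2) (1 - z) - Rcpow (INR k + c - / 2) (1 - z))%C
    (- Rcpow (c - / 2) (1 - z))%C.
Proof.
intros Hc Hz. apply (clim_shift _ _ 1).
apply (clim_ext (fun n => Rcpow (INR n + (c + / 2)) (1 - z) + - Rcpow (c - / 2) (1 - z))%C).
- intros n. rewrite Nat.add_1_r. induction n.
  + simpl. replace (0 + (c + / 2)) with (0 + c + / 2) by ring. replace (0 + c - / 2) with (c - / 2) by ring. ring.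
  + change (csum ?f (S (S n))) with (csum f (S n) + f (S n))%C. cbv beta. rewrite <- IHn.
    rewrite S_INR. replace (INR n + 1 + c - / 2) with (INR n + (c + / 2)) by field.
    replace (INR n + 1 + c + / 2) with (INR n + 1 + (c + / 2)) by ring. ring.
- assert (K := clim_plus _ _ _ _ (Rcpow_lim (c + / 2) z ltac:(lra) Hz) (clim_const (- Rcpow (c - / 2) (1 - z))%C)).
  rewrite Cplus_0_l in K. exact K.
Qed.

(** The function (z - 1) F(z), set to the expected residue 1 at z = 1, where F itself has no
    prescribed value. Analyticity of [hE F] at 1 thus contains the value of the residue. *)
Definition hE (F : C -> C) (z : C) : C :=
  if excluded_middle_informative (z = 1) then 1 else ((z - 1) * F z)%C.

Lemma hE_1 F : hE F 1 = 1.
Proof. unfold hE. destruct excluded_middle_informative; congruence. Qed.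

Lemma hE_neq F (z : C) : z <> 1 -> hE F z = ((z - 1) * F z)%C.
Proof. intros H. unfold hE. destruct excluded_middle_informative; congruence. Qed.

Lemma is_hurwitz_cser c F : is_hurwitz_zeta c F ->
  exists sigma, forall s, sigma < Re s -> cser (fun j => Rcpow (INR j + c) (- s)) (F s).
Proof. intros [_ [sigma H]]. exists sigma. intros s Hs. apply is_series_cser, H, Hs. Qed.

Lemma peq_nearby (f g : C -> C) a : (forall z : C, z <> 1 -> f z = g z) -> peq f g a.
Proof.
intros H. destruct (classic (a = 1)) as [->|N].
- exists 1. split; [lra|]. intros h [Hh _]. apply H. intros E. apply Cmod_gt_0 in Hh. apply Hh.
  replace h with (1 + h - 1)%C by ring. rewrite E. ring.
- assert (P : 0 < Cmod (1 - a)%C) by (apply Cmod_gt_0; intros E; apply N; symmetry; apply Ceq_minus, E).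
  exists (Cmod (1 - a)%C). split; [exact P|]. intros h [_ Hh]. apply H. intros E.
  replace h with (1 - a)%C in Hh by (rewrite <- E; ring). lra.
Qed.

Lemma mer_ext f g a : peq f g a -> mer f a -> mer g a.
Proof.
intros E [m [G [HG H]]]. exists m, G. split; [exact HG|].
unfold peq. apply (peq_and _ _ _ _ a (fun z => ((z - a) ^ m * g z = G z)%C) E H). simpl. congruence.
Qed.

Lemma mer_hE c F a : is_hurwitz_zeta c F -> mer (hE F) a.
Proof.
intros [H _]. apply (mer_ext (fun z => (z - 1) * F z)%C).
- apply peq_sym, peq_nearby. intros z Hz. apply hE_neq, Hz.
- apply mer_mult; [apply mer_an, an_sub|apply meromorphic_mer, H].
Qed.

Lemma an_cb a n : an (fun s => cb s n) a.
Proof. exists 1, (cbA (Cmod a + 1) n). split; [lra|apply wn_cb; lra]. Qed.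

Lemma an_hcoef l a : an (hcoef l) a.
Proof.
apply (an_ext (fun z => (/ INR (2 * l + 1) * / 4 ^ l) * cb (1 * z + - (1)) (2 * l))%C).
- intros z. unfold hcoef. replace (1 * z + - (1))%C with (z - 1)%C by ring. ring.
- apply an_scal, (an_affine (fun s => cb s (2 * l))), an_cb.
Qed.

Lemma Re_plus_INR z n : Re (z + INR n)%C = Re z + INR n.
Proof. destruct z. reflexivity. Qed.

Lemma Csub_1_nz (z : C) : z <> 1 -> (z - 1)%C <> 0.
Proof. intros H E. apply H, Ceq_minus, E. Qed.

(* Summing [hurwitz_difference] over [k] makes the left-hand side telescope. *)
Lemma hurwitz_recursion_peq c F J a : 1 <= c -> is_hurwitz_zeta c F -> 2 - 2 * INR J < Re a ->
  peq (fun z => csum (fun l => hcoef l z * hE F (z + INR (2 * l))) J)%C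
      (fun z => Rcpow (c - / 2) (- (1) * z + 1) + hrem c J z)%C a.
Proof.
intros Hc HF Ha. destruct (is_hurwitz_cser c F HF) as [sigma Hs].
apply (mer_identity _ _ (2 - 2 * INR J) (Rmax sigma 2)); [| | |exact Ha].
- intros b Hb. apply mer_csum. intros l _. apply mer_mult; [apply mer_an, an_hcoef|].
  apply (mer_ext (fun z => hE F (1 * z + INR (2 * l)))%C).
  + apply peq_all. intros z. f_equal. ring.
  + apply mer_affine; [apply C1_nz|apply (mer_hE c), HF].
- intros b Hb. apply mer_an, an_plus; [apply an_Rcpow; lra|apply hrem_an; assumption].
- intros z Hz. generalize (Rmax_l sigma 2) (Rmax_r sigma 2). intros M1 M2.
  assert (T := telescoping_cser c z Hc ltac:(lra)).
  assert (S : cser (fun k => Rcpow (INR k + c + / 2) (1 - z) - Rcpow (INR k + c - / 2) (1 - z))%C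
     (- (1) * csum (fun l => (hcoef l z * (z + INR (2 * l) - 1)) * F (z + INR (2 * l))) J + hrem c J z)%C).
  { apply (cser_ext (fun k => - (1) * csum (fun l => hcoef l z * (z + INR (2 * l) - 1) * Rcpow (INR k + c) (- (z + INR (2 * l)))) J
        + hterm c J k z)%C).
    - intros k. rewrite (hurwitz_difference c J) by exact Hc. ring.
    - apply cser_plus; [|apply hrem_cser; [exact Hc|]].
      + apply cser_scal.
        apply (cser_csum (fun l k => hcoef l z * (z + INR (2 * l) - 1) * Rcpow (INR k + c) (- (z + INR (2 * l))))%C
          (fun l => hcoef l z * (z + INR (2 * l) - 1) * F (z + INR (2 * l)))%C).
        intros l _. apply cser_scal, Hs. rewrite Re_plus_INR. generalize (pos_INR (2 * l)). lra.
      + destruct J as [|J]; [simpl in *; lra|]. generalize (pos_INR (S J)). lra. }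
  assert (E := clim_unique _ _ _ T S).
  rewrite (csum_ext _ (fun l => hcoef l z * (z + INR (2 * l) - 1) * F (z + INR (2 * l)))%C).
  + replace (- (1) * z + 1)%C with (1 - z)%C by ring.
    replace (Rcpow (c - / 2) (1 - z)) with (- - Rcpow (c - / 2) (1 - z))%C by ring. rewrite E. ring.
  + intros l _. rewrite hE_neq; [ring|]. intros E1. apply (f_equal Re) in E1. rewrite Re_plus_INR in E1.
    simpl in E1. generalize (pos_INR (2 * l)). intros. simpl in *. lra.
Qed.

Lemma hrem_1 c J : 1 <= c -> (1 <= J)%nat -> hrem c J 1 = 0.
Proof.
intros Hc HJ. apply csersum_correct. apply (cser_ext (fun _ => RtoC 0)); [|apply cser_zero].
intros k. unfold hterm. destruct (hstep_bounds c k Hc) as [T1 T2].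
replace (1 * 1 + - (1))%C with (RtoC 0) by ring.
rewrite !bR_0_l; [ring| | | |]; try lia; rewrite ?Rabs_Ropp, Rabs_pos_eq; lra.
Qed.

(** The recursion has leading coefficient [hcoef 0] = 1, so it can be solved for [hE F z] in terms
    of analytic functions and of the values at z + 2, z + 4, ... *)
Lemma an_hE_step c F J a : 1 <= c -> is_hurwitz_zeta c F -> (1 <= J)%nat -> 2 - 2 * INR J < Re a ->
  (forall l, (1 <= l < J)%nat -> an (hE F) (a + INR (2 * l))%C) -> an (hE F) a.
Proof.
intros Hc HF HJ Ha IH. assert (P := hurwitz_recursion_peq c F J a Hc HF Ha).
destruct J as [|J]; [lia|].
set (G := fun z => (Rcpow (c - / 2) (- (1) * z + 1) + hrem c (S J) z
   + - (1) * csum (fun l => hcoef (S l) z * hE F (1 * z + INR (2 * S l))) J)%C).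
assert (HG : an G a).
{ apply an_plus; [apply an_plus; [apply an_Rcpow; lra|apply hrem_an; assumption]|].
  apply an_scal, an_csum. intros l Hl. apply an_mult; [apply an_hcoef|].
  apply an_affine. rewrite Cmult_1_l. apply IH. lia. }
assert (PG : peq (hE F) G a).
{ apply (peq_and _ _ _ _ a (fun z => hE F z = G z) P P). intros h E _ _. unfold G. rewrite <- E.
  rewrite csum_recl, hcoef_0.
  rewrite (csum_ext (fun l => hcoef (S l) (a + h) * hE F (1 * (a + h) + INR (2 * S l)))%C
      (fun l => hcoef (S l) (a + h) * hE F (a + h + INR (2 * S l)))%C).
  - change (INR (2 * 0)) with 0. replace (a + h + 0)%C with (a + h)%C by ring. ring.
  - intros l _. rewrite Cmult_1_l. reflexivity. }
destruct (classic (a = 1)) as [->|N].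
- destruct PG as [r [Hr E]]. apply (an_ext_loc G (hE F) 1 r Hr); [|exact HG]. intros h Hh.
  destruct (classic (h = 0)) as [->|Hn].
  (* At z = 1 the remainder and all coefficients with l >= 1 vanish together with [cb 0], and (c -
     1/2)^0 = 1 is left: the residue is 1. *)
  + rewrite Cplus_0_r, hE_1. unfold G.
    rewrite hrem_1, csum_zero by (try intros l _; try lia; try lra;
      unfold hcoef; replace (1 - 1)%C with (RtoC 0) by ring;
      replace (2 * S l)%nat with (S (2 * l + 1)) by lia; rewrite cb_0_l; ring).
    replace (- (1) * 1 + 1)%C with (RtoC 0) by ring. rewrite Rcpow_0_r by lra. ring.
  + symmetry. apply E. split; [apply Cmod_gt_0, Hn|exact Hh].
- destruct HF as [HM _].
  destruct (meromorphic_removable F (fun z => z - 1)%C G a HM (an_sub a 1) (Csub_1_nz a N) HG) as [A _].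
  + apply (peq_trans _ (hE F)); [|exact PG]. apply peq_nearby. intros z Hz. symmetry. apply hE_neq, Hz.
  + apply (an_ext_loc (fun z => (z - 1) * F z)%C (hE F) a (Cmod (1 - a)%C)).
    * apply Cmod_gt_0. intros E. apply N. symmetry. apply Ceq_minus, E.
    * intros h Hh. symmetry. apply hE_neq. intros E. replace h with (1 - a)%C in Hh by (rewrite <- E; ring). lra.
    * apply an_mult; [apply an_sub|exact A].
Qed.

(** Each application of the recursion widens the half-plane of analyticity by 2, since the shifted
    arguments lie at least 2 further to the right. *)
Lemma an_hE c F a : 1 <= c -> is_hurwitz_zeta c F -> an (hE F) a.
Proof.
intros Hc HF.
assert (H : forall J a, 2 - 2 * INR (S J) < Re a -> an (hE F) a).
{ induction J; intros b Hb.
  - apply (an_hE_step c F 1 b Hc HF); [lia|exact Hb|]. intros l Hl. lia.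
  - apply (an_hE_step c F (S (S J)) b Hc HF); [lia|exact Hb|]. intros l Hl. apply IHJ.
    rewrite Re_plus_INR, mult_INR. rewrite !S_INR in *. change (INR 2) with 2.
    assert (1 <= INR l) by (apply (le_INR 1); lia). simpl. lra. }
destruct (INR_unbounded (2 - Re a)) as [J HJ]. apply (H J). rewrite S_INR. generalize (pos_INR J). lra.
Qed.

Lemma hurwitz_an c F (a : C) : 1 <= c -> is_hurwitz_zeta c F -> a <> 1 -> an F a.
Proof.
intros Hc HF N. assert (A := an_hE c F a Hc HF). destruct HF as [HM _].
apply (meromorphic_removable F (fun z => z - 1)%C (hE F) a HM (an_sub a 1) (Csub_1_nz a N) A).
apply peq_nearby. intros z Hz. symmetry. apply hE_neq, Hz.
Qed.

Lemma hurwitz_recursion c F J a : 1 <= c -> is_hurwitz_zeta c F -> 2 - 2 * INR J < Re a ->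
  (csum (fun l => hcoef l a * hE F (a + INR (2 * l))) J = Rcpow (c - / 2) (1 - a) + hrem c J a)%C.
Proof.
intros Hc HF Ha. replace (1 - a)%C with (- (1) * a + 1)%C by ring.
apply (an_peq_eq (fun z => csum (fun l => hcoef l z * hE F (z + INR (2 * l))) J)%C
  (fun z => Rcpow (c - / 2) (- (1) * z + 1) + hrem c J z)%C); [| |apply hurwitz_recursion_peq; assumption].
- apply an_csum. intros l _. apply an_mult; [apply an_hcoef|].
  apply (an_ext (fun z => hE F (1 * z + INR (2 * l)))%C); [intros; f_equal; ring|].
  apply an_affine, (an_hE c); assumption.
- apply an_plus; [apply an_Rcpow; lra|apply hrem_an; assumption].
Qed.

(** * Trivial zeros of the Riemann zeta function *)

Lemma cb_opp_INR M j : (j <= M)%nat -> (cb (- INR M) j * INR (fact j) * INR (fact (M - j)) = INR (fact M))%C.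
Proof.
induction j; intros Hj.
- rewrite Nat.sub_0_r. simpl. ring.
- rewrite <- IHj by lia. rewrite cb_S, fact_simpl, mult_INR, RtoC_mult.
  replace (fact (M - j)) with ((M - j) * fact (M - S j))%nat
    by (replace (M - j)%nat with (S (M - S j)) by lia; rewrite fact_simpl; f_equal; lia).
  rewrite mult_INR, RtoC_mult, (minus_INR M j), RtoC_minus by lia. field. apply INR_S_nz.
Qed.

Lemma cb_opp_INR_zero M j : (M < j)%nat -> cb (- INR M) j = 0.
Proof.
intros H. induction H; rewrite cb_S.
- replace (- INR M + INR M)%C with (RtoC 0) by ring. field. apply INR_S_nz.
- rewrite IHle. field. apply INR_S_nz.
Qed.

(** For the exponent M the binomial series is the finite expansion of (1 + t)^M, so nothing remains
    beyond order M. *)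
Lemma bR_opp_INR M J t : (M < J)%nat -> Rabs t < 1 -> bR (- INR M) J t = 0.
Proof.
intros HJ Ht. unfold bR.
rewrite (clim_unique _ _ _ (binomial_series (- INR M) t Ht)
  (cser_finite (fun n => cb (- INR M) n * RtoC (t ^ n))%C J
     ltac:(intros k Hk; cbv beta; rewrite cb_opp_INR_zero by lia; ring))).
ring.
Qed.

Lemma riemann_hurwitz zeta : is_riemann_zeta zeta -> is_hurwitz_zeta 1 zeta.
Proof.
intros [H [sigma Hs]]. split; [exact H|]. exists sigma. intros s Hs'.
generalize (Hs s Hs'). apply is_series_ext. intros n. rewrite S_INR. reflexivity.
Qed.

(** At z = -2m with c = 1 the remainder vanishes and the right-hand side is (1/2)^(2m+1). For m >= 1
    the term at argument 0 has coefficient 4^(-m) and value 1/2, so it already equals the right-hand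
    side; by induction nothing is left for [hE zeta] at -2m. *)
Lemma hE_zeta_even zeta m : is_riemann_zeta zeta ->
  hE zeta (- INR (2 * m))%C = if Nat.eqb m 0 then / 2 else 0.
Proof.
intros Hz. apply riemann_hurwitz in Hz.
induction m as [m IH] using lt_wf_ind.
(* The strict condition 2 - 2J < -2m forces J >= m + 2. The extra term l = m + 1, with argument 2,
   has coefficient 0. *)
assert (R := hurwitz_recursion 1 zeta (m + 2) (- INR (2 * m))%C (Rle_refl 1) Hz).
assert (ES : (- INR (2 * m) - 1)%C = (- INR (2 * m + 1))%C) by (rewrite plus_INR, RtoC_plus; simpl (INR 1); ring).
assert (HR : hrem 1 (m + 2) (- INR (2 * m))%C = 0).
{ apply csersum_correct, (cser_ext (fun _ => RtoC 0)); [|apply cser_zero]. intros k. unfold hterm.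
  destruct (hstep_bounds 1 k (Rle_refl 1)) as [T1 T2].
  replace (1 * - INR (2 * m) + - (1))%C with (- INR (2 * m + 1))%C by (rewrite <- ES; ring).
  rewrite !bR_opp_INR; [ring| | | |]; try lia; rewrite ?Rabs_Ropp, Rabs_pos_eq; lra. }
rewrite HR in R.
assert (RE : 2 - 2 * INR (m + 2) < Re (- INR (2 * m))%C).
{ rewrite plus_INR, mult_INR. simpl. lra. }
specialize (R RE). clear RE. replace (m + 2)%nat with (S (S m)) in R by lia.
change (csum ?f (S (S m))) with (csum f (S m) + f (S m))%C in R. cbv beta in R.
unfold hcoef at 2 in R. rewrite ES, (cb_opp_INR_zero _ (2 * S m)) in R by lia.
replace (1 - - INR (2 * m))%C with (RtoC (INR (2 * m + 1))) in R by (rewrite plus_INR, RtoC_plus; simpl (INR 1); ring).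
rewrite Rcpow_INR in R by lra. replace (1 - / 2) with (/ 2) in R by field.
assert (H0 := hcoef_0 (- INR (2 * m))%C).
destruct m as [|m].
- change (csum ?f 1) with (0 + f O)%C in R. cbv beta in R. rewrite H0 in R.
  change (INR (2 * 0)) with 0 in *. change (2 * 0 + 1)%nat with 1%nat in R. rewrite pow_1 in R.
  replace (- 0 + 0)%C with (- 0)%C in R by ring.
  simpl Nat.eqb. cbv iota.
  match type of R with Cplus (Cplus _ (Cmult _ ?x)) ?y = _ => transitivity (0 + 1 * x + y)%C; [ring|] end.
  rewrite R. ring.
- simpl Nat.eqb. cbv iota.
  change (csum ?f (S (S m))) with (csum f (S m) + f (S m))%C in R. rewrite csum_recl in R. cbv beta in R.
  rewrite csum_zero, H0 in R.
  2: { intros k Hk. replace (- INR (2 * S m) + INR (2 * S k))%C with (- INR (2 * (m - k)))%C.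
    - rewrite IH by lia. replace (Nat.eqb (m - k) 0) with false by (symmetry; apply Nat.eqb_neq; lia). ring.
    - replace (2 * S m)%nat with (2 * (m - k) + 2 * S k)%nat by lia. rewrite plus_INR, RtoC_plus. ring. }
  replace (- INR (2 * S m) + INR (2 * S m))%C with (- INR (2 * 0))%C in R by (simpl (2 * 0)%nat; simpl (INR 0); ring).
  rewrite (IH 0%nat) in R by lia. simpl Nat.eqb in R. cbv iota in R.
  unfold hcoef in R. rewrite ES in R.
  (* The binomial coefficient cancels the denominator of [hcoef], leaving 4^(-m) with m the
     successor here. *)
  assert (CB : cb (- INR (2 * S m + 1)) (2 * S m) = INR (2 * S m + 1)).
  { generalize (cb_opp_INR (2 * S m + 1) (2 * S m) ltac:(lia)).
    replace (2 * S m + 1 - 2 * S m)%nat with 1%nat by lia. rewrite Nat.add_1_r, (fact_simpl (2 * S m)), mult_INR, RtoC_mult.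
    simpl (fact 1). simpl (INR 1). intros E.
    apply Ceq_minus. apply NNPP. intros Hn. apply (Cmult_neq_0 _ _ Hn (INR_fact_C_nz (2 * S m))).
    transitivity (cb (- INR (S (2 * S m))) (2 * S m) * INR (fact (2 * S m)) * 1
       - INR (S (2 * S m)) * INR (fact (2 * S m)))%C; [ring|]. rewrite E. ring. }
  rewrite CB in R.
  assert (P : RtoC ((/ 2) ^ (2 * S m + 1)) = (/ 2 * / 4 ^ S m)%C).
  { rewrite pow_add, pow_mult, pow_1, RtoC_mult, <- (RtoC_inv 2) by lra.
    replace ((/ 2) ^ 2) with (/ 4) by field.
    rewrite pow_inv, (RtoC_inv (4 ^ S m)), RtoC_pow; [ring|]. apply pow_nonzero. lra. }
  rewrite P in R. simpl (2 * 0)%nat in R. simpl (INR 0) in R.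
  replace (- INR (2 * S m) + 0)%C with (- INR (2 * S m))%C in R by ring.
  match type of R with Cplus (Cplus (Cplus (Cmult _ ?x) _) ?y) ?w = ?v => replace x with (v - y - w)%C by (rewrite <- R; ring) end.
  rewrite RtoC_inv by lra. field.
  repeat split; first [apply C4_pow_nz|rewrite Nat.add_1_r; apply INR_S_nz].
Qed.

(** * Comparison of the spectrum with its two linear factors *)

(* With [t = d / w] this is [w ^ (2 s)] times the difference between [(w^2 - d^2) ^ (- s)] and the mean
   of [(w - d) ^ (- 2 s)] and [(w + d) ^ (- 2 s)]. *)
Definition defect (s : C) (t : R) : C :=
  (Rcpow (1 - t ^ 2) (- s) - / 2 * (Rcpow (1 + t) (- (2 * s)) + Rcpow (1 - t) (- (2 * s))))%C.

(** The coefficient of t^(2m) in [defect s t]; taking the mean over t and -t removes the odd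
    powers. *)
Definition ecoef (m : nat) (s : C) : C := ((- (1)) ^ m * cb s m - cb (2 * s) (2 * m))%C.

Definition erem (J : nat) (t : R) (s : C) : C :=
  (bR s J (- t ^ 2) + - / 2 * (bR (2 * s + 0) (2 * J) t + bR (2 * s + 0) (2 * J) (- t)))%C.

Lemma defect_expansion s t J :
  defect s t = (csum (fun m => ecoef m s * RtoC (t ^ (2 * m))) J + erem J t s)%C.
Proof.
unfold defect, erem, bR. rewrite Cplus_0_r, !csum_double.
replace (1 - t ^ 2) with (1 + - t ^ 2) by ring. replace (1 - t) with (1 + - t) by ring.
match goal with |- Cminus ?A (Cmult _ (Cplus ?B ?D))
    = Cplus ?S (Cplus (Cminus ?A ?S1) (Cmult _ (Cplus (Cminus ?B ?S2) (Cminus ?D ?S3)))) =>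
  assert (E : (S = S1 + - / 2 * (S2 + S3))%C) end.
{ rewrite <- csum_plus, <- csum_scal, <- csum_plus. apply csum_ext. intros m _. unfold ecoef.
  assert (P1 : (- t) ^ (2 * m) = t ^ (2 * m)) by (rewrite !pow_mult; f_equal; ring).
  assert (P2 : (- t) ^ (2 * m + 1) = - t ^ (2 * m + 1)) by (rewrite !pow_add, P1; ring).
  assert (P3 : RtoC ((- t ^ 2) ^ m) = ((- (1)) ^ m * RtoC (t ^ (2 * m)))%C).
  { rewrite pow_mult. replace (- t ^ 2) with (- (1) * t ^ 2) by ring.
    rewrite Rpow_mult_distr, RtoC_mult, RtoC_pow, RtoC_opp. reflexivity. }
  rewrite P1, P2, P3, RtoC_opp. field. }
rewrite E. ring.
Qed.

Lemma harmonic_S j : harmonic (S j) = harmonic j + / INR (S j).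
Proof. unfold harmonic. rewrite sum_n_Sm by lia. reflexivity. Qed.

Lemma harmonic_0 : harmonic 0 = 0.
Proof. unfold harmonic. rewrite sum_n_m_zero by lia. reflexivity. Qed.

(** Up to sign, [cb s (S j)] is s / (j + 1) times the product of the 1 + s / i for 1 <= i <= j, and
    the linear coefficient of that product is the harmonic number of j. *)
Lemma cb_S_expansion j : exists q, an q 0 /\
  forall s, cb s (S j) = ((- (1)) ^ S j * (s / INR (S j)) * (1 + s * harmonic j + s ^ 2 * q s))%C.
Proof.
induction j as [|j [q [Hq H]]].
- exists (fun _ => RtoC 0). split; [apply an_const|]. intros s. rewrite harmonic_0. simpl. field.
- exists (fun s => q s + harmonic j / INR (S j) + / INR (S j) * ((1 * s + 0) * q s))%C. split.
  + apply an_plus; [apply an_plus; [exact Hq|apply an_const]|]. apply an_scal, an_mult; [apply an_linear|exact Hq].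
  + intros s. rewrite cb_S, H, harmonic_S, RtoC_plus, RtoC_inv by (apply not_0_INR; lia).
    simpl Cpow. field. split; apply INR_S_nz.
Qed.

Lemma ecoef_0 s : ecoef 0 s = 0.
Proof. unfold ecoef. simpl. ring. Qed.

(** The linear terms s / m and 2s / (2m) cancel. The quadratic terms give the harmonic numbers;
    doubling s makes the second one count twice. *)
Lemma ecoef_expansion m : (1 <= m)%nat -> exists q, an q 0 /\
  q 0 = RtoC ((harmonic (m - 1) - 2 * harmonic (2 * m - 1)) / INR m) /\
  forall s, ecoef m s = (s ^ 2 * q s)%C.
Proof.
destruct m as [|i]; [lia|]. intros _.
destruct (cb_S_expansion i) as [q [Hq H]]. destruct (cb_S_expansion (2 * i + 1)) as [q' [Hq' H']].
exists (fun s => / INR (S i) * ((harmonic i - 2 * harmonic (2 * i + 1)) + (1 * s + 0) * (q s + - (4) * q' (2 * s + 0))))%C.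
split.
- apply an_scal, an_plus; [apply an_const|]. apply an_mult; [apply an_linear|].
  apply an_plus; [exact Hq|]. apply an_scal, an_affine. replace (2 * 0 + 0)%C with (RtoC 0) by ring. exact Hq'.
- replace (S i - 1)%nat with i by lia. replace (2 * S i - 1)%nat with (2 * i + 1)%nat by lia. split.
  + rewrite RtoC_div, RtoC_minus, RtoC_mult by (apply not_0_INR; lia). field. apply INR_S_nz.
  + intros s. unfold ecoef. replace (2 * S i)%nat with (S (2 * i + 1)) by lia. rewrite H, H'.
    assert (P : ((- (1)) ^ S (2 * i + 1) = 1)%C).
    { replace (S (2 * i + 1)) with (2 * S i)%nat by lia. rewrite Cpow_mult_r.
      replace ((- (1)) ^ 2)%C with (RtoC 1) by (simpl; ring). apply Cpow_1_l. }
    assert (P' : ((- (1)) ^ S i * (- (1)) ^ S i = 1)%C).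
    { rewrite <- Cpow_mult_l. replace (- (1) * - (1))%C with (RtoC 1) by ring. apply Cpow_1_l. }
    rewrite P, !Cplus_0_r. replace (INR (S (2 * i + 1))) with (2 * INR (S i)) by
      (replace (S (2 * i + 1)) with (2 * S i)%nat by lia; rewrite mult_INR; reflexivity).
    rewrite RtoC_mult.
    transitivity ((- (1)) ^ S i * (- (1)) ^ S i * (s / INR (S i) * (1 + s * harmonic i + s ^ 2 * q s)) -
       2 * s / (2 * INR (S i)) * (1 + 2 * s * harmonic (2 * i + 1) + (2 * s) ^ 2 * q' (2 * s)%C))%C; [ring|].
    rewrite P'. field. apply INR_S_nz.
Qed.

Lemma dv_sqr_mult q : an q 0 -> dv (fun s => s ^ 2 * q s)%C 0 0.
Proof.
intros Hq. destruct (an_dv _ _ Hq) as [l Hl].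
apply (dv_eq _ _ ((1 * 0 + 0 * 1) * q 0 + (0 * 0) * l)%C); [ring|].
apply (dv_ext (fun s => s * s * q s)%C); [intros; simpl; ring|].
apply (dv_mult (fun s => s * s)%C q); [apply (dv_mult (fun s => s) (fun s => s)); apply dv_id|exact Hl].
Qed.

Lemma dv_ecoef m : dv (ecoef m) 0 0.
Proof.
destruct m as [|m].
- apply (dv_ext (fun _ => RtoC 0)); [intros; symmetry; apply ecoef_0|apply dv_const].
- destruct (ecoef_expansion (S m) ltac:(lia)) as [q [Hq [_ H]]].
  apply (dv_ext (fun s => s ^ 2 * q s)%C); [intros; symmetry; apply H|apply dv_sqr_mult, Hq].
Qed.

Lemma ecoef_at_0 m : ecoef m 0 = 0.
Proof.
destruct m as [|m]; [apply ecoef_0|].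
destruct (ecoef_expansion (S m) ltac:(lia)) as [q [_ [_ H]]]. rewrite H. simpl. ring.
Qed.

Lemma defect_at_0 t : 0 <= t < 1 -> defect 0 t = 0.
Proof.
intros Ht. unfold defect. replace (- (2 * 0))%C with (RtoC 0) by ring. rewrite Copp_0.
rewrite !Rcpow_0_r by nra. field.
Qed.

(** To first order in s this is the identity ln (1 - t^2) = ln (1 + t) + ln (1 - t), the reason for
    comparing with the mean of the two factors. *)
Lemma dv_defect t : 0 <= t < 1 -> dv (fun s => defect s t) 0 0.
Proof.
intros Ht. unfold defect.
assert (P1 : 0 < 1 - t ^ 2) by nra. assert (P2 : 0 < 1 + t) by lra. assert (P3 : 0 < 1 - t) by lra.
apply (dv_ext (fun s => Rcpow (1 - t ^ 2) (- (1) * s + 0)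
   + - / 2 * (Rcpow (1 + t) (- (2) * s + 0) + Rcpow (1 - t) (- (2) * s + 0)))%C).
{ intros s. replace (- (1) * s + 0)%C with (- s)%C by ring. replace (- (2) * s + 0)%C with (- (2 * s))%C by ring. ring. }
assert (K := dv_plus _ _ _ _ _ (dv_Rcpow 0 (1 - t ^ 2) (- (1)) 0 P1)
  (dv_scal _ _ _ (- / 2) (dv_plus _ _ _ _ _ (dv_Rcpow 0 (1 + t) (- (2)) 0 P2) (dv_Rcpow 0 (1 - t) (- (2)) 0 P3)))).
revert K. apply dv_eq.
replace (- (1) * 0 + 0)%C with (RtoC 0) by ring. replace (- (2) * 0 + 0)%C with (RtoC 0) by ring.
rewrite !Rcpow_0_r by assumption. replace (1 - t ^ 2) with ((1 + t) * (1 - t)) by ring.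
rewrite ln_mult, RtoC_plus by assumption. field.
Qed.

Lemma erem_at_0 J t : 0 <= t < 1 -> erem J t 0 = 0.
Proof.
intros Ht. transitivity (defect 0 t - csum (fun m => ecoef m 0 * RtoC (t ^ (2 * m))) J)%C.
- rewrite (defect_expansion 0 t J). ring.
- rewrite defect_at_0, csum_zero by (try intros; rewrite ?ecoef_at_0; try lra; ring). ring.
Qed.

Lemma dv_erem J t : 0 <= t < 1 -> dv (erem J t) 0 0.
Proof.
intros Ht. apply (dv_ext (fun s => defect s t + - (1) * csum (fun m => RtoC (t ^ (2 * m)) * ecoef m s) J)%C).
- intros s. rewrite (defect_expansion s t J).
  rewrite (csum_ext (fun m => RtoC (t ^ (2 * m)) * ecoef m s)%C (fun m => ecoef m s * RtoC (t ^ (2 * m)))%C) by (intros; ring). ring.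
- apply (dv_eq _ _ (0 + - (1) * csum (fun m => RtoC (t ^ (2 * m)) * 0) J)%C).
  { rewrite csum_zero by (intros; ring). ring. }
  apply dv_plus; [apply dv_defect, Ht|]. apply dv_scal, dv_csum. intros m _. apply dv_scal, dv_ecoef.
Qed.

Lemma wn_erem a J t0 : 0 < t0 < 1 -> exists K, forall t, 0 <= t <= t0 -> wn a 1 (erem J t) (K * t ^ (2 * J)).
Proof.
intros Ht0.
destruct (wn_bR a 1 (Cmod a + 1) J t0) as [K1 [HK1 H1]]; try lra.
destruct (wn_bR (2 * a + 0)%C 2 (Cmod (2 * a + 0)%C + 2) (2 * J) t0) as [K2 [HK2 H2]]; try lra.
exists (K1 + Cmod (- / 2)%C * (K2 + K2)). intros t Ht.
replace ((K1 + Cmod (- / 2)%C * (K2 + K2)) * t ^ (2 * J))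
  with (K1 * t ^ (2 * J) + Cmod (- / 2)%C * (K2 * t ^ (2 * J) + K2 * t ^ (2 * J))) by ring.
apply wn_plus; [|apply wn_scal, wn_plus].
- replace (t ^ (2 * J)) with (Rabs (- t ^ 2) ^ J).
  + apply H1. rewrite Rabs_Ropp, Rabs_pos_eq by apply pow2_ge_0. nra.
  + rewrite Rabs_Ropp, Rabs_pos_eq by apply pow2_ge_0. symmetry. apply pow_mult.
- apply (wn_affine a 1 2 0 (fun s => bR s (2 * J) t)). rewrite Cmod_pos_R, Rmult_1_r by lra.
  assert (K := H2 t). rewrite Rabs_pos_eq in K by lra. apply K. lra.
- apply (wn_affine a 1 2 0 (fun s => bR s (2 * J) (- t))). rewrite Cmod_pos_R, Rmult_1_r by lra.
  assert (K := H2 (- t)). rewrite Rabs_Ropp, Rabs_pos_eq in K by lra. apply K. lra.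
Qed.

(** * Continuation of the sums of the defect over the nodes *)

Definition gstep (d : R) (k : nat) : R := d / 2 * / (INR k + (1 + d / 2)).

(** The node is w = 2 (k + 1) + d. With the factor 2 taken out, powers of the nodes sum to a Hurwitz
    zeta function with parameter 1 + d/2. *)
Definition gnode (d : R) (k : nat) : R := 2 * (INR k + (1 + d / 2)).

(** Minus the exponent of w in w^(p - 2s) (d / w)^(2m), hence the argument at which the Hurwitz zeta
    function occurs. *)
Definition garg (p m : nat) (s : C) : C := (2 * s + (INR (2 * m) - INR p))%C.

Definition gterm (d : R) (p J k : nat) (s : C) : C :=
  (Rcpow (gnode d k) (- (2) * s + INR p) * erem J (gstep d k) s)%C.

Definition gpart (F : C -> C) (d : R) (p m : nat) (s : C) : C :=
  (ecoef m s * RtoC (d ^ (2 * m)) * Rcpow 2 (- garg p m s) * F (garg p m s))%C.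

(* Continuation of the sum over [k] of [w ^ (p - 2 s) * defect s (d / w)], where [w = gnode d k]. *)
Definition gfun (F : C -> C) (d : R) (p : nat) (s : C) : C :=
  (csum (fun m => gpart F d p m s) (p + 2) + csersum (fun k => gterm d p (p + 2) k s))%C.

Lemma gstep_bounds d k : 0 < d -> 0 < gstep d k <= d / (2 + d) /\ d / (2 + d) < 1.
Proof.
intros Hd. unfold gstep. generalize (pos_INR k). intros Hk. split; [split|].
- apply Rmult_lt_0_compat; [lra|apply Rinv_0_lt_compat; lra].
- replace (d / (2 + d)) with (d / 2 * / (1 + d / 2)) by (field; lra).
  apply Rmult_le_compat_l; [lra|]. apply Rinv_le_contravar; lra.
- apply (Rmult_lt_reg_r (2 + d)); [lra|]. replace (d / (2 + d) * (2 + d)) with d by (field; lra). lra.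
Qed.

(** With p + 2 orders removed, the terms have size w^(- 2 Re s - p - 4), summable for Re s > -1
    whatever p is; a neighbourhood of 0 is all that the determinant needs. *)
Lemma gterm_wn d p a : 0 < d -> -1 < Re a ->
  exists r M B, 0 < r /\ (forall k, wn a r (gterm d p (p + 2) k) (M k)) /\ (forall n, rsum M n <= B).
Proof.
intros Hd Ha. destruct (gstep_bounds d 0 Hd) as [[T1 T2] T3].
destruct (wn_erem a (p + 2) (d / (2 + d))) as [K HK]; [lra|].
set (N := Rpower 2 (Re (- (2) * a + INR p)%C + Cmod (- (2))%C * 1)).
destruct (dirichlet_terms (1 + d / 2) (- (2)) (INR p) a (INR (2 * (p + 2))) 1 (N * K * (d / 2) ^ (2 * (p + 2)))
  (fun k s => Rcpow 2 (- (2) * s + INR p) * erem (p + 2) (gstep d k) s)%C) as [r [M [B [Hr [H HB]]]]]; try lra.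
- intros k. destruct (gstep_bounds d k Hd) as [[S1 S2] _].
  apply (wn_le _ _ _ (N * (K * gstep d k ^ (2 * (p + 2))))).
  + rewrite Rpower_opp_nat by (generalize (pos_INR k); lra). unfold gstep. rewrite Rpow_mult_distr. right. ring.
  + apply wn_mult; [lra|apply wn_Rcpow; lra|apply HK; lra].
- rewrite mult_INR, plus_INR. change (INR 2) with 2. generalize (pos_INR p).
  replace (Re (- (2) * a + INR p)%C) with (- 2 * Re a + INR p) by (destruct a; unfold Re; simpl; ring). lra.
- exists r, M, B. split; [exact Hr|]. split; [|exact HB]. intros k.
  apply (wn_ext a r (fun s => Rcpow (INR k + (1 + d / 2)) (- (2) * s + INR p)
     * (Rcpow 2 (- (2) * s + INR p) * erem (p + 2) (gstep d k) s))%C); [|apply H].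
  intros h _. unfold gterm, gnode. rewrite (Rcpow_mult_base 2) by (generalize (pos_INR k); lra). ring.
Qed.

Lemma an_grem d p a : 0 < d -> -1 < Re a -> an (fun s => csersum (fun k => gterm d p (p + 2) k s)) a.
Proof.
intros Hd Ha. destruct (gterm_wn d p a Hd Ha) as [r [M [B [Hr [H HB]]]]].
exists r, B. split; [exact Hr|]. apply (wn_csersum a r _ M B Hr H HB).
Qed.

Lemma dv_grem d p : 0 < d -> dv (fun s => csersum (fun k => gterm d p (p + 2) k s)) 0 0.
Proof.
intros Hd. destruct (gterm_wn d p 0 Hd) as [r [M [B [Hr [H HB]]]]]; [simpl; lra|].
apply (dv_csersum_zero 0 r (gterm d p (p + 2)) M B Hr H HB).
- intros k. destruct (gstep_bounds d k Hd) as [[S1 S2] S3]. unfold gterm. rewrite erem_at_0 by lra. ring.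
- intros k. destruct (gstep_bounds d k Hd) as [[S1 S2] S3].
  assert (X : 0 < gnode d k) by (unfold gnode; generalize (pos_INR k); lra).
  assert (K := dv_mult _ _ _ _ _ (dv_Rcpow 0 (gnode d k) (- (2)) (INR p) X) (dv_erem (p + 2) (gstep d k) ltac:(lra))).
  revert K. apply dv_eq. rewrite erem_at_0 by lra. ring.
Qed.

Lemma mer_gpart F d p m a : (forall z, mer F z) -> mer (gpart F d p m) a.
Proof.
intros HF. unfold gpart. apply mer_mult; [apply mer_mult; [apply mer_mult|]|].
- apply mer_an. unfold ecoef.
  apply (an_ext (fun s => (- (1)) ^ m * cb s m + - (1) * cb (2 * s + 0) (2 * m))%C); [intros; rewrite Cplus_0_r; ring|].
  apply an_plus; apply an_scal; [apply an_cb|]. apply (an_affine (fun s => cb s (2 * m))), an_cb.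
- apply mer_an, an_const.
- apply mer_an. apply (an_ext (fun s => Rcpow 2 (- (2) * s + (- (INR (2 * m) - INR p))))%C).
  + intros s. unfold garg. f_equal. ring.
  + apply an_Rcpow. lra.
- apply mer_affine; [apply RtoC_nz; lra|apply HF].
Qed.

Lemma mer_gfun F d p a : 0 < d -> (forall z, mer F z) -> -1 < Re a -> mer (gfun F d p) a.
Proof.
intros Hd HF Ha. apply mer_plus; [|apply mer_an, an_grem; assumption].
apply mer_csum. intros m _. apply mer_gpart, HF.
Qed.

Lemma gfun_cser F d p : 0 < d -> is_hurwitz_zeta (1 + d / 2) F -> exists sigma, forall s, sigma < Re s ->
  cser (fun k => Rcpow (gnode d k) (- (2) * s + INR p) * defect s (gstep d k))%C (gfun F d p s).
Proof.
intros Hd HF. destruct (is_hurwitz_cser _ _ HF) as [sigma Hs].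
exists (Rmax 0 ((Rabs sigma + INR p) / 2)). intros s H.
assert (S1 := Rmax_l 0 ((Rabs sigma + INR p) / 2)). assert (S2 := Rmax_r 0 ((Rabs sigma + INR p) / 2)).
assert (S3 := Rle_abs sigma).
apply (cser_ext (fun k => csum (fun m => ecoef m s * RtoC (d ^ (2 * m)) * Rcpow 2 (- garg p m s)
    * Rcpow (INR k + (1 + d / 2)) (- garg p m s)) (p + 2) + gterm d p (p + 2) k s)%C).
- intros k. rewrite (defect_expansion s (gstep d k) (p + 2)). unfold gterm.
  rewrite Cmult_plus_distr_l, <- csum_scal. f_equal. apply csum_ext. intros m _.
  assert (X : 0 < INR k + (1 + d / 2)) by (generalize (pos_INR k); lra).
  assert (W : 0 < gnode d k) by (unfold gnode; lra).
  assert (E : gstep d k * gnode d k = d) by (unfold gstep, gnode; field; lra).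
  replace (d ^ (2 * m)) with (gstep d k ^ (2 * m) * gnode d k ^ (2 * m)) by (rewrite <- Rpow_mult_distr, E; reflexivity).
  rewrite RtoC_mult, <- (Rcpow_INR (gnode d k)) by exact W.
  transitivity (ecoef m s * RtoC (gstep d k ^ (2 * m)) * (Rcpow (gnode d k) (INR (2 * m))
    * (Rcpow 2 (- garg p m s) * Rcpow (INR k + (1 + d / 2)) (- garg p m s))))%C; [ring|].
  rewrite <- Rcpow_mult_base by lra. fold (gnode d k). rewrite <- Rcpow_plus by exact W.
  unfold garg. replace (INR (2 * m) + - (2 * s + (INR (2 * m) - INR p)))%C with (- (2) * s + INR p)%C by ring. ring.
- apply cser_plus.
  + apply (cser_csum (fun m k => ecoef m s * RtoC (d ^ (2 * m)) * Rcpow 2 (- garg p m s)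
    * Rcpow (INR k + (1 + d / 2)) (- garg p m s))%C (fun m => gpart F d p m s)).
    intros m _. apply cser_scal, Hs. unfold garg.
    replace (Re _) with (2 * Re s + (INR (2 * m) - INR p)) by (destruct s; unfold Re; simpl; ring).
    generalize (pos_INR (2 * m)). lra.
  + destruct (gterm_wn d p s Hd ltac:(lra)) as [r [M [B [Hr [T HB]]]]].
    destruct (wn_csersum s r _ M B Hr T HB) as [_ K]. specialize (K 0 ltac:(rewrite Cmod_0; lra)).
    rewrite Cplus_0_r in K. exact K.
Qed.

(** The derivative of [gpart] at 0. Near s = 0 the pole contributes F (2s + 1) ~ 1 / (2s) and the
    power of 2 contributes 1/2; together they make the 4 in the denominator. *)
Definition gvalue (d : R) (p m : nat) : R :=
  if Nat.eqb (2 * m) (p + 1) then d ^ (2 * m) * (harmonic (m - 1) - 2 * harmonic (2 * m - 1)) / (4 * INR m) else 0.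

(* When [2 m = p + 1] the pole of [F] at 1 cancels one of the two zeros of [ecoef m] at 0. *)
Lemma gpart_at_0 F d p m : 0 < d -> is_hurwitz_zeta (1 + d / 2) F ->
  an (gpart F d p m) 0 /\ dv (gpart F d p m) 0 (gvalue d p m).
Proof.
intros Hd HF. assert (Hc : 1 <= 1 + d / 2) by lra. unfold gvalue.
assert (AR : an (fun s => Rcpow 2 (- garg p m s)) 0).
{ apply (an_ext (fun s => Rcpow 2 (- (2) * s + (- (INR (2 * m) - INR p))))%C).
  - intros s. unfold garg. f_equal. ring.
  - apply an_Rcpow. lra. }
destruct m as [|i].
{ replace (Nat.eqb (2 * 0) (p + 1)) with false by (symmetry; apply Nat.eqb_neq; lia).
  assert (Z : forall s, RtoC 0 = gpart F d p 0 s) by (intros; unfold gpart; rewrite ecoef_0; ring).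
  split; [apply (an_ext (fun _ => RtoC 0) _ _ Z), an_const|apply (dv_ext (fun _ => RtoC 0) _ _ _ Z), dv_const]. }
set (m := S i) in *. destruct (ecoef_expansion m ltac:(unfold m; lia)) as [q [Hq [Hq0 E]]].
destruct (Nat.eqb_spec (2 * m) (p + 1)) as [EQ|NE].
- assert (GA : forall s, garg p m s = (2 * s + 1)%C).
  { intros s. unfold garg. rewrite EQ, plus_INR, RtoC_plus. simpl (INR 1). ring. }
  (* One factor s of the double zero turns F (2s + 1) into half of [hE F (2s + 1)]; Q is the
     analytic quotient by the remaining factor s. *)
  set (Q := fun s => (/ 2 * RtoC (d ^ (2 * m)) * (q s * (Rcpow 2 (- garg p m s) * hE F (2 * s + 1))))%C).
  assert (AQ : an Q 0).
  { apply an_scal, an_mult; [exact Hq|]. apply an_mult; [exact AR|]. apply an_affine, (an_hE (1 + d / 2)); assumption. }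
  assert (Z : forall s, ((1 * s + 0) * Q s = gpart F d p m s)%C).
  { intros s. unfold Q, gpart. rewrite E, GA. destruct (classic (s = 0)) as [->|N]; [simpl; ring|].
    rewrite hE_neq.
    - simpl. field.
    - intros A. apply N. apply Ceq_minus in A. apply NNPP. intros B.
      apply (Cmult_neq_0 2 s); [apply RtoC_nz; lra|exact B|]. rewrite <- A. ring. }
  split; [apply (an_ext _ _ _ Z), an_mult; [apply an_linear|exact AQ]|].
  apply (dv_ext _ _ _ _ Z). destruct (an_dv _ _ AQ) as [l Hl].
  apply (dv_eq _ _ (1 * Q 0 + (1 * 0 + 0) * l)%C).
  + unfold Q. rewrite Hq0, GA. replace (2 * 0 + 1)%C with (RtoC 1) by ring. rewrite hE_1.
    assert (R2 : Rcpow 2 (- (1)) = / 2).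
    { assert (K := Rcpow_opp_r 2 1 ltac:(lra)). assert (K1 := Rcpow_INR 2 1 ltac:(lra)). simpl in K1. rewrite K1, Rmult_1_r in K.
      rewrite RtoC_inv by lra. transitivity (/ 2 * (2 * Rcpow 2 (- (1))))%C; [field|rewrite K; ring]. }
    rewrite R2. rewrite !Cmult_0_r, Cplus_0_l, !Cmult_0_l, Cplus_0_r.
    rewrite <- RtoC_inv by lra. rewrite <- !RtoC_mult. f_equal.
    field. apply not_0_INR. unfold m. lia.
  + apply (dv_mult (fun s => 1 * s + 0)%C Q); [|exact Hl].
    apply (dv_ext (fun s => s)); [intros; ring|apply dv_id].
- set (Q := fun s => (RtoC (d ^ (2 * m)) * (q s * (Rcpow 2 (- garg p m s) * F (garg p m s))))%C).
  assert (AQ : an Q 0).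
  { apply an_scal, an_mult; [exact Hq|]. apply an_mult; [exact AR|]. apply an_affine, (hurwitz_an (1 + d / 2)); [exact Hc|exact HF|].
    intros A. apply NE. replace (2 * 0 + (INR (2 * m) - INR p))%C with (RtoC (INR (2 * m) - INR p)) in A by (rewrite RtoC_minus; ring).
    apply RtoC_inj in A. apply INR_eq. rewrite plus_INR. simpl (INR 1). lra. }
  assert (Z : forall s, (s ^ 2 * Q s = gpart F d p m s)%C).
  { intros s. unfold Q, gpart. rewrite E. ring. }
  split; [|apply (dv_ext _ _ _ _ Z), dv_sqr_mult, AQ].
  apply (an_ext _ _ _ Z), an_mult; [|exact AQ]. apply (an_pow (fun s => s)).
  apply (an_ext (fun s => 1 * s + 0)%C); [intros; ring|apply an_linear].
Qed.

Lemma gfun_at_0 F d p : 0 < d -> is_hurwitz_zeta (1 + d / 2) F ->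
  an (gfun F d p) 0 /\ dv (gfun F d p) 0 (csum (fun m => RtoC (gvalue d p m)) (p + 2)).
Proof.
intros Hd HF. split.
- apply an_plus; [|apply an_grem; [exact Hd|simpl; lra]].
  apply an_csum. intros m _. apply (gpart_at_0 F d p m Hd HF).
- apply (dv_eq _ _ (csum (fun m => RtoC (gvalue d p m)) (p + 2) + 0)%C); [ring|].
  apply dv_plus; [|apply dv_grem, Hd]. apply dv_csum. intros m _. apply (gpart_at_0 F d p m Hd HF).
Qed.

(** By parity no argument hits the pole: 2m = 2i + 1 is impossible. This is why odd dimensions have
    no harmonic numbers. *)
Lemma gvalue_sum_even d i : csum (fun m => RtoC (gvalue d (2 * i) m)) (2 * i + 2) = 0.
Proof.
apply csum_zero. intros m _. unfold gvalue. replace (Nat.eqb _ _) with false; [reflexivity|].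
symmetry. apply Nat.eqb_neq. lia.
Qed.

(** Exactly one index, m = i + 1, meets the pole; the range of summation is split around it. *)
Lemma gvalue_sum_odd d i :
  csum (fun m => RtoC (gvalue d (2 * i + 1) m)) (2 * i + 1 + 2)
  = RtoC (d ^ (2 * S i) * (harmonic i - 2 * harmonic (2 * i + 1)) / (4 * INR (S i))).
Proof.
replace (2 * i + 1 + 2)%nat with (S i + (1 + S i))%nat by lia.
rewrite !csum_add. rewrite (csum_zero _ (S i)).
- rewrite (csum_zero _ (S i)).
  + simpl csum. rewrite Nat.add_0_r. unfold gvalue.
    replace (Nat.eqb _ _) with true by (symmetry; apply Nat.eqb_eq; lia).
    replace (S i - 1)%nat with i by lia. replace (2 * S i - 1)%nat with (2 * i + 1)%nat by lia. ring.
  + intros k Hk. unfold gvalue. replace (Nat.eqb _ _) with false; [reflexivity|]. symmetry. apply Nat.eqb_neq. lia.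
- intros k Hk. unfold gvalue. replace (Nat.eqb _ _) with false; [reflexivity|]. symmetry. apply Nat.eqb_neq. lia.
Qed.

(** * Multiplicities as polynomials *)

Fixpoint rprod (f : nat -> R) (n : nat) : R :=
  match n with O => 1 | S m => rprod f m * f m end.

Lemma rprod_ext (f g : nat -> R) n : (forall k, (k < n)%nat -> f k = g k) -> rprod f n = rprod g n.
Proof. induction n; intros H; simpl; [reflexivity|]. rewrite IHn, H by (try intros; try apply H; lia). reflexivity. Qed.

Lemma rprod_recl (f : nat -> R) n : rprod f (S n) = f O * rprod (fun k => f (S k)) n.
Proof.
induction n; [simpl; ring|].
change (rprod f (S (S n))) with (rprod f (S n) * f (S n)). rewrite IHn. simpl. ring.
Qed.

Lemma rprod_rev (f : nat -> R) n : rprod f n = rprod (fun i => f (n - 1 - i)%nat) n.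
Proof.
revert f. induction n; intros f; [reflexivity|].
rewrite rprod_recl. simpl rprod at 2. rewrite (IHn (fun k => f (S k))).
rewrite Rmult_comm. f_equal; [|f_equal; lia].
apply rprod_ext. intros k Hk. f_equal. lia.
Qed.

Lemma rprod_opp (f : nat -> R) n : rprod (fun i => - f i) n = (-1) ^ n * rprod f n.
Proof. induction n; simpl; [ring|]. rewrite IHn. ring. Qed.

Lemma rprod_zero (f : nat -> R) n k : (k < n)%nat -> f k = 0 -> rprod f n = 0.
Proof.
intros Hk H. induction n; [lia|]. simpl. destruct (Nat.eq_dec k n) as [->|]; [rewrite H; ring|].
rewrite IHn by lia. ring.
Qed.

Lemma fold_seq_rprod (f : nat -> R) a n :
  fold_right Rmult 1 (map f (seq a n)) = rprod (fun i => f (a + i)%nat) n.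
Proof.
revert a; induction n; intros a; [reflexivity|]. rewrite rprod_recl. simpl. rewrite IHn, Nat.add_0_r.
f_equal. apply rprod_ext. intros k _. f_equal. lia.
Qed.

Lemma stirling_sum n x : rsum (fun k => stirling1 n k * x ^ k) (S n) = rprod (fun i => x - INR i) n.
Proof. rewrite <- sum_n_rsum. unfold sum_n. rewrite stirling1E, fold_seq_rprod. reflexivity. Qed.

Lemma cfu_sum n x : rsum (fun k => cfu n k * x ^ k) (S n) = rprod (fun i => x - INR i ^ 2) n.
Proof. rewrite <- sum_n_rsum. unfold sum_n. rewrite cfuE, fold_seq_rprod. reflexivity. Qed.

Lemma rsum_recl (f : nat -> R) n : rsum f (S n) = f O + rsum (fun k => f (S k)) n.
Proof.
induction n; [simpl; ring|].
change (rsum f (S (S n))) with (rsum f (S n) + f (S n)). rewrite IHn. simpl. ring.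
Qed.

Lemma rsum_zero (f : nat -> R) n : (forall k, (k < n)%nat -> f k = 0) -> rsum f n = 0.
Proof. induction n; intros H; simpl; [reflexivity|]. rewrite IHn, H by (try intros; try apply H; lia). ring. Qed.

(** The identity stays multiplied by x because [cfvE] has this factor on its right-hand side;
    [vbar_sum] cancels it at a nonzero x. *)
Lemma cfv_sum n x : rsum (fun k => cfv (S n) (S k) * x ^ k) (S n) * x
  = x * rprod (fun i => x - (2 * INR i + 1) ^ 2) n.
Proof.
assert (E := cfvE (S n) x ltac:(lia)). change (sum_n_m ?f 0 (S n)) with (sum_n f (S n)) in E.
rewrite sum_n_rsum, rsum_recl, cfv_n0 in E. rewrite fold_seq_rprod in E.
rewrite Rmult_comm, <- rsum_scal. rewrite (rsum_ext _ (fun k => cfv (S n) (S k) * x ^ S k)) by (intros; simpl; ring).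
replace (rsum _ (S n)) with (0 * x ^ 0 + rsum (fun k => cfv (S n) (S k) * x ^ S k) (S n)) by ring.
rewrite E. f_equal. replace (S n - 1)%nat with n by lia. apply rprod_ext. intros k _.
rewrite plus_INR. simpl (INR 1). ring.
Qed.

Lemma stirling1_0 n : (1 <= n)%nat -> stirling1 n 0 = 0.
Proof. destruct n; [lia|]. intros _. unfold stirling1. simpl. ring. Qed.

Lemma stirling1_1 n : stirling1 (S n) 1 = (-1) ^ n * INR (fact n).
Proof.
unfold stirling1. change (map INR (seq 0 (S n))) with (INR 0 :: map INR (seq 1 n)). simpl roots_coef.
assert (E := roots_coefE (map INR (seq 1 n)) 0). change (sum_n_m ?f 0 ?m) with (sum_n f m) in E.
rewrite sum_n_rsum, rsum_recl, map_map, fold_seq_rprod in E.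
rewrite (rprod_ext _ (fun i => - INR (1 + i))), rprod_opp in E by (intros; ring).
assert (F : rprod (fun i => INR (1 + i)) n = INR (fact n)).
{ clear. induction n; [reflexivity|].
  change (rprod ?f (S n)) with (rprod f n * f n). rewrite IHn, fact_simpl, mult_INR. apply Rmult_comm. }
rewrite F in E. rewrite <- E.
replace (rsum _ (length _)) with 0; [simpl; ring|].
symmetry. apply rsum_zero. intros. simpl. ring.
Qed.

(* The multiplicity as a polynomial in [x = 2 k]. *)
Definition mult_poly (N : nat) (x : R) : R :=
  (2 * x + INR N - 1) * rprod (fun i => x + 1 + INR i) (N - 2) / INR (fact (N - 1)).

Lemma rprod_fact p m : rprod (fun i => INR p + 1 + INR i) m * INR (fact p) = INR (fact (p + m)).
Proof.
induction m; [simpl; rewrite Nat.add_0_r; ring|].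
rewrite Nat.add_succ_r, fact_simpl, mult_INR, <- IHm, S_INR, plus_INR. simpl rprod. ring.
Qed.

Lemma RP_mult_poly N k : (2 <= N)%nat -> (1 <= k)%nat -> RP_mult N k = mult_poly N (2 * INR k).
Proof.
intros HN Hk. destruct k as [|j]; [lia|]. destruct N as [|[|m]]; try lia. clear HN Hk.
unfold RP_mult, mult_poly, Binomial.C.
replace (S (S m) + 2 * S j - 2 * S j)%nat with (S (S m)) by lia.
replace (S (S m) + 2 * S j - 2 - (2 * S j - 2))%nat with (S (S m)) by lia.
replace (S (S m) + 2 * S j - 2)%nat with (2 * S j + m)%nat by lia.
replace (S (S m) + 2 * S j)%nat with (S (S (2 * S j + m))) by lia.
replace (S (S m) - 2)%nat with m by lia. replace (S (S m) - 1)%nat with (S m) by lia.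
replace (2 * S j - 2)%nat with (2 * j)%nat by lia.
set (P := rprod (fun i => 2 * INR (S j) + 1 + INR i) m).
assert (E : INR (fact (2 * S j + m)) = P * INR (fact (2 * S j))).
{ rewrite <- rprod_fact. f_equal. apply rprod_ext. intros i _. rewrite mult_INR. reflexivity. }
rewrite (fact_simpl (S (2 * S j + m))), (fact_simpl (2 * S j + m)), !mult_INR, E.
replace (2 * S j)%nat with (S (S (2 * j))) by lia.
rewrite (fact_simpl (S (2 * j))), (fact_simpl (2 * j)), (fact_simpl (S m)), !mult_INR.
replace (S (S (2 * j)) + m)%nat with (S (S (2 * j + m))) by lia.
rewrite !S_INR, plus_INR, mult_INR. change (INR 2) with 2.
generalize (INR_fact_neq_0 (2 * j)) (INR_fact_neq_0 (S m)) (pos_INR j) (pos_INR m). intros.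
field. repeat split; lra.
Qed.

(** The circle is treated apart: for N = 1 the truncated difference N - 2 makes [mult_poly] give a
    wrong value. *)
Lemma RP_mult_1 k : (1 <= k)%nat -> RP_mult 1 k = 2.
Proof.
intros Hk. destruct k as [|j]; [lia|]. unfold RP_mult, Binomial.C.
replace (1 + 2 * S j - 2 * S j)%nat with 1%nat by lia.
replace (1 + 2 * S j - 2 - (2 * S j - 2))%nat with 1%nat by lia.
replace (1 + 2 * S j - 2)%nat with (S (2 * j)) by lia. replace (2 * S j - 2)%nat with (2 * j)%nat by lia.
replace (1 + 2 * S j)%nat with (S (2 * S j)) by lia.
rewrite (fact_simpl (2 * S j)), (fact_simpl (2 * j)), !mult_INR, !S_INR, !mult_INR, !S_INR.
change (INR (fact 1)) with 1. generalize (INR_fact_neq_0 (2 * j)) (INR_fact_neq_0 (2 * S j)). intros.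
simpl (INR 0). field. split; assumption.
Qed.

Lemma mult_poly_0 N : (2 <= N)%nat -> mult_poly N 0 = 1.
Proof.
intros HN. destruct N as [|[|m]]; try lia. unfold mult_poly.
replace (S (S m) - 2)%nat with m by lia. replace (S (S m) - 1)%nat with (S m) by lia.
assert (E := rprod_fact 0 m). simpl (fact 0) in E. simpl (INR 1) in E. rewrite Rmult_1_r in E. simpl (0 + m)%nat in E.
change (INR 0) with 0 in E. rewrite E, fact_simpl, mult_INR, !S_INR. field.
split; [apply INR_fact_neq_0|generalize (pos_INR m); lra].
Qed.

(** These zeros allow a series over the spectrum to be extended backwards to all positive nodes of a
    residue class. *)
Lemma mult_poly_neg N m : (1 <= m <= N - 2)%nat -> mult_poly N (- INR m) = 0.
Proof.
intros Hm. unfold mult_poly. rewrite (rprod_zero _ (N - 2) (m - 1)); [unfold Rdiv; ring|lia|].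
rewrite minus_INR by lia. simpl (INR 1). ring.
Qed.

(** Coefficients of the multiplicity in powers of Y = x + N - 1. Dividing the falling factorial of
    length N by Y and adding the one of length N - 1 leaves (Y - 1)...(Y - N + 2) (2Y - N + 1). *)
Definition qcoef (N j : nat) : R := (stirling1 N (j + 1) + stirling1 (N - 1) j) / INR (fact (N - 1)).

Lemma qcoef_sum N Y : (2 <= N)%nat -> Y <> 0 ->
  rsum (fun j => qcoef N j * Y ^ j) N = rprod (fun i => Y - 1 - INR i) (N - 2) * (2 * Y - INR N + 1) / INR (fact (N - 1)).
Proof.
intros HN HY. destruct N as [|[|m]]; try lia. clear HN.
replace (S (S m) - 2)%nat with m by lia. unfold qcoef. replace (S (S m) - 1)%nat with (S m) by lia.
assert (E1 := stirling_sum (S (S m)) Y). assert (E2 := stirling_sum (S m) Y).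
rewrite rsum_recl, stirling1_0, Rmult_0_l, Rplus_0_l in E1 by lia.
simpl rprod in E1. change (rprod ?f (S m)) with (rprod f m * f m) in E2. cbv beta in E2.
assert (E3 := rprod_recl (fun i => Y - INR i) m). cbv beta in E3. simpl rprod in E3. simpl (INR 0) in E3. rewrite Rminus_0_r in E3.
rewrite (rprod_ext (fun k => Y - INR (S k)) (fun i => Y - 1 - INR i)) in E3 by (intros; rewrite S_INR; ring).
apply (Rmult_eq_reg_l Y); [|exact HY].
rewrite (rsum_ext _ (fun j => / INR (fact (S m)) * (stirling1 (S (S m)) (S j) * Y ^ j + stirling1 (S m) j * Y ^ j)))
  by (intros; rewrite Nat.add_1_r; unfold Rdiv; ring).
rewrite rsum_scal, rsum_plus, E2.
replace (Y * (/ INR (fact (S m)) * (rsum (fun k => stirling1 (S (S m)) (S k) * Y ^ k) (S (S m))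
   + rprod (fun i => Y - INR i) m * (Y - INR m)))) with (/ INR (fact (S m)) *
   (Y * rsum (fun k => stirling1 (S (S m)) (S k) * Y ^ k) (S (S m)) + Y * (rprod (fun i => Y - INR i) m * (Y - INR m)))) by ring.
rewrite <- rsum_scal, (rsum_ext _ (fun k => stirling1 (S (S m)) (S k) * Y ^ S k)) by (intros; simpl; ring).
rewrite E1, E3. change (match m with O => 1 | S _ => INR m + 1 end) with (INR (S m)). rewrite !S_INR. unfold Rdiv. ring.
Qed.

Lemma qcoef_upper N x : (2 <= N)%nat -> x + INR N - 1 <> 0 ->
  rsum (fun j => qcoef N j * (x + INR N - 1) ^ j) N = mult_poly N x.
Proof.
intros HN HY. rewrite qcoef_sum by assumption. unfold mult_poly. rewrite rprod_rev.
rewrite (rprod_ext _ (fun i => x + 1 + INR i)).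
- unfold Rdiv. ring.
- intros i Hi. rewrite !minus_INR by lia. simpl (INR 1). change (INR 2) with 2. ring.
Qed.

(** The substitution x -> 1 - N - x multiplies the multiplicity polynomial by (-1)^(N-1), so its
    coefficients in x are those in x + N - 1 up to sign. *)
Lemma qcoef_lower N x : (2 <= N)%nat -> x <> 0 ->
  rsum (fun j => (-1) ^ (N - 1 + j) * qcoef N j * x ^ j) N = mult_poly N x.
Proof.
intros HN HY. rewrite (rsum_ext _ (fun j => (-1) ^ (N - 1) * (qcoef N j * (- x) ^ j))).
2: { intros j _. replace (- x) with (-1 * x) by ring. rewrite Rpow_mult_distr, pow_add. ring. }
rewrite rsum_scal, qcoef_sum by (try assumption; lra). unfold mult_poly.
rewrite (rprod_ext _ (fun i => - (x + 1 + INR i))), rprod_opp by (intros; ring).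
assert (P : (-1) ^ (N - 1) * (-1) ^ (N - 2) = -1).
{ replace (N - 1)%nat with (S (N - 2)) by lia. simpl. rewrite Rmult_assoc, <- Rpow_mult_distr.
  replace (-1 * -1) with 1 by ring. rewrite pow1. ring. }
transitivity ((-1) ^ (N - 1) * (-1) ^ (N - 2) * (rprod (fun i => x + 1 + INR i) (N - 2) * (2 * - x - INR N + 1) / INR (fact (N - 1)))).
- unfold Rdiv. ring.
- rewrite P. unfold Rdiv. ring.
Qed.

(** This coefficient multiplies zeta(0), the one zeta value that remains beside the derivatives. *)
Lemma qcoef_0 N : (2 <= N)%nat -> qcoef N 0 = (-1) ^ (N - 1).
Proof.
intros HN. destruct N as [|[|m]]; try lia. unfold qcoef. replace (S (S m) - 1)%nat with (S m) by lia.
rewrite (stirling1_0 (S m)) by lia. simpl (0 + 1)%nat. rewrite stirling1_1. field. apply INR_fact_neq_0.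
Qed.

(** * Multiplicities as polynomials in the centred variable *)

Lemma rprod_shift_odd w n :
  rprod (fun i => w - INR n + INR i) (2 * n + 1) = w * rprod (fun i => w ^ 2 - INR (S i) ^ 2) n.
Proof.
induction n; [simpl; ring|].
replace (2 * S n + 1)%nat with (S (S (2 * n + 1))) by lia. rewrite rprod_recl.
change (rprod ?f (S (2 * n + 1))) with (rprod f (2 * n + 1) * f (2 * n + 1)%nat).
change (rprod ?f (S n)) with (rprod f n * f n). cbv beta.
rewrite (rprod_ext (fun k => w - INR (S n) + INR (S k)) (fun i => w - INR n + INR i)) by (intros; rewrite !S_INR; ring).
rewrite IHn. rewrite !S_INR, !plus_INR, !mult_INR. simpl (INR 0). change (INR 2) with 2. simpl (INR 1). ring.
Qed.

Lemma rprod_shift_even w n :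
  rprod (fun i => w - INR n + / 2 + INR i) (2 * n) = rprod (fun i => w ^ 2 - (INR i + / 2) ^ 2) n.
Proof.
induction n; [reflexivity|].
replace (2 * S n)%nat with (S (S (2 * n))) by lia. rewrite rprod_recl.
change (rprod ?f (S (2 * n))) with (rprod f (2 * n) * f (2 * n)%nat).
change (rprod ?f (S n)) with (rprod f n * f n). cbv beta.
rewrite (rprod_ext (fun k => w - INR (S n) + / 2 + INR (S k)) (fun i => w - INR n + / 2 + INR i)) by (intros; rewrite !S_INR; ring).
rewrite IHn. rewrite !S_INR, !mult_INR. simpl (INR 0). change (INR 2) with 2. field.
Qed.

Lemma ubar_sum n w : (2 <= n)%nat ->
  rsum (fun i => ubar (n - 1) i * w ^ (2 * i)) n = mult_poly (2 * n - 1) (w - (INR n - 1)).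
Proof.
intros Hn. destruct n as [|[|m]]; try lia. replace (S (S m) - 1)%nat with (S m) by lia.
rewrite (rsum_ext _ (fun i => 2 / INR (fact (2 * S m)) * (cfu (S m) i * (w ^ 2) ^ i)))
  by (intros; unfold ubar; rewrite pow_mult; ring).
rewrite rsum_scal, cfu_sum, rprod_recl. unfold mult_poly.
replace (2 * S (S m) - 1 - 2)%nat with (2 * m + 1)%nat by lia.
replace (2 * S (S m) - 1 - 1)%nat with (2 * S m)%nat by lia.
rewrite (rprod_ext (fun i => w - (INR (S (S m)) - 1) + 1 + INR i) (fun i => w - INR m + INR i)) by (intros; rewrite !S_INR; ring).
rewrite rprod_shift_odd. rewrite minus_INR, mult_INR, !S_INR by lia. simpl (INR 0). unfold Rdiv. ring.
Qed.

Lemma vbar_sum n w : (1 <= n)%nat -> w <> 0 ->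
  rsum (fun i => vbar n (S i) * 2 ^ (2 * i + 1) * w ^ (2 * i + 1)) n = mult_poly (2 * n) (w - (INR n - / 2)).
Proof.
intros Hn Hw. destruct n as [|m]; try lia. clear Hn.
rewrite (rsum_ext _ (fun i => / 4 ^ m / INR (fact (2 * S m - 1)) * (2 * w) * (cfv (S m) (S i) * ((2 * w) ^ 2) ^ i))).
2: { intros i _. unfold vbar. replace (S m - 1)%nat with m by lia. rewrite <- pow_mult, Rpow_mult_distr, !pow_add. simpl. ring. }
rewrite rsum_scal.
assert (X : (2 * w) ^ 2 <> 0) by (apply pow_nonzero; lra).
assert (E := cfv_sum m ((2 * w) ^ 2)). rewrite Rmult_comm in E. apply Rmult_eq_reg_l in E; [|exact X]. rewrite E.
rewrite (rprod_ext _ (fun i => 4 * (w ^ 2 - (INR i + / 2) ^ 2))) by (intros; field).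
assert (F : rprod (fun i => 4 * (w ^ 2 - (INR i + / 2) ^ 2)) m = 4 ^ m * rprod (fun i => w ^ 2 - (INR i + / 2) ^ 2) m).
{ clear. induction m; [simpl; ring|]. change (rprod ?f (S m)) with (rprod f m * f m).
  rewrite IHm. simpl pow. ring. }
rewrite F, <- rprod_shift_even. unfold mult_poly. replace (2 * S m - 2)%nat with (2 * m)%nat by lia.
rewrite (rprod_ext (fun i => w - (INR (S m) - / 2) + 1 + INR i) (fun i => w - INR m + / 2 + INR i)) by (intros; rewrite !S_INR; ring).
rewrite mult_INR, !S_INR. simpl (INR 0). field. split; [apply INR_fact_neq_0|apply pow_nonzero; lra].
Qed.

(** * The shifted zeta functions *)

(* Dirichlet series over the positive integers of the parity opposite to that of [m]. *)
Definition parity_zeta (zeta : C -> C) (m : nat) (z : C) : C :=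
  ((tau m - RtoC ((-1) ^ m) * Rcpow 2 (- z)) * zeta z)%C.

Definition parity_node (m j : nat) : R := 2 * INR j + 2 - tau m.

Lemma tau_cases m : (tau m = 1 /\ (-1) ^ m = 1 /\ m = (2 * Nat.div2 m)%nat) \/
  (tau m = 0 /\ (-1) ^ m = -1 /\ m = (2 * Nat.div2 m + 1)%nat).
Proof.
unfold tau. assert (S2 : forall k, (-1) ^ (2 * k) = 1) by (intros; apply pow_1_even).
destruct (Nat.Even_or_Odd m) as [H|H].
- left. rewrite (proj2 (Nat.even_spec m) H). assert (D := Nat.Even_double m H). unfold Nat.double in D.
  split; [reflexivity|split; [|lia]]. replace m with (2 * Nat.div2 m)%nat at 1 by lia. apply S2.
- right. assert (D := Nat.Odd_double m H). unfold Nat.double in D.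
  destruct (Nat.even m) eqn:E.
  + apply Nat.even_spec in E. exfalso. apply (Nat.Even_Odd_False m E H).
  + split; [reflexivity|split; [|lia]]. replace m with (2 * Nat.div2 m + 1)%nat at 1 by lia.
    rewrite pow_add, S2. ring.
Qed.

Lemma parity_node_pos m j : 0 < parity_node m j.
Proof. unfold parity_node. generalize (pos_INR j). destruct (tau_cases m) as [[-> _]|[-> _]]; lra. Qed.

Lemma parity_cser zeta : is_riemann_zeta zeta -> exists sigma, forall m z, sigma < Re z ->
  cser (fun j => Rcpow (parity_node m j) (- z)) (parity_zeta zeta m z).
Proof.
intros H. apply riemann_hurwitz, is_hurwitz_cser in H. destruct H as [sigma H].
exists sigma. intros m z Hz. specialize (H z Hz).
assert (E : cser (fun j => Rcpow (2 * INR j + 2) (- z)) (Rcpow 2 (- z) * zeta z)%C).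
{ apply (cser_ext (fun j => Rcpow 2 (- z) * Rcpow (INR j + 1) (- z))%C); [|apply cser_scal, H].
  intros j. rewrite <- Rcpow_mult_base by (generalize (pos_INR j); lra). f_equal. ring. }
unfold parity_node, parity_zeta. destruct (tau_cases m) as [[-> [-> _]]|[-> [-> _]]].
(* The sum over odd integers is the full sum minus the sum over even ones; the full partial sums are
   taken at even lengths so that both match term by term. *)
- assert (K := clim_plus _ _ _ _ (clim_subseq _ _ (fun n => 2 * n)%nat ltac:(intros; cbv beta; lia) H) (clim_scal _ (- (1))%C _ E)).
  apply (clim_ext (fun n => csum (fun j => Rcpow (INR j + 1) (- z)) (2 * n) + - (1) * csum (fun j => Rcpow (2 * INR j + 2) (- z)) n)%C).
  + intros n. rewrite csum_double, <- csum_scal, <- csum_plus. apply csum_ext. intros k _.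
    rewrite plus_INR, mult_INR. change (INR 2) with 2. simpl (INR 1).
    replace (2 * INR k + 2 - 1) with (2 * INR k + 1) by ring. replace (2 * INR k + 1 + 1) with (2 * INR k + 2) by ring. ring.
  + replace ((1 - 1 * Rcpow 2 (- z)) * zeta z)%C with (zeta z + - (1) * (Rcpow 2 (- z) * zeta z))%C by ring. exact K.
- replace ((0 - -1 * Rcpow 2 (- z)) * zeta z)%C with (Rcpow 2 (- z) * zeta z)%C.
  + apply (cser_ext (fun j => Rcpow (2 * INR j + 2) (- z))); [|exact E]. intros j. f_equal. ring.
  + replace (RtoC (-1)) with (- (1))%C by (rewrite <- RtoC_opp; reflexivity). ring.
Qed.

Lemma RtoC_rsum (f : nat -> R) n : RtoC (rsum f n) = csum (fun k => RtoC (f k)) n.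
Proof. induction n; simpl; [reflexivity|]. rewrite RtoC_plus, IHn. reflexivity. Qed.

Lemma poly_cser (w : nat -> R) (L : C -> C) sigma (b : nat -> R) (p : nat -> nat) n z :
  (forall j, 0 < w j) -> (forall z, sigma < Re z -> cser (fun j => Rcpow (w j) (- z)) (L z)) ->
  (forall l, (l < n)%nat -> sigma < Re z - INR (p l)) ->
  cser (fun j => RtoC (rsum (fun l => b l * w j ^ p l)%R n) * Rcpow (w j) (- z))%C
    (csum (fun l => b l * L (z - INR (p l))) n)%C.
Proof.
intros Hw HL Hz.
apply (cser_ext (fun j => csum (fun l => b l * Rcpow (w j) (- (z - INR (p l)))) n)%C).
- intros j. rewrite RtoC_rsum, (Cmult_comm (csum _ n)), <- csum_scal. apply csum_ext. intros l _.
  rewrite RtoC_mult, <- Rcpow_INR by apply Hw.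
  replace (- (z - INR (p l)))%C with (INR (p l) + - z)%C by ring. rewrite Rcpow_plus by apply Hw. ring.
- apply (cser_csum (fun l j => b l * Rcpow (w j) (- (z - INR (p l))))%C (fun l => b l * L (z - INR (p l)))%C).
  intros l Hl. apply cser_scal, HL.
  replace (Re (z - INR (p l))%C) with (Re z - INR (p l)) by (destruct z; unfold Re; simpl; ring). apply Hz, Hl.
Qed.

(* The first [K] nodes do not occur in the spectrum: they contribute only the value at [x0],
   the other multiplicities being zero. *)
Lemma mult_cser (N K n : nat) (x0 sigma : R) (w : nat -> R) (L : C -> C) (b : nat -> R) (p : nat -> nat) z :
  (forall j, 0 < w j) -> (forall z, sigma < Re z -> cser (fun j => Rcpow (w j) (- z)) (L z)) ->
  (forall i, w (K + i)%nat = x0 + 2 * INR (S i)) ->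
  (forall i, rsum (fun l => b l * w (K + i)%nat ^ p l) n = RP_mult N (S i)) ->
  (forall j, (j < K)%nat -> rsum (fun l => b l * w j ^ p l) n = if Nat.eqb (S j) K then 1 else 0) ->
  ((1 <= K)%nat -> w (K - 1)%nat = x0) ->
  (forall l, (l < n)%nat -> sigma < Re z - INR (p l)) ->
  cser (fun i => RP_mult N (S i) * Rcpow (x0 + 2 * INR (S i)) (- z))%C
    (csum (fun l => b l * L (z - INR (p l))) n - (if Nat.eqb K 0 then 0 else Rcpow x0 (- z)))%C.
Proof.
intros Hw HL Hs Hp H0 HK Hz.
assert (T := cser_tail _ _ K (poly_cser w L sigma b p n z Hw HL Hz)).
replace (if Nat.eqb K 0 then RtoC 0 else Rcpow x0 (- z))
  with (csum (fun j => RtoC (rsum (fun l => b l * w j ^ p l)%R n) * Rcpow (w j) (- z))%C K).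
- revert T. apply cser_ext. intros i. rewrite Hp, Hs. reflexivity.
- destruct K as [|K]; [reflexivity|]. simpl Nat.eqb. cbv iota. simpl csum.
  rewrite csum_zero.
  + rewrite H0, Nat.eqb_refl by lia. rewrite <- (HK ltac:(lia)). replace (S K - 1)%nat with K by lia. ring.
  + intros k Hk. rewrite H0 by lia. replace (Nat.eqb (S k) (S K)) with false by (symmetry; apply Nat.eqb_neq; lia). ring.
Qed.

(** The omitted nodes correspond to x = -2 (K - 1 - j). Since 2K <= N they are zeros of the
    multiplicity polynomial, except the last one, x = 0, where it equals 1. *)
Lemma mult_poly_early N K j : (2 <= N)%nat -> (2 * K <= N)%nat -> (j < K)%nat ->
  mult_poly N (- INR (2 * (K - 1 - j))) = if Nat.eqb (S j) K then 1 else 0.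
Proof.
intros HN HK Hj. destruct (Nat.eqb_spec (S j) K) as [E|E].
- replace (2 * (K - 1 - j))%nat with O by lia. simpl (INR 0). rewrite Ropp_0. apply mult_poly_0, HN.
- apply mult_poly_neg. lia.
Qed.

Lemma Csum_csum_1 (f : nat -> C) n : Csum f 1 n = csum (fun i => f (S i)) n.
Proof.
unfold Csum. induction n; [rewrite sum_n_m_zero by lia; reflexivity|].
rewrite sum_n_Sm by lia. rewrite IHn. reflexivity.
Qed.

Lemma Csum_csum_0 (f : nat -> C) n : Csum f 0 n = csum f (S n).
Proof.
unfold Csum. induction n; [rewrite sum_n_n; simpl; ring|].
rewrite sum_n_Sm by lia. rewrite IHn. reflexivity.
Qed.

(** The half-plane Re > rho is a parameter because the candidate for the spectral zeta function is
    built only for Re s > -1. *)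
Lemma meromorphic_continuation_eq (term : C -> nat -> C) (F G : C -> C) rho sigma a :
  meromorphic_continuation term F -> (forall z, rho < Re z -> mer G z) ->
  (forall s, sigma < Re s -> cser (term s) (G s)) -> rho < Re a -> peq F G a.
Proof.
intros [HF [sigma' HS]] HG HT Ha. apply (mer_identity F G rho (Rmax sigma sigma')); auto.
- intros b _. apply meromorphic_mer, HF.
- intros s Hs. generalize (Rmax_l sigma sigma') (Rmax_r sigma sigma'). intros.
  apply (clim_unique (csum (term s))); [apply is_series_cser, HS; lra|apply HT; lra].
Qed.

Lemma an_Rcpow_opp x a : 0 < x -> an (fun z => Rcpow x (- z)) a.
Proof.
intros Hx. apply (an_ext (fun z => Rcpow x (- (1) * z + 0))); [intros; f_equal; ring|apply an_Rcpow, Hx].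
Qed.

Lemma an_parity_factor m a : an (fun z => tau m - RtoC ((-1) ^ m) * Rcpow 2 (- z))%C a.
Proof.
apply (an_ext (fun z => tau m + (- RtoC ((-1) ^ m)) * Rcpow 2 (- z))%C); [intros; ring|].
apply an_plus; [apply an_const|apply an_scal, an_Rcpow_opp; lra].
Qed.

Lemma mer_parity_zeta zeta m a : is_riemann_zeta zeta -> mer (parity_zeta zeta m) a.
Proof. intros [H _]. apply mer_mult; [apply mer_an, an_parity_factor|apply meromorphic_mer, H]. Qed.

Lemma an_parity_zeta zeta m a : an zeta a -> an (parity_zeta zeta m) a.
Proof. intros H. apply an_mult; [apply an_parity_factor|exact H]. Qed.

Lemma mer_scaled_arg F (a y : C) : (forall z, mer F z) -> mer (fun s => F (2 * s - y)%C) a.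
Proof.
intros H. apply (mer_ext (fun s => F (2 * s + - y)%C)).
- apply peq_all. intros z. f_equal.
- apply mer_affine; [apply RtoC_nz; lra|apply H].
Qed.

Lemma an_scaled_arg F (a y : C) : an F (2 * a - y)%C -> an (fun s => F (2 * s - y)%C) a.
Proof. intros H. apply (an_ext (fun s => F (2 * s + - y)%C)); [intros; f_equal|apply an_affine, H]. Qed.

Lemma an_Rcpow_2 x a : 0 < x -> an (fun s => Rcpow x (- (2 * s))) a.
Proof.
intros Hx. apply (an_ext (fun s => Rcpow x (- (2) * s + 0))); [intros; f_equal; ring|apply an_Rcpow, Hx].
Qed.

(** Common form of both shifted identities. L is a Dirichlet series over all nodes w, of which the
    spectrum skips the first K; the last skipped node x0 yields the correction term when K > 0. *)
Lemma shifted_zeta_formula (zRPs : C -> C) (N K n : nat) (x0 sigma : R) (w : nat -> R) (L : C -> C) (b : nat -> R) (p : nat -> nat) :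
  is_RP_shifted_zeta N zRPs -> x0 = (INR N - 1) / 2 -> ((1 <= K)%nat -> 0 < x0) -> (forall z, mer L z) ->
  (forall j, 0 < w j) -> (forall z, sigma < Re z -> cser (fun j => Rcpow (w j) (- z)) (L z)) ->
  (forall i, w (K + i)%nat = x0 + 2 * INR (S i)) ->
  (forall i, rsum (fun l => b l * w (K + i)%nat ^ p l) n = RP_mult N (S i)) ->
  (forall j, (j < K)%nat -> rsum (fun l => b l * w j ^ p l) n = if Nat.eqb (S j) K then 1 else 0) ->
  ((1 <= K)%nat -> w (K - 1)%nat = x0) -> (forall l, (l < n)%nat -> (p l <= 2 * n)%nat) ->
  forall s, (forall l, (l < n)%nat -> an L (2 * s - INR (p l))%C) ->
  zRPs s = (csum (fun l => b l * L (2 * s - INR (p l))) n - (if Nat.eqb K 0 then 0 else Rcpow x0 (- (2 * s))))%C.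
Proof.
intros HZ Hx0 HK0 HmL Hw HL Hs Hp H0 HK Hpn s Han.
set (G := fun s => (csum (fun l => b l * L (2 * s - INR (p l))) n - (if Nat.eqb K 0 then 0 else Rcpow x0 (- (2 * s))))%C).
assert (AV : forall a, an (fun s => (- (if Nat.eqb K 0 then RtoC 0 else Rcpow x0 (- (2 * s))))%C) a).
{ intros a. destruct K as [|K]; simpl; [apply an_const|].
  apply (an_ext (fun s => - (1) * Rcpow x0 (- (2 * s)))%C); [intros; ring|].
  apply an_scal, an_Rcpow_2, HK0. lia. }
assert (P : peq zRPs G s).
{ apply (meromorphic_continuation_eq _ _ _ (Re s - 1) ((Rabs sigma + INR (2 * n)) / 2) s HZ); [| |lra].
  - intros a _. apply mer_plus; [|apply mer_an, AV]. apply mer_csum. intros l _.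
    apply mer_mult; [apply mer_an, an_const|apply (mer_scaled_arg L), HmL].
  - intros z Hz. apply (cser_ext (fun i => RP_mult N (S i) * Rcpow (x0 + 2 * INR (S i)) (- (2 * z)))%C).
    + intros i. rewrite Hx0. do 2 f_equal. ring.
    + apply (mult_cser N K n x0 sigma w L b p (2 * z)%C); auto. intros l Hl.
      replace (Re (2 * z)%C) with (2 * Re z) by (destruct z; unfold Re; simpl; ring).
      generalize (le_INR _ _ (Hpn l Hl)) (Rle_abs sigma). lra. }
destruct HZ as [HM _].
destruct (meromorphic_removable zRPs (fun _ => RtoC 1) G s HM (an_const s 1) C1_nz) as [_ E].
- apply an_plus; [|apply AV]. apply an_csum. intros l Hl. apply an_scal, an_scaled_arg, Han, Hl.
- apply (peq_trans _ zRPs); [apply peq_all; intros; ring|exact P].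
- rewrite <- (Cmult_1_l (zRPs s)). exact E.
Qed.

Lemma RP_mult_odd n k : (1 <= n)%nat -> (1 <= k)%nat ->
  rsum (fun i => ubar (n - 1) i * (INR n - 1 + 2 * INR k) ^ (2 * i)) n = RP_mult (2 * n - 1) k.
Proof.
intros Hn Hk. destruct (Nat.eq_dec n 1) as [->|N].
- simpl (2 * 1 - 1)%nat. rewrite RP_mult_1 by exact Hk. simpl. unfold ubar, cfu. simpl. field.
- rewrite ubar_sum, RP_mult_poly by lia. f_equal. ring.
Qed.

Lemma RP_mult_even n k : (1 <= n)%nat -> (1 <= k)%nat ->
  rsum (fun i => vbar n (S i) * 2 ^ (2 * i + 1) * (INR n - / 2 + 2 * INR k) ^ (2 * i + 1)) n = RP_mult (2 * n) k.
Proof.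
intros Hn Hk. assert (1 <= INR n) by (apply (le_INR 1), Hn). assert (1 <= INR k) by (apply (le_INR 1), Hk).
rewrite vbar_sum, RP_mult_poly by (try lia; lra). f_equal. ring.
Qed.

Lemma INR_div2 n : 2 * INR (Nat.div2 n) = INR n - 1 + tau n.
Proof.
destruct (tau_cases n) as [[E [_ H]]|[E [_ H]]]; rewrite E; apply (f_equal INR) in H;
  rewrite ?plus_INR, mult_INR in H; change (INR 2) with 2 in H; simpl (INR 1) in H; lra.
Qed.

Lemma parity_node_shift m i : parity_node m (Nat.div2 m + i) = INR m - 1 + 2 * INR (S i).
Proof. unfold parity_node. rewrite plus_INR, S_INR. generalize (INR_div2 m). lra. Qed.

Lemma parity_node_early m j : (j < Nat.div2 m)%nat ->
  parity_node m j = INR m - 1 + - INR (2 * (Nat.div2 m - 1 - j)).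
Proof.
intros Hj. unfold parity_node. rewrite mult_INR, !minus_INR by lia. change (INR 2) with 2. simpl (INR 1).
generalize (INR_div2 m). lra.
Qed.

Lemma div2_bound n : (2 * Nat.div2 n <= n)%nat.
Proof. destruct (tau_cases n) as [[_ [_ H]]|[_ [_ H]]]; lia. Qed.

Lemma div2_pos n : (2 <= n)%nat -> (1 <= Nat.div2 n)%nat.
Proof. intros Hn. destruct (tau_cases n) as [[_ [_ H]]|[_ [_ H]]]; lia. Qed.

Lemma INR_double_sub_1 n : (1 <= n)%nat -> (INR (2 * n - 1) - 1) / 2 = INR n - 1.
Proof. intros H. rewrite minus_INR, mult_INR by lia. change (INR 2) with 2. simpl (INR 1). field. Qed.

Lemma shifted_zeta_odd zeta (zRPs : C -> C) n : is_riemann_zeta zeta -> is_RP_shifted_zeta (2 * n - 1) zRPs ->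
  (1 <= n)%nat -> forall s,
  (forall i, (i < n)%nat -> an zeta (2 * s - INR (2 * i))%C) ->
  zRPs s = (csum (fun i => ubar (n - 1) i * parity_zeta zeta n (2 * s - INR (2 * i))) n
     - Rcpow (INR n - 1) (- (2 * s)))%C.
Proof.
intros Hz HZ Hn s Han. destruct (parity_cser zeta Hz) as [sigma Hs].
rewrite (shifted_zeta_formula zRPs (2 * n - 1) (Nat.div2 n) n (INR n - 1) sigma (parity_node n)
  (parity_zeta zeta n) (ubar (n - 1)) (fun i => 2 * i)%nat); auto.
(* For n = 1 no node is skipped, in agreement with the convention that [Rcpow 0] vanishes; for n >=
   2 the correction is present. *)
- f_equal. f_equal. destruct (Nat.eq_dec n 1) as [->|N].
  + simpl. unfold Rcpow. destruct (Rlt_dec 0 (1 - 1)); [lra|reflexivity].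
  + generalize (div2_pos n ltac:(lia)). destruct (Nat.div2 n); [lia|reflexivity].
- symmetry. apply INR_double_sub_1, Hn.
- intros K. assert (2 <= INR n) by (apply (le_INR 2); generalize (div2_bound n); lia). lra.
- intros z. apply mer_parity_zeta, Hz.
- apply parity_node_pos.
- apply parity_node_shift.
- intros i. rewrite parity_node_shift. apply RP_mult_odd; lia.
- intros j Hj. assert (2 <= n)%nat by (generalize (div2_bound n); lia). rewrite ubar_sum by lia.
  rewrite parity_node_early by exact Hj. rewrite <- (mult_poly_early (2 * n - 1)) by (generalize (div2_bound n); lia).
  f_equal. ring.
- intros K. rewrite parity_node_early by lia. replace (2 * _)%nat with O by lia. simpl (INR 0). ring.
- intros l Hl. lia.
- intros l Hl. apply an_parity_zeta, Han, Hl.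
Qed.

(** Twice the parameter is 5/2 or 7/2, the first spectral node for n = 1 or n = 2. From n = 3 on the
    same progression starts before the spectrum and skips div2 (n - 1) > 0 nodes, which explains
    [gamma]. *)
Lemma shifted_zeta_even hz (zRPs : C -> C) n : is_hurwitz_zeta (5 / 4 + tau n / 2) hz -> is_RP_shifted_zeta (2 * n) zRPs ->
  (1 <= n)%nat -> forall s,
  (forall i, (i < n)%nat -> an hz (2 * s - INR (2 * i + 1))%C) ->
  zRPs s = (csum (fun i => RtoC (vbar n (S i) * 2 ^ (2 * i + 1)) * (Rcpow 2 (- (2 * s - INR (2 * i + 1))) * hz (2 * s - INR (2 * i + 1)))) n
     - (if Nat.eqb (Nat.div2 (n - 1)) 0 then 0 else Rcpow (INR n - / 2) (- (2 * s))))%C.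
Proof.
intros Hz HZ Hn s Han. destruct (is_hurwitz_cser _ _ Hz) as [sigma Hs].
assert (TP : 0 <= tau n) by (destruct (tau_cases n) as [[-> _]|[-> _]]; lra).
assert (N1 : 1 <= INR n) by (apply (le_INR 1), Hn).
set (w := fun j => 2 * (INR j + (5 / 4 + tau n / 2))).
assert (WP : forall j, 0 < w j) by (intros j; unfold w; generalize (pos_INR j); lra).
assert (D2 : 2 * INR (Nat.div2 (n - 1)) = INR n - 1 - tau n).
{ rewrite INR_div2, minus_INR by lia. simpl (INR 1).
  destruct (tau_cases n) as [[E [_ H]]|[E [_ H]]]; destruct (tau_cases (n - 1)) as [[E' [_ H']]|[E' [_ H']]];
    try lia; rewrite E, E'; ring. }
assert (W1 : forall i, w (Nat.div2 (n - 1) + i)%nat = INR n - / 2 + 2 * INR (S i)).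
{ intros i. unfold w. rewrite plus_INR, S_INR. lra. }
assert (W2 : forall j, (j < Nat.div2 (n - 1))%nat -> w j = INR n - / 2 + - INR (2 * (Nat.div2 (n - 1) - 1 - j))).
{ intros j Hj. unfold w. rewrite mult_INR, !minus_INR by lia. change (INR 2) with 2. simpl (INR 1). lra. }
apply (shifted_zeta_formula zRPs (2 * n) (Nat.div2 (n - 1)) n (INR n - / 2) sigma w
  (fun z => Rcpow 2 (- z) * hz z)%C (fun i => vbar n (S i) * 2 ^ (2 * i + 1)) (fun i => 2 * i + 1)%nat); auto.
- rewrite mult_INR. change (INR 2) with 2. field.
- intros _. lra.
- intros z. apply mer_mult; [|apply meromorphic_mer, Hz]. apply mer_an, an_Rcpow_opp. lra.
- intros z Hz'. apply (cser_ext (fun j => Rcpow 2 (- z) * Rcpow (INR j + (5 / 4 + tau n / 2)) (- z))%C).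
  + intros j. rewrite <- Rcpow_mult_base by (generalize (pos_INR j); lra). reflexivity.
  + apply cser_scal, Hs, Hz'.
- intros i. rewrite W1. apply RP_mult_even; lia.
- intros j Hj. assert (NZ : w j <> 0) by (generalize (WP j); lra).
  rewrite vbar_sum by assumption. rewrite W2 by exact Hj.
  rewrite <- (mult_poly_early (2 * n)) by (generalize (div2_bound (n - 1)); lia). f_equal. ring.
- intros K. rewrite W2 by lia. replace (2 * _)%nat with O by lia. simpl (INR 0). ring.
- intros l Hl. lia.
- intros l Hl. apply an_mult; [apply an_Rcpow_opp; lra|apply Han, Hl].
Qed.

(** * The spectral zeta function at 0 *)

Definition lower_coef (N j : nat) : R := (-1) ^ (N - 1 + j) * qcoef N j.

(* Continuations of the sums over [k >= 1] of [m_k (2 k) ^ (- z)] and [m_k (2 k + N - 1) ^ (- z)]. *)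
Definition lower_zeta (zeta : C -> C) (N : nat) (z : C) : C :=
  csum (fun j => lower_coef N j * parity_zeta zeta 1 (z - INR j))%C N.

Definition upper_zeta (zeta : C -> C) (N : nat) (z : C) : C :=
  (csum (fun j => qcoef N j * parity_zeta zeta N (z - INR j)) N - Rcpow (INR N - 1) (- z))%C.

(** Candidate for the spectral zeta function on Re s > -1. The multiplicity is used in three forms:
    in powers of 2k, of 2k + N - 1, and of w with coefficients b and exponents 2l + e. *)
Definition RP_sum (zeta F : C -> C) (N n e : nat) (b : nat -> R) (s : C) : C :=
  (/ 2 * (lower_zeta zeta N (2 * s) + upper_zeta zeta N (2 * s))
   + csum (fun l => b l * gfun F ((INR N - 1) / 2) (2 * l + e) s) n)%C.

Lemma lower_cser zeta N : is_riemann_zeta zeta -> (2 <= N)%nat -> exists sigma, forall z, sigma < Re z ->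
  cser (fun i => RP_mult N (S i) * Rcpow (2 * INR (S i)) (- z))%C (lower_zeta zeta N z).
Proof.
intros Hz HN. destruct (parity_cser zeta Hz) as [sigma Hs]. exists (sigma + INR N). intros z Hz'.
assert (W : forall i, parity_node 1 (0 + i) = 0 + 2 * INR (S i)).
{ intros i. assert (E := parity_node_shift 1 i). simpl (INR 1) in E. simpl Nat.div2 in E. rewrite E. ring. }
apply (cser_ext (fun i => RP_mult N (S i) * Rcpow (0 + 2 * INR (S i)) (- z))%C).
{ intros i. rewrite Rplus_0_l. reflexivity. }
replace (lower_zeta zeta N z) with (lower_zeta zeta N z - (if Nat.eqb 0 0 then 0 else Rcpow 0 (- z)))%C by (simpl; ring).
apply (mult_cser N 0 N 0 sigma (parity_node 1) (parity_zeta zeta 1) (lower_coef N) (fun j => j)); auto.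
- apply parity_node_pos.
- intros i. rewrite W, Rplus_0_l. generalize (INR_S_pos i). intros.
  unfold lower_coef. rewrite qcoef_lower, RP_mult_poly by (try lia; lra). reflexivity.
- intros j Hj. lia.
- intros K. lia.
- intros l Hl. assert (INR l <= INR N) by (apply le_INR; lia). lra.
Qed.

Lemma upper_cser zeta N : is_riemann_zeta zeta -> (2 <= N)%nat -> exists sigma, forall z, sigma < Re z ->
  cser (fun i => RP_mult N (S i) * Rcpow (INR N - 1 + 2 * INR (S i)) (- z))%C (upper_zeta zeta N z).
Proof.
intros Hz HN. destruct (parity_cser zeta Hz) as [sigma Hs]. exists (sigma + INR N). intros z Hz'.
assert (DP := div2_pos N HN). assert (DB := div2_bound N).
assert (PP := parity_node_pos N).
assert (Q : forall j x, parity_node N j = INR N - 1 + x ->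
  rsum (fun l => qcoef N l * parity_node N j ^ l) N = mult_poly N x).
{ intros j x E. rewrite <- qcoef_upper.
  - apply rsum_ext. intros l _. rewrite E. do 2 f_equal. ring.
  - exact HN.
  - generalize (PP j). lra. }
unfold upper_zeta.
replace (Rcpow (INR N - 1) (- z)) with (if Nat.eqb (Nat.div2 N) 0 then RtoC 0 else Rcpow (INR N - 1) (- z))
  by (destruct (Nat.div2 N); [lia|reflexivity]).
apply (mult_cser N (Nat.div2 N) N (INR N - 1) sigma (parity_node N) (parity_zeta zeta N) (qcoef N) (fun j => j)); auto.
- apply parity_node_shift.
- intros i. rewrite (Q _ _ (parity_node_shift N i)), RP_mult_poly by lia. reflexivity.
- intros j Hj. rewrite (Q _ _ (parity_node_early N j Hj)). apply mult_poly_early; lia.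
- intros K. rewrite parity_node_early by lia. replace (2 * _)%nat with O by lia. simpl (INR 0). ring.
- intros l Hl. assert (INR l <= INR N) by (apply le_INR; lia). lra.
Qed.

Lemma gnode_shift N k : gnode ((INR N - 1) / 2) k = 2 * INR (S k) + (INR N - 1) / 2.
Proof. unfold gnode. rewrite S_INR. field. Qed.

(** With t = d / w the two factors are w (1 - t) and w (1 + t), and the eigenvalue is w^2 (1 - t^2);
    [defect] is the difference after w^(-2s) is taken out. *)
Lemma eigenvalue_split N k s : (2 <= N)%nat -> let d := (INR N - 1) / 2 in
  Rcpow (RP_eigenvalue N (S k)) (- s) =
  (/ 2 * (Rcpow (2 * INR (S k)) (- (2 * s)) + Rcpow (INR N - 1 + 2 * INR (S k)) (- (2 * s)))
   + Rcpow (gnode d k) (- (2 * s)) * defect s (gstep d k))%C.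
Proof.
intros HN d. assert (N2 : 2 <= INR N) by (apply (le_INR 2), HN).
assert (Hd : 0 < d) by (unfold d; lra). assert (SP := INR_S_pos k).
destruct (gstep_bounds d k Hd) as [[T1 T2] T3].
assert (W : 0 < gnode d k) by (unfold gnode; generalize (pos_INR k); lra).
assert (E : gnode d k * gstep d k = d) by (unfold gnode, gstep; field; generalize (pos_INR k); lra).
assert (WK := gnode_shift N k). fold d in WK.
replace (2 * INR (S k)) with (gnode d k * (1 - gstep d k)) by (rewrite Rmult_minus_distr_l, E; unfold d in *; lra).
replace (INR N - 1 + gnode d k * (1 - gstep d k)) with (gnode d k * (1 + gstep d k))
  by (rewrite Rmult_minus_distr_l, Rmult_plus_distr_l, E; unfold d; lra).
replace (RP_eigenvalue N (S k)) with (gnode d k * gnode d k * (1 - gstep d k ^ 2)).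
- assert (Q : 0 < 1 - gstep d k ^ 2) by nra. assert (WW := Rmult_lt_0_compat _ _ W W).
  rewrite (Rcpow_mult_base (gnode d k * gnode d k)), !(Rcpow_mult_base (gnode d k)) by lra.
  rewrite <- Rcpow_plus by exact W. replace (- s + - s)%C with (- (2 * s))%C by ring. unfold defect. field.
- replace (gnode d k * gnode d k * (1 - gstep d k ^ 2)) with (gnode d k * gnode d k - (gnode d k * gstep d k) * (gnode d k * gstep d k)) by ring.
  rewrite E, WK. unfold RP_eigenvalue, d. field.
Qed.

Lemma RP_sum_cser zeta F N n e b : is_riemann_zeta zeta -> (2 <= N)%nat ->
  is_hurwitz_zeta (1 + (INR N - 1) / 2 / 2) F ->
  (forall k, (1 <= k)%nat -> rsum (fun l => b l * ((INR N - 1) / 2 + 2 * INR k) ^ (2 * l + e)) n = RP_mult N k) ->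
  exists sigma, forall s, sigma < Re s ->
    cser (fun j => RP_mult N (S j) * Rcpow (RP_eigenvalue N (S j)) (- s))%C (RP_sum zeta F N n e b s).
Proof.
intros Hz HN HF Hb. assert (N2 : 2 <= INR N) by (apply (le_INR 2), HN).
set (d := (INR N - 1) / 2) in *. assert (Hd : 0 < d) by (unfold d; lra).
destruct (lower_cser zeta N Hz HN) as [s1 H1]. destruct (upper_cser zeta N Hz HN) as [s2 H2].
assert (HG : exists s3, forall l, (l < n)%nat -> forall s, s3 < Re s ->
   cser (fun k => Rcpow (gnode d k) (- (2) * s + INR (2 * l + e)) * defect s (gstep d k))%C (gfun F d (2 * l + e) s)).
{ clear Hb. induction n as [|m [s3 IH]]; [exists 0; intros; lia|].
  destruct (gfun_cser F d (2 * m + e) Hd HF) as [s4 H4]. exists (Rmax s3 s4). intros l Hl s Hs.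
  generalize (Rmax_l s3 s4) (Rmax_r s3 s4). intros.
  destruct (Nat.eq_dec l m) as [->|]; [apply H4; lra|apply IH; [lia|lra]]. }
destruct HG as [s3 H3].
exists (Rmax (Rmax 0 s3) (Rmax s1 s2)). intros s Hs.
generalize (Rmax_l (Rmax 0 s3) (Rmax s1 s2)) (Rmax_r (Rmax 0 s3) (Rmax s1 s2))
  (Rmax_l 0 s3) (Rmax_r 0 s3) (Rmax_l s1 s2) (Rmax_r s1 s2). intros.
assert (R2 : Re (2 * s)%C = 2 * Re s) by (destruct s; unfold Re; simpl; ring).
assert (A1 := H1 (2 * s)%C ltac:(rewrite R2; lra)). assert (A2 := H2 (2 * s)%C ltac:(rewrite R2; lra)).
assert (A3 := cser_csum (fun l k => b l * (Rcpow (gnode d k) (- (2) * s + INR (2 * l + e)) * defect s (gstep d k)))%C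
  (fun l => b l * gfun F d (2 * l + e) s)%C n ltac:(intros l Hl; apply cser_scal, H3; [exact Hl|lra])).
generalize (cser_plus _ _ _ _ (cser_scal _ (/ 2)%C _ (cser_plus _ _ _ _ A1 A2)) A3). apply cser_ext.
intros k. rewrite (eigenvalue_split N k s HN). fold d.
assert (W : 0 < gnode d k) by (unfold gnode; generalize (pos_INR k); lra).
rewrite (csum_ext _ (fun l => (Rcpow (gnode d k) (- (2 * s)) * defect s (gstep d k)) * RtoC (b l * gnode d k ^ (2 * l + e)))%C).
- rewrite csum_scal, <- RtoC_rsum. assert (GE := gnode_shift N k). fold d in GE. rewrite Rplus_comm in GE.
  rewrite (rsum_ext _ (fun l => b l * (d + 2 * INR (S k)) ^ (2 * l + e))) by (intros; rewrite GE; reflexivity).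
  rewrite (Hb (S k)) by lia. ring.
- intros l _. rewrite RtoC_mult, <- Rcpow_INR by exact W.
  replace (- (2) * s + INR (2 * l + e))%C with (INR (2 * l + e) + - (2 * s))%C by ring.
  rewrite Rcpow_plus by exact W. ring.
Qed.

Lemma mer_RP_sum zeta F N n e b a : is_riemann_zeta zeta -> (2 <= N)%nat ->
  is_hurwitz_zeta (1 + (INR N - 1) / 2 / 2) F -> -1 < Re a -> mer (RP_sum zeta F N n e b) a.
Proof.
intros Hz HN HF Ha. assert (N2 : 2 <= INR N) by (apply (le_INR 2), HN).
apply mer_plus.
- apply mer_mult; [apply mer_an, an_const|]. apply mer_plus; [|apply mer_plus].
  + apply mer_csum. intros j _. apply mer_mult; [apply mer_an, an_const|].
    apply (mer_scaled_arg (parity_zeta zeta 1)). intros. apply mer_parity_zeta, Hz.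
  + apply mer_csum. intros j _. apply mer_mult; [apply mer_an, an_const|].
    apply (mer_scaled_arg (parity_zeta zeta N)). intros. apply mer_parity_zeta, Hz.
  + apply mer_an, (an_ext (fun s => - (1) * Rcpow (INR N - 1) (- (2 * s)))%C); [intros; ring|].
    apply an_scal, an_Rcpow_2. lra.
- apply mer_csum. intros l _. apply mer_mult; [apply mer_an, an_const|].
  apply mer_gfun; [lra| |exact Ha]. intros z. apply meromorphic_mer, HF.
Qed.

Lemma zeta_an_neg zeta j : is_riemann_zeta zeta -> an zeta (- INR j)%C.
Proof.
intros Hz. apply (hurwitz_an 1); [lra|apply riemann_hurwitz, Hz|].
intros E. rewrite <- RtoC_opp in E. apply RtoC_inj in E. generalize (pos_INR j). lra.
Qed.

Lemma zeta_dv_neg zeta j : is_riemann_zeta zeta -> dv zeta (- INR j)%C (C_derive zeta (- INR j)%C).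
Proof.
intros Hz. destruct (an_dv _ _ (zeta_an_neg zeta j Hz)) as [l Hl]. rewrite (dv_C_derive _ _ _ Hl). exact Hl.
Qed.

Lemma dv_parity_zeta zeta m j : is_riemann_zeta zeta ->
  dv (fun s => parity_zeta zeta m (2 * s - INR j)%C) 0
    (2 * ((tau m - RtoC ((-1) ^ m) * 2 ^ j) * C_derive zeta (- INR j)
          + RtoC ((-1) ^ m) * ln 2 * 2 ^ j * zeta (- INR j)))%C.
Proof.
intros Hz.
assert (A : dv (fun s => zeta (2 * s + - INR j)%C) 0 (2 * C_derive zeta (- INR j))%C).
{ apply (dv_affine zeta). rewrite Cmult_0_r, Cplus_0_l. apply zeta_dv_neg, Hz. }
assert (B := dv_plus _ _ _ _ _ (dv_const 0 (tau m)) (dv_scal _ _ _ (- RtoC ((-1) ^ m))%C (dv_Rcpow 0 2 (- (2)) (INR j) ltac:(lra)))).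
assert (K := dv_mult _ _ _ _ _ B A).
apply (dv_ext (fun z => (tau m + - RtoC ((-1) ^ m) * Rcpow 2 (- (2) * z + INR j)) * zeta (2 * z + - INR j))%C).
- intros s. unfold parity_zeta. replace (- (2 * s - INR j))%C with (- (2) * s + INR j)%C by ring.
  replace (2 * s - INR j)%C with (2 * s + - INR j)%C by ring. ring.
- revert K. apply dv_eq. rewrite !Cmult_0_r, !Cplus_0_l, Rcpow_INR, (RtoC_pow 2) by lra. ring.
Qed.

Lemma zeta_neg_even zeta k : is_riemann_zeta zeta -> zeta (- INR (2 * k))%C = if Nat.eqb k 0 then - / 2 else 0.
Proof.
intros Hz. assert (E := hE_zeta_even zeta k Hz). rewrite hE_neq in E.
- assert (NZ : (- INR (2 * k) - 1)%C <> 0).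
  { rewrite <- RtoC_opp, <- RtoC_minus. apply RtoC_nz. generalize (pos_INR (2 * k)). lra. }
  apply Ceq_minus. apply NNPP. intros H. apply (Cmult_neq_0 _ _ NZ H).
  transitivity ((- INR (2 * k) - 1) * zeta (- INR (2 * k)) - (- INR (2 * k) - 1) * (if Nat.eqb k 0 then RtoC (- / 2) else RtoC 0))%C; [ring|].
  rewrite E. destruct (Nat.eqb_spec k 0) as [->|_]; [|ring]. simpl (INR (2 * 0)).
  rewrite RtoC_opp. ring.
- intros H. rewrite <- RtoC_opp in H. apply RtoC_inj in H. generalize (pos_INR (2 * k)). lra.
Qed.

(** The derivative of [RP_sum] at 0: the factor 1/2 of the mean cancels the 2 produced by
    differentiating in 2s. *)
Definition RP_derivative (zeta : C -> C) (N n e : nat) (b : nat -> R) : C :=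
  (csum (fun j => RtoC (qcoef N j * (tau N - (-1) ^ N * 2 ^ (j + 1) * tau j)) * C_derive zeta (- INR j)) N
   + ln (2 * (INR N - 1))
   + csum (fun l => b l * csum (fun m => RtoC (gvalue ((INR N - 1) / 2) (2 * l + e) m)) (2 * l + e + 2)) n)%C.

(* Only [zeta 0] survives in the terms without derivative, by the trivial zeros. *)
Lemma RP_derivative_terms zeta N j : is_riemann_zeta zeta -> (2 <= N)%nat ->
  (lower_coef N j * ((tau 1 - RtoC ((-1) ^ 1) * 2 ^ j) * C_derive zeta (- INR j) + RtoC ((-1) ^ 1) * ln 2 * 2 ^ j * zeta (- INR j))
   + qcoef N j * ((tau N - RtoC ((-1) ^ N) * 2 ^ j) * C_derive zeta (- INR j) + RtoC ((-1) ^ N) * ln 2 * 2 ^ j * zeta (- INR j))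
   = RtoC (qcoef N j * (tau N - (-1) ^ N * 2 ^ (j + 1) * tau j)) * C_derive zeta (- INR j)
     + (if Nat.eqb j 0 then ln 2 else 0))%C.
Proof.
intros Hz HN. assert (S1 : (-1) ^ (N - 1) = - (-1) ^ N) by (replace N with (S (N - 1)) at 2 by lia; simpl; ring).
unfold lower_coef. rewrite pow_add, S1. change (tau 1) with 0. rewrite (pow_1 (-1)).
assert (P2 : RtoC (2 ^ (j + 1)) = (2 * 2 ^ j)%C) by (rewrite pow_add, pow_1, RtoC_mult, RtoC_pow; ring).
rewrite !RtoC_mult, RtoC_minus, !RtoC_mult, P2, RtoC_opp. replace (RtoC (-1)) with (- (1))%C by (rewrite <- RtoC_opp; reflexivity).
destruct (tau_cases j) as [[-> [-> E]]|[-> [-> E]]].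
- replace (zeta (- INR j)%C) with (if Nat.eqb (Nat.div2 j) 0 then RtoC (- / 2) else RtoC 0) by (rewrite E at 2; rewrite zeta_neg_even by exact Hz; reflexivity).
  destruct (Nat.eqb_spec j 0) as [->|NE].
  + simpl Nat.div2. simpl Nat.eqb. cbv iota. rewrite qcoef_0, S1 by exact HN. rewrite RtoC_opp.
    assert (SQ : (RtoC ((-1) ^ N) * RtoC ((-1) ^ N) = 1)%C).
    { rewrite <- RtoC_mult, <- Rpow_mult_distr. replace (-1 * -1) with 1 by ring. rewrite pow1. reflexivity. }
    (* With u = (-1)^N, the equation at j = 0 holds because u^2 = 1; zeta(0) = -1/2 contributes half
       of ln 2 from each factor of the eigenvalue. *)
    rewrite RtoC_opp, RtoC_inv by lra. simpl Cpow.
    set (u := RtoC ((-1) ^ N)) in *. set (z' := C_derive zeta _). set (t := RtoC (tau N)). set (l2 := RtoC (ln 2)).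
    transitivity (u * u * (1 + 1) * z' - u * t * z' + u * u * l2)%C; [field|]. rewrite SQ.
    transitivity (u * u * 2 * z' - u * t * z' + l2)%C; [rewrite SQ; ring|ring].
  + replace (Nat.eqb (Nat.div2 j) 0) with false by (symmetry; apply Nat.eqb_neq; lia). ring.
(* For odd j, where zeta(-j) need not vanish, the two terms containing it have opposite signs and
   cancel. *)
- replace (Nat.eqb j 0) with false by (symmetry; apply Nat.eqb_neq; lia).
  replace (RtoC (-1)) with (- (1))%C by (rewrite <- RtoC_opp; reflexivity). ring.
Qed.

Lemma RP_sum_at_0 zeta F N n e b : is_riemann_zeta zeta -> (2 <= N)%nat ->
  is_hurwitz_zeta (1 + (INR N - 1) / 2 / 2) F ->
  an (RP_sum zeta F N n e b) 0 /\ dv (RP_sum zeta F N n e b) 0 (RP_derivative zeta N n e b).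
Proof.
intros Hz HN HF. assert (N2 : 2 <= INR N) by (apply (le_INR 2), HN).
assert (Hd : 0 < (INR N - 1) / 2) by lra.
assert (AN : forall m j, an (fun s => parity_zeta zeta m (2 * s - INR j)%C) 0).
{ intros m j. apply (an_scaled_arg (parity_zeta zeta m)), an_parity_zeta.
  replace (2 * 0 - INR j)%C with (- INR j)%C by ring. apply zeta_an_neg, Hz. }
split.
- apply an_plus; [apply an_scal, an_plus; [|apply an_plus]|].
  + apply an_csum. intros j _. apply an_scal, AN.
  + apply an_csum. intros j _. apply an_scal, AN.
  + apply (an_ext (fun s => - (1) * Rcpow (INR N - 1) (- (2 * s)))%C); [intros; ring|].
    apply an_scal, an_Rcpow_2. lra.
  + apply an_csum. intros l _. apply an_scal, gfun_at_0; assumption.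
- assert (L1 := dv_csum _ _ _ N (fun j _ => dv_scal _ _ _ (RtoC (lower_coef N j)) (dv_parity_zeta zeta 1 j Hz))).
  assert (L2 := dv_csum _ _ _ N (fun j _ => dv_scal _ _ _ (RtoC (qcoef N j)) (dv_parity_zeta zeta N j Hz))).
  assert (L3 := dv_scal _ _ _ (- (1))%C (dv_Rcpow 0 (INR N - 1) (- (2)) 0 ltac:(lra))).
  assert (L4 := dv_csum _ _ _ n (fun l _ => dv_scal _ _ _ (RtoC (b l)) (proj2 (gfun_at_0 F ((INR N - 1) / 2) (2 * l + e) Hd HF)))).
  assert (K := dv_plus _ _ _ _ _ (dv_scal _ _ _ (/ 2)%C (dv_plus _ _ _ _ _ L1 (dv_plus _ _ _ _ _ L2 L3))) L4).
  apply (dv_ext (fun z => / 2 * (csum (fun j => lower_coef N j * parity_zeta zeta 1 (2 * z - INR j)) N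
     + (csum (fun j => qcoef N j * parity_zeta zeta N (2 * z - INR j)) N + - (1) * Rcpow (INR N - 1) (- (2) * z + 0)))
     + csum (fun l => b l * gfun F ((INR N - 1) / 2) (2 * l + e) z) n)%C).
  { intros s. unfold RP_sum, lower_zeta, upper_zeta. replace (- (2) * s + 0)%C with (- (2 * s))%C by ring. ring. }
  revert K. apply dv_eq. unfold RP_derivative. f_equal.
  replace (- (2) * 0 + 0)%C with (RtoC 0) by ring. rewrite Rcpow_0_r by lra.
  rewrite ln_mult, RtoC_plus by lra.
  match goal with |- Cmult _ (Cplus ?A (Cplus ?B _)) = _ => transitivity (/ 2 * (A + B) + ln (INR N - 1))%C; [field|] end.
  rewrite <- csum_plus, <- csum_scal.
  rewrite (csum_ext _ (fun j => RtoC (qcoef N j * (tau N - (-1) ^ N * 2 ^ (j + 1) * tau j)) * C_derive zeta (- INR j)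
     + (if Nat.eqb j 0 then ln 2 else 0))%C).
  + rewrite csum_plus. replace (csum (fun k => if Nat.eqb k 0 then RtoC (ln 2) else RtoC 0) N) with (RtoC (ln 2)); [ring|].
    destruct N as [|N']; [lia|]. rewrite csum_recl, csum_zero by reflexivity. simpl. ring.
  + intros j _. rewrite <- RP_derivative_terms by assumption. field.
Qed.

Lemma dv_peq f g a l : an f a -> an g a -> peq f g a -> dv g a l -> dv f a l.
Proof.
intros F G P H. assert (E := an_peq_eq f g a F G P). destruct P as [r [Hr P]].
apply (dv_ext_loc g f a l r Hr); [|exact H]. intros h Hh.
destruct (classic (h = 0)) as [->|N]; [rewrite Cplus_0_r; symmetry; exact E|].
symmetry. apply P. split; [apply Cmod_gt_0, N|exact Hh].
Qed.

Lemma RP_zeta_at_0 zeta F zRP N n e b : is_riemann_zeta zeta -> (2 <= N)%nat ->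
  is_hurwitz_zeta (1 + (INR N - 1) / 2 / 2) F -> is_RP_zeta N zRP ->
  (forall k, (1 <= k)%nat -> rsum (fun l => b l * ((INR N - 1) / 2 + 2 * INR k) ^ (2 * l + e)) n = RP_mult N k) ->
  an zRP 0 /\ dv zRP 0 (RP_derivative zeta N n e b).
Proof.
intros Hz HN HF HRP Hb. destruct (RP_sum_cser zeta F N n e b Hz HN HF Hb) as [sigma Hs].
destruct (RP_sum_at_0 zeta F N n e b Hz HN HF) as [A D].
assert (P : peq zRP (RP_sum zeta F N n e b) 0).
{ apply (meromorphic_continuation_eq _ _ _ (-1) sigma 0 HRP); [|exact Hs|simpl; lra].
  intros z Hz'. apply mer_RP_sum; assumption. }
destruct HRP as [HM _].
destruct (meromorphic_removable zRP (fun _ => RtoC 1) _ 0 HM (an_const 0 1) C1_nz A) as [A' _].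
- apply (peq_trans _ zRP); [apply peq_all; intros; ring|exact P].
- split; [exact A'|]. apply (dv_peq _ _ _ _ A' A P D).
Qed.

(** * Reality of the derivative at 0 and the determinant *)

Lemma Cconj_RtoC (x : R) : Cconj x = x.
Proof. unfold Cconj, RtoC. simpl. f_equal. ring. Qed.

Lemma Cconj_Cexp z : Cconj (Cexp z) = Cexp (Cconj z).
Proof. destruct z as [x y]. unfold Cconj, Cexp, Re, Im. simpl. rewrite cos_neg, sin_neg. f_equal. ring. Qed.

Lemma Cconj_Rcpow x z : Cconj (Rcpow x z) = Rcpow x (Cconj z).
Proof.
unfold Rcpow. destruct (Rlt_dec 0 x); [|apply Cconj_RtoC].
rewrite Cconj_Cexp, Cmult_conj, Cconj_RtoC. reflexivity.
Qed.

(** Multiplicities and eigenvalues are real, so the conjugate of the function at the conjugate point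
    continues the same series. The identity theorem makes both agree near 0, and the derivative
    equals its own conjugate. *)
Lemma RP_zeta_derivative_real zRP N l : is_RP_zeta N zRP -> an zRP 0 -> dv zRP 0 l -> Im l = 0.
Proof.
intros HRP A D.
assert (C0 : Cconj 0 = RtoC 0) by apply Cconj_RtoC.
assert (P : peq zRP (fun z => Cconj (zRP (Cconj z))) 0).
{ assert (H := HRP). destruct HRP as [HM [sigma Hs]].
  apply (meromorphic_continuation_eq _ _ _ (-1) sigma 0 H); [| |simpl; lra].
  - intros z _. apply mer_Cconj, meromorphic_mer, HM.
  - intros s Hs'. assert (T := Hs (Cconj s) ltac:(destruct s; exact Hs')). apply is_series_cser, cser_Cconj in T.
    revert T. apply cser_ext. intros j. rewrite Cmult_conj, Cconj_RtoC, Cconj_Rcpow, Copp_conj, Cconj_conj. reflexivity. }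
assert (A' : an (fun z => Cconj (zRP (Cconj z))) 0) by (rewrite <- C0; apply an_Cconj, A).
assert (D' : dv (fun z => Cconj (zRP (Cconj z))) 0 (Cconj l)).
{ destruct D as [r [K [Hr [HK H]]]]. exists r, K. split; [exact Hr|]. split; [exact HK|]. intros h Hh.
  rewrite Cplus_conj, C0. specialize (H (Cconj h)). rewrite Cmod_conj in H. specialize (H Hh).
  rewrite <- Cmod_conj, !Cminus_conj, Cmult_conj, !Cconj_conj. exact H. }
assert (E := dv_unique _ _ _ _ D (dv_peq _ _ _ _ A A' P D')).
destruct l as [x y]. unfold Cconj in E. simpl in E. injection E as E. unfold Im. simpl. lra.
Qed.

Lemma RP_zeta_det zRP N l : is_RP_zeta N zRP -> an zRP 0 -> dv zRP 0 l ->
  analytic_at zRP 0 /\ exists d : R, 0 < d /\ zeta_det zRP = RtoC d /\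
    C_derive zRP 0 = RtoC (- ln d) /\ C_derive zRP 0 = l.
Proof.
intros HRP A D. split; [apply an_analytic_at, A|].
assert (E := dv_C_derive _ _ _ D). assert (I := RP_zeta_derivative_real zRP N l HRP A D).
assert (L : l = RtoC (Re l)) by (destruct l as [x y]; unfold Im in I; simpl in I; rewrite I; reflexivity).
exists (exp (- Re l)). split; [apply exp_pos|]. split; [|split; [|exact E]].
- unfold zeta_det. rewrite E, L, <- RtoC_opp. apply Cexp_RtoC.
- rewrite ln_exp, Ropp_involutive, <- L. exact E.
Qed.

(** * The derivative at 0 in terms of Stirling numbers *)

Lemma csum_even_only (g : nat -> C) m : (forall l, g (2 * l + 1)%nat = 0) ->
  csum g (2 * m + 1) = csum (fun l => g (2 * l)%nat) (S m).
Proof.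
intros H. rewrite Nat.add_1_r. change (csum ?f (S ?k)) with (csum f k + f k)%C. cbv beta.
rewrite csum_double. f_equal. apply csum_ext. intros l _. rewrite H. ring.
Qed.

Lemma sum_n_m_rsum_1 (f : nat -> R) n : sum_n_m f 1 n = rsum (fun i => f (S i)) n.
Proof.
induction n; [rewrite sum_n_m_zero by lia; reflexivity|].
rewrite sum_n_Sm by lia. rewrite IHn. reflexivity.
Qed.

(** For odd N the coefficient reduces to 2^(j+1) [tau j], so only the derivatives at even negative
    integers and at 0 remain. *)
Lemma RP_derivative_odd zeta n : (2 <= n)%nat ->
  RP_derivative zeta (2 * n - 1) n 0 (ubar (n - 1)) =
  (/ INR (fact (2 * n - 2))
   * Csum (fun k => 2 ^ (2 * k + 1) * C_derive zeta (- (2 * INR k))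
       * (stirling1 (2 * n - 1) (2 * k + 1) + stirling1 (2 * n - 2) (2 * k))) 0 (n - 1)
   + ln (4 * (INR n - 1)))%C.
Proof.
intros Hn. unfold RP_derivative.
assert (T : tau (2 * n - 1) = 0 /\ (-1) ^ (2 * n - 1) = -1) by (destruct (tau_cases (2 * n - 1)) as [[_ [_ E]]|[-> [-> _]]]; [lia|auto]).
destruct T as [-> ->].
rewrite (csum_zero _ n).
2: { intros l _. rewrite Nat.add_0_r, gvalue_sum_even. ring. }
rewrite Cplus_0_r. rewrite minus_INR, mult_INR by lia. change (INR 2) with 2. simpl (INR 1).
replace (2 * (2 * INR n - 1 - 1)) with (4 * (INR n - 1)) by ring. f_equal.
rewrite Csum_csum_0, <- csum_scal. replace (2 * n - 1)%nat with (2 * (n - 1) + 1)%nat by lia.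
rewrite csum_even_only.
- apply csum_ext. intros k _. unfold qcoef.
  replace (2 * (n - 1) + 1 - 1)%nat with (2 * n - 2)%nat by lia. replace (2 * (n - 1) + 1)%nat with (2 * n - 1)%nat by lia.
  replace (tau (2 * k)) with 1 by (destruct (tau_cases (2 * k)) as [[-> _]|[_ [_ E]]]; [reflexivity|lia]).
  replace (RtoC (INR (2 * k))) with (2 * INR k)%C by (rewrite mult_INR, RtoC_mult; reflexivity).
  rewrite <- RtoC_plus, <- (RtoC_inv (INR (fact (2 * n - 2)))), <- RtoC_pow by apply INR_fact_neq_0.
  match goal with |- (_ * ?z = _)%C => transitivity (RtoC (/ INR (fact (2 * n - 2)) * 2 ^ (2 * k + 1)
     * (stirling1 (2 * n - 1) (2 * k + 1) + stirling1 (2 * n - 2) (2 * k))) * z)%C end.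
  + f_equal. f_equal. unfold Rdiv. ring.
  + rewrite !RtoC_mult. ring.
- intros l. replace (tau (2 * l + 1)) with 0 by (destruct (tau_cases (2 * l + 1)) as [[_ [_ E]]|[-> _]]; [lia|reflexivity]).
  rewrite !Rmult_0_r, Rminus_0_r, Rmult_0_r. ring.
Qed.

Lemma RP_derivative_even zeta n : (1 <= n)%nat ->
  RP_derivative zeta (2 * n) n 1 (fun i => vbar n (S i) * 2 ^ (2 * i + 1)) =
  (/ INR (fact (2 * n - 1))
   * Csum (fun k => (1 - tau k * 2 ^ (k + 1)) * C_derive zeta (- INR k)
       * (stirling1 (2 * n) (k + 1) + stirling1 (2 * n - 1) k)) 0 (2 * n - 1)
   + ln (4 * INR n - 2)
   + RtoC (sum_n_m (fun i => vbar n i * ((2 * INR n - 1) ^ (2 * i) / (4 * INR i))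
       * (harmonic (i - 1) / 2 - harmonic (2 * i - 1)))%R 1 n))%C.
Proof.
intros Hn. unfold RP_derivative.
assert (T : tau (2 * n) = 1 /\ (-1) ^ (2 * n) = 1) by (destruct (tau_cases (2 * n)) as [[-> [-> _]]|[_ [_ E]]]; [auto|lia]).
destruct T as [-> ->].
rewrite mult_INR. change (INR 2) with 2. f_equal; [f_equal|].
- rewrite Csum_csum_0, <- csum_scal. replace (S (2 * n - 1)) with (2 * n)%nat by lia.
  apply csum_ext. intros k _. unfold qcoef.
  rewrite <- RtoC_plus, <- (RtoC_inv (INR (fact (2 * n - 1)))), <- RtoC_pow by apply INR_fact_neq_0.
  match goal with |- (_ * ?z = _)%C => transitivity (RtoC (/ INR (fact (2 * n - 1)) * (1 - tau k * 2 ^ (k + 1))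
     * (stirling1 (2 * n) (k + 1) + stirling1 (2 * n - 1) k)) * z)%C end.
  + f_equal. f_equal. unfold Rdiv. ring.
  + rewrite !RtoC_mult, !RtoC_minus, !RtoC_mult. ring.
- do 2 f_equal. ring.
- rewrite sum_n_m_rsum_1, RtoC_rsum. apply csum_ext. intros i _.
  rewrite gvalue_sum_odd, <- RtoC_mult. f_equal.
  replace (S i - 1)%nat with i by lia. replace (2 * S i - 1)%nat with (2 * i + 1)%nat by lia.
  replace ((2 * INR n - 1) / 2) with ((2 * INR n - 1) * / 2) by reflexivity. rewrite Rpow_mult_distr.
  replace (2 ^ (2 * i + 1)) with (2 ^ (2 * S i) * / 2) by (replace (2 * S i)%nat with (S (2 * i + 1)) by lia; simpl; field).
  (* The factor 2^(2i+1) beside [vbar] meets the 2^(-2i-2) from the power of d = (2n - 1) / 2. The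
     1/2 that remains is absorbed into the harmonic factor. *)
  assert (P : 2 ^ (2 * S i) * (/ 2) ^ (2 * S i) = 1) by (rewrite <- Rpow_mult_distr, Rinv_r, pow1 by lra; reflexivity).
  match goal with |- ?v * (?p * _) * (?x * ?y * ?h / ?q) = _ => transitivity (v * (x / q) * (h / 2) * (p * y)) end.
  + field. apply not_0_INR. lia.
  + rewrite P. field. apply not_0_INR. lia.
Qed.

Theorem theorem3p3
  (zeta : C -> C) (hzeta : R -> C -> C) (zRP zRPs : nat -> C -> C)
  (Hzeta : is_riemann_zeta zeta)
  (Hhzeta : forall a : R, 0 < a -> is_hurwitz_zeta a (hzeta a))
  (HzRP : forall N : nat, (1 <= N)%nat -> is_RP_zeta N (zRP N))
  (HzRPs : forall N : nat, (1 <= N)%nat -> is_RP_shifted_zeta N (zRPs N))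
  (n : nat) (Hn : (1 <= n)%nat) :
  (forall s : C,
    (forall i : nat, (1 <= i <= n)%nat ->
       analytic_at zeta (2 * s - 2 * INR i + 2)%C) ->
    zRPs (2 * n - 1)%nat s =
      (Csum (fun i =>
          ubar (n - 1) (i - 1)
          * (tau n - (-1) ^ n * Rcpow 2 (2 * INR i - 2 * s - 2))
          * zeta (2 * s - 2 * INR i + 2)) 1 n
       - Rcpow (INR n - 1) (- (2 * s)))%C)
  /\
  (forall s : C,
    (forall i : nat, (1 <= i <= n)%nat ->
       analytic_at (hzeta (5 / 4 + tau n / 2)) (2 * s - 2 * INR i + 1)%C) ->
    zRPs (2 * n)%nat s =
      (Csum (fun i =>
          vbar n i * Rcpow 2 (4 * INR i - 2 * s - 2)
          * hzeta (5 / 4 + tau n / 2)%R (2 * s - 2 * INR i + 1)) 1 n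
       - gamma n * Rcpow (2 / (2 * INR n - 1)) (2 * s))%C)
  /\
  (* the term log(4(n-1)) requires n >= 2 *)
  ((2 <= n)%nat ->
    analytic_at (zRP (2 * n - 1)%nat) 0 /\
    exists d : R, 0 < d /\ zeta_det (zRP (2 * n - 1)%nat) = RtoC d /\
      C_derive (zRP (2 * n - 1)%nat) 0 = RtoC (- ln d) /\
      C_derive (zRP (2 * n - 1)%nat) 0 =
        (/ INR (fact (2 * n - 2))
         * Csum (fun k =>
             2 ^ (2 * k + 1) * C_derive zeta (- (2 * INR k))
             * (stirling1 (2 * n - 1) (2 * k + 1) + stirling1 (2 * n - 2) (2 * k)))
             0 (n - 1)
         + ln (4 * (INR n - 1)))%C)
  /\
  (analytic_at (zRP (2 * n)%nat) 0 /\
   exists d : R, 0 < d /\ zeta_det (zRP (2 * n)%nat) = RtoC d /\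
     C_derive (zRP (2 * n)%nat) 0 = RtoC (- ln d) /\
     C_derive (zRP (2 * n)%nat) 0 =
       (/ INR (fact (2 * n - 1))
        * Csum (fun k =>
            (1 - tau k * 2 ^ (k + 1)) * C_derive zeta (- INR k)
            * (stirling1 (2 * n) (k + 1) + stirling1 (2 * n - 1) k))
            0 (2 * n - 1)
        + ln (4 * INR n - 2)
        + RtoC (sum_n_m (fun i =>
            vbar n i * ((2 * INR n - 1) ^ (2 * i) / (4 * INR i))
            * (harmonic (i - 1) / 2 - harmonic (2 * i - 1)))%R 1 n))%C).
Proof.
(* The auxiliary Hurwitz function has parameter 1 + d/2 with d = (N - 1) / 2; it is unrelated to the
   parameter 5/4 + tau n / 2 of the second identity. *)
assert (Hh : forall d, 0 < d -> is_hurwitz_zeta (1 + d / 2) (hzeta (1 + d / 2))) by (intros d Hd; apply Hhzeta; lra).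
assert (N1 : 1 <= INR n) by (apply (le_INR 1), Hn).
split; [|split; [|split]].
- intros s Hs. rewrite (shifted_zeta_odd zeta _ n Hzeta (HzRPs (2 * n - 1)%nat ltac:(lia)) Hn s).
  + rewrite Csum_csum_1. f_equal. apply csum_ext. intros i _. replace (S i - 1)%nat with i by lia.
    replace (2 * s - INR (2 * i))%C with (2 * s - 2 * INR (S i) + 2)%C
      by (rewrite mult_INR, (S_INR i), RtoC_mult, RtoC_plus; change (INR 2) with 2; ring).
    unfold parity_zeta. rewrite RtoC_pow.
    replace (- (2 * s - 2 * INR (S i) + 2))%C with (2 * INR (S i) - 2 * s - 2)%C by ring. ring.
  + intros i Hi. apply an_analytic_at.
    replace (2 * s - INR (2 * i))%C with (2 * s - 2 * INR (S i) + 2)%C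
      by (rewrite mult_INR, (S_INR i), RtoC_mult, RtoC_plus; change (INR 2) with 2; ring).
    apply Hs. lia.
- intros s Hs. assert (TP : 0 <= tau n) by (destruct (tau_cases n) as [[-> _]|[-> _]]; lra).
  rewrite (shifted_zeta_even _ _ n (Hhzeta (5 / 4 + tau n / 2) ltac:(lra)) (HzRPs (2 * n)%nat ltac:(lia)) Hn s).
  + rewrite Csum_csum_1. f_equal; [|f_equal].
    * apply csum_ext. intros i _.
      replace (2 * s - INR (2 * i + 1))%C with (2 * s - 2 * INR (S i) + 1)%C
        by (rewrite plus_INR, mult_INR, (S_INR i), !RtoC_plus, RtoC_mult; change (INR 2) with 2; simpl (INR 1); ring).
      rewrite RtoC_mult, <- Rcpow_INR by lra.
      transitivity (vbar n (S i) * (Rcpow 2 (INR (2 * i + 1)) * Rcpow 2 (- (2 * s - 2 * INR (S i) + 1)))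
         * hzeta (5 / 4 + tau n / 2)%R (2 * s - 2 * INR (S i) + 1))%C; [ring|].
      rewrite <- Rcpow_plus by lra. do 3 f_equal.
      rewrite plus_INR, mult_INR, (S_INR i), !RtoC_plus, RtoC_mult; change (INR 2) with 2; simpl (INR 1). ring.
    * unfold gamma. destruct (Nat.leb_spec n 2) as [L|L].
      -- replace (Nat.div2 (n - 1)) with O by (destruct n as [|[|[|]]]; [lia|reflexivity|reflexivity|lia]). simpl. ring.
      -- replace (Nat.eqb (Nat.div2 (n - 1)) 0) with false
           by (symmetry; apply Nat.eqb_neq; generalize (div2_pos (n - 1) ltac:(lia)); lia).
         replace (2 / (2 * INR n - 1)) with (/ (INR n - / 2)) by (field; lra). rewrite Rcpow_inv_base by lra. ring.
  + intros i Hi. apply an_analytic_at.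
    replace (2 * s - INR (2 * i + 1))%C with (2 * s - 2 * INR (S i) + 1)%C
      by (rewrite plus_INR, mult_INR, (S_INR i), !RtoC_plus, RtoC_mult; change (INR 2) with 2; simpl (INR 1); ring).
    apply Hs. lia.
- intros Hn2. assert (N2 : 2 <= INR n) by (apply (le_INR 2), Hn2).
  (* In odd dimension the multiplicity is an even polynomial in w, hence e = 0; in even dimension it
     is odd, hence e = 1 below. *)
  destruct (RP_zeta_at_0 zeta (hzeta (1 + (INR (2 * n - 1) - 1) / 2 / 2)) (zRP (2 * n - 1)%nat) (2 * n - 1) n 0 (ubar (n - 1))) as [A D].
  + exact Hzeta.
  + lia.
  + apply Hh. rewrite INR_double_sub_1; [lra|lia].
  + apply HzRP. lia.
  + intros k Hk. rewrite INR_double_sub_1 by lia. rewrite <- RP_mult_odd by lia.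
    apply rsum_ext. intros l _. rewrite Nat.add_0_r. reflexivity.
  + rewrite RP_derivative_odd in D by exact Hn2. apply (RP_zeta_det _ (2 * n - 1)); [apply HzRP; lia|exact A|exact D].
- assert (E2 : (INR (2 * n) - 1) / 2 = INR n - / 2) by (rewrite mult_INR; change (INR 2) with 2; field).
  destruct (RP_zeta_at_0 zeta (hzeta (1 + (INR (2 * n) - 1) / 2 / 2)) (zRP (2 * n)%nat) (2 * n) n 1
    (fun i => vbar n (S i) * 2 ^ (2 * i + 1))) as [A D].
  + exact Hzeta.
  + lia.
  + apply Hh. rewrite E2. lra.
  + apply HzRP. lia.
  + intros k Hk. rewrite E2. apply RP_mult_even; assumption.
  + rewrite RP_derivative_even in D by exact Hn. apply (RP_zeta_det _ (2 * n)); [apply HzRP; lia|exact A|exact D].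
Qed.
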